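(* Let $G=(V,E)$ be an input graph with arboricity $a$ and diameter $D$ in the Node-Capacitated Clique model, and let $s\in V$. There is an algorithm that computes a BFS tree rooted at $s$ in $O((a+D+\log n)\log n)$ rounds, w.h.p.; i.e., at termination every node $u$ knows $\delta(u)$, the length of a shortest (unweighted) path from $s$ to $u$ in $G$, and $\pi(u)$, the predecessor of $u$ on a shortest path from $s$ to $u$, ties broken in favor of the smallest identifier.
   Context: Node-Capacitated Clique model: a set $V$ of $n$ nodes with unique identifiers from $\{0,\dots,n-1\}$, all known to every node; synchronous rounds; per round each node may perform arbitrary local computation and send distinct messages of $O(\log n)$ bits to up to $O(\log n)$ other nodes, and receives at most $O(\log n)$ messages (excess dropped arbitrarily). Initially each node knows only the identifiers of its neighbors in $G$. Shared (pseudo-)random hash functions behave as perfectly random functions. Arboricity: minimum number of forests partitioning the edge set. Diameter: maximum length of a shortest path between two nodes. ''W.h.p.'' means with probability at least $1-1/n^c$ for any fixed constant $c>0$. *)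

(* Defs.v *)
From mathcomp Require Import all_boot.
Set Implicit Arguments.
Unset Strict Implicit.
Unset Printing Implicit Defensive.

(* "log n", made >= 1 so that O(log n) capacities are nonzero for n = 1. *)
Definition logc (n : nat) : nat := (trunc_log 2 n).+1.

Fixpoint walkb (n : nat) (G : rel 'I_n) (k : nat) (u v : 'I_n) : bool :=
  match k with
  | 0 => u == v
  | k'.+1 => [exists w, G u w && walkb G k' w v]
  end.

Definition is_distb (n : nat) (G : rel 'I_n) (u v : 'I_n) (d : nat) : bool :=
  walkb G d u v && [forall k : 'I_d, ~~ walkb G k u v].

(* D is the diameter: max over all pairs of the shortest-path distance
   (in particular the graph is connected). *)
Definition is_diameter (n : nat) (G : rel 'I_n) (D : nat) : Prop :=
  (forall u v, exists2 d, d <= D & is_distb G u v d) /\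
  (exists u v, is_distb G u v D).

Definition forest (n : nat) (F : rel 'I_n) : Prop :=
  forall cyc : seq 'I_n, uniq cyc -> 2 < size cyc -> ~~ cycle F cyc.

Definition forest_partition (n : nat) (G : rel 'I_n) (k : nat) : Prop :=
  exists col : 'I_n -> 'I_n -> nat,
    (forall u v, G u v -> col u v = col v u /\ col u v < k) /\
    (forall i, forest [rel u v | G u v && (col u v == i)]).

Definition is_arboricity (n : nat) (G : rel 'I_n) (a : nat) : Prop :=
  forest_partition G a /\ (forall k, forest_partition G k -> a <= k).

Definition neighbors (n : nat) (G : rel 'I_n) (v : 'I_n) : {set 'I_n} :=
  [set u | G v u].

(* A (randomized) NCC algorithm, given for every network size n.
   Rnd n : the finite space of shared random seeds (uniformly distributed);
   init : own id, "am I the source s", ids of neighbours, shared seed;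
   send : per round, at most one message (a bit string) per destination;
   recv : new state from the delivered (sender, message) list;
   output : Some (delta, pi) once the node terminates. *)
Record NCCAlg := {
  St : nat -> Type;
  Rnd : nat -> finType;
  init : forall n, 'I_n -> bool -> {set 'I_n} -> Rnd n -> St n;
  send : forall n, St n -> 'I_n -> option (seq bool);
  recv : forall n, St n -> seq ('I_n * seq bool) -> St n;
  output : forall n, St n -> option (nat * option 'I_n)
}.

(* capacity enforcement: at most cap destinations (the first ones by id),
   each message truncated to cap bits *)
Definition dests (A : NCCAlg) (n cap : nat) (st : St A n) : seq 'I_n :=
  take cap [seq d <- enum 'I_n | isSome (@send A n st d)].

Definition msg_to (A : NCCAlg) (n cap : nat) (st : St A n) (w : 'I_n)
  : option (seq bool) :=
  if w \in @dests A n cap st then omap (take cap) (@send A n st w) else None.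

Definition incoming (A : NCCAlg) (n cap : nat) (st : 'I_n -> St A n) (w : 'I_n)
  : seq ('I_n * seq bool) :=
  pmap (fun v => omap (fun m => (v, m)) (@msg_to A n cap (st v) w)) (enum 'I_n).

(* adversary choosing which messages are delivered (fully adaptive: it knows
   the seed, the round, the receiver and the incoming messages) *)
Definition Adv (A : NCCAlg) (n : nat) :=
  Rnd A n -> nat -> 'I_n -> seq ('I_n * seq bool) -> seq ('I_n * seq bool).

(* receive capacity cap: if more than cap messages arrive, an arbitrary
   subset of exactly cap of them is delivered; otherwise all are. *)
Definition valid_adv (A : NCCAlg) (n cap : nat) (adv : Adv A n) : Prop :=
  forall r t w l, subseq (adv r t w l) l /\ size (adv r t w l) = minn (size l) cap.

Fixpoint exec (A : NCCAlg) (n : nat) (G : rel 'I_n) (s : 'I_n) (cap : nat)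
  (adv : Adv A n) (r : Rnd A n) (t : nat) : 'I_n -> St A n :=
  match t with
  | 0 => fun v => @init A n v (v == s) (neighbors G v) r
  | t'.+1 =>
      let st := @exec A n G s cap adv r t' in
      fun w => @recv A n (st w) (adv r t' w (@incoming A n cap st w))
  end.

(* the (irrevocable) output of v within the first T rounds: the first output *)
Fixpoint decided (A : NCCAlg) (n : nat) (G : rel 'I_n) (s : 'I_n) (cap : nat)
  (adv : Adv A n) (r : Rnd A n) (T : nat) (v : 'I_n) : option (nat * option 'I_n) :=
  match T with
  | 0 => @output A n (@exec A n G s cap adv r 0 v)
  | T'.+1 => if @decided A n G s cap adv r T' v is Some x then Some x
             else @output A n (@exec A n G s cap adv r T v)
  end.

Definition correct_output (n : nat) (G : rel 'I_n) (s v : 'I_n)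
  (o : option (nat * option 'I_n)) : bool :=
  match o with
  | Some (d, p) =>
      is_distb G s v d &&
      (if v == s then p == None else
       match p with
       | Some u => [&& G u v, is_distb G s u d.-1 &
                    [forall w, (G w v && is_distb G s w d.-1) ==> (u <= w)]]
       | None => false
       end)
  | None => false
  end.

Definition bfs_success (A : NCCAlg) (n : nat) (G : rel 'I_n) (s : 'I_n)
  (cap : nat) (adv : Adv A n) (r : Rnd A n) (T : nat) : bool :=
  [forall v, correct_output G s v (@decided A n G s cap adv r T v)].

(* Main.v *)
Require Import Defs.
From mathcomp Require Import all_boot.
From mathcomp Require Import zify.
Set Implicit Arguments.
Unset Strict Implicit.
Unset Printing Implicit Defensive.

(** Every node [v] owns a binary trie on the identifiers: the leaf [(v, 0, u)]
    stands for the edge [{v, u}], the parent of a trie node halves its key, and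
    the root is [(v, L, 0)] with [L = logc n]. Trie nodes are hosted at
    uniformly random nodes, and every message of a step that lasts [R] rounds is
    sent in a uniformly random round. What is computed does not depend on this
    randomness, so the messages of every step are fixed by the graph, and a
    binomial tail bound with a union bound over the steps shows that w.h.p. no
    node ever exceeds its capacity; then the adversary has no choice and the
    real execution follows the ideal one.

    The ideal computation proceeds in phases. A phase begins with an all-reduce
    that tells everybody how many edges still have to be inserted into the tries
    and how many edges the current BFS layer has; this fixes the step length
    [R]. While edges are missing, every node with at most about twice the average
    number of missing edges finds them by comparing the counters of its trie,
    top-down, with its own adjacency list, and inserts them into both tries;
    this halves the number of nodes with missing edges, and the arboricity
    bounds the average. Once all edges are inserted, a phase advances the BFS by
    one layer: the layer broadcasts down its tries, every leaf signals its
    mirror leaf, and the minimal identifiers are collected upwards. A phase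
    costs [O(L)] rounds plus a load term, and the load terms sum up to
    [O(a * L)]. *)

(** * Binomial tails and independence *)

(** A star has arboricity 1 and a centre of degree [n - 1], so a node cannot afford to handle its
    incident edges one by one. Hence adjacency lives in structures spread over all hosts, and one
    endpoint with few missing edges inserts an edge on behalf of both. Such a node has to search,
    because it only learns how many of its edges the other endpoints have inserted, not which;
    descending only where a counter falls short costs time in proportion to what is missing.

    A node sends at most one message per destination and round, so all packets between two hosts
    share one message of [O(log n)] bits. Two thresholds result: [O(log n)] packets sent or received
    per host, but only a constant number [Q] per ordered pair of hosts. Messages that share a trie
    node have dependent hosts; they are split into a constant number of colour classes, independent
    inside each class, and the tail bound is applied class by class.

    At most [L] insertion phases cost [O(a + L)] rounds each. The load terms of the BFS phases sum
    to [O(a)] only, since the degrees of all layers together are at most [2 * a * n] and are spread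
    over [n] hosts. *)

Lemma card_bigcup_leq (I T : finType) (D : pred I) (F : I -> {set T}) :
  #|\bigcup_(i | D i) F i| <= \sum_(i | D i) #|F i|.
Proof.
elim/big_ind2: _ => [|x1 x2 y1 y2 h1 h2|//]; first by rewrite cards0.
by apply: leq_trans (leq_card_setU _ _) _; rewrite leq_add.
Qed.

(** Division by [m] is injective on a residue class and takes values below [B %/ m]. *)
Lemma card_modn_eq (m B c : nat) : 0 < m -> m %| B ->
  #|[pred b : 'I_B | b %% m == c]| * m <= B.
Proof.
move=> m_gt0 dv.
have lt_div (b : 'I_B) : b %/ m < B %/ m.
  by rewrite ltn_divLR // divnK.
pose g (b : 'I_B) : 'I_(B %/ m) := Ordinal (lt_div b).
rewrite -leq_divRL // -[X in _ <= X]card_ord -(card_in_imset (f := g)).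
  exact: max_card.
move=> b1 b2; rewrite !inE => /eqP e1 /eqP e2 /(congr1 val) /= e.
by apply: val_inj; rewrite /= (divn_eq b1 m) (divn_eq b2 m) e e1 e2.
Qed.

(** A crude substitute for Stirling: [q ^ q] is at most a falling factorial of [q + q], which is a
    central binomial coefficient times the factorial of [q]. *)
Lemma expnn_leq_fact (q : nat) : q ^ q <= 4 ^ q * q`!.
Proof.
have le1 m : q ^ m <= (q + m) ^_ m.
  elim: m => // m IHm.
  by rewrite addnS ffactnS /= expnS leq_mul // -addnS leq_addr.
apply: leq_trans (le1 q) _.
rewrite -bin_ffact leq_mul2r; apply/orP; right.
have -> : 4 ^ q = 2 ^ (q + q) by rewrite expnD -expnMn.
have -> : 2 ^ (q + q) = \sum_(i < (q + q).+1) 'C(q + q, i).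
  rewrite -[2]/(1 + 1) expnDn; apply: eq_bigr => i _.
  by rewrite !exp1n !muln1.
have lt : q < (q + q).+1 by lia.
by rewrite (bigD1 (Ordinal lt)) //= leq_addr.
Qed.

Lemma ffact_leq_expn (N q : nat) : N ^_ q <= N ^ q.
Proof.
elim: q N => // q IHq N; rewrite ffactnS expnS leq_mul2l; apply/orP; right.
apply: leq_trans (IHq _) _; case: q {IHq} => // q.
by rewrite leq_exp2r // leq_pred.
Qed.

(** The bound of the binomial coefficient by the [q]-th power of [4 * N / q], written without
    division. *)
Lemma bin_leq_expn (N q : nat) : 'C(N, q) * q ^ q <= 4 ^ q * N ^ q.
Proof.
apply: (@leq_trans ('C(N, q) * (4 ^ q * q`!))).
  by rewrite leq_mul2l expnn_leq_fact orbT.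
by rewrite mulnCA leq_mul2l bin_ffact ffact_leq_expn orbT.
Qed.

(** * Independent coordinates of a uniform seed *)

Section Independence.

Variables (Z I : finType) (B : nat) (A : {set I}) (s : I -> {set Z}).
Variables (md : Z -> nat) (val_ : I -> Z -> nat).
Hypothesis disj : {in A &, forall i j, i != j -> [disjoint s i & s j]}.
Hypothesis md_gt0 : forall z, 0 < md z.
Hypothesis md_dvd : forall z, md z %| B.

Definition event (i : I) (f : {ffun Z -> 'I_B}) :=
  [forall z in s i, f z %% md z == val_ i z].

(** The seeds that satisfy all events form a product over the coordinates. By disjointness a
    coordinate is constrained by at most one event, which costs it the factor [md z]. *)
Lemma card_events (Q : {set I}) : Q \subset A ->
  #|[set f | [forall i in Q, event i f]]| * (\prod_(i in Q) \prod_(z in s i) md z)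
    <= #|{ffun Z -> 'I_B}|.
Proof.
move=> sQA.
pose F (z : Z) : pred 'I_B :=
  [pred b : 'I_B | [forall i in Q, (z \in s i) ==> (b %% md z == val_ i z)]].
have -> : [set f | [forall i in Q, event i f]] =
          [set f : {ffun Z -> 'I_B} | f \in family F].
  apply/setP=> f; rewrite !inE; apply/forall_inP/familyP => [H z|H i iQ].
    rewrite inE; apply/forall_inP => i iQ; apply/implyP => zi.
    exact: (forall_inP (H i iQ)).
  apply/forall_inP => z zi; have := H z; rewrite inE.
  by move/forall_inP/(_ i iQ)/implyP/(_ zi).
rewrite cardsE card_family card_ffun card_ord.
have -> : \prod_(i in Q) \prod_(z in s i) md z =
          \prod_(z : Z) \prod_(i in Q | z \in s i) md z.
  by rewrite (exchange_big_dep xpredT).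
have -> : foldr muln 1 [seq #|F x| | x : Z] = \prod_(z : Z) #|F z|.
  by rewrite -big_enum foldrE big_map.
rewrite -big_split /= -prod_nat_const.
apply: leq_prod => z _.
case: (pickP [pred i in Q | z \in s i]) => [i0 /= /andP [iQ zi]|none].
  rewrite (bigD1 i0) /=; last by rewrite iQ zi.
  rewrite big1 ?muln1; last first.
    move=> j /andP [/andP [jQ zj] nji].
    have := disj (subsetP sQA _ jQ) (subsetP sQA _ iQ) nji.
    by move/pred0P/(_ z); rewrite /= zj zi.
  apply: leq_trans (card_modn_eq (val_ i0 z) (md_gt0 z) (md_dvd z)).
  rewrite leq_mul2r; apply/orP; right; apply: subset_leq_card.
  apply/subsetP => b; rewrite !inE => /forall_inP /(_ i0 iQ).
  by rewrite zi.
rewrite big_pred0 => [|i]; last by have := none i; rewrite inE.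
by rewrite muln1 -[X in _ <= X]card_ord max_card.
Qed.

(** Union bound over the [q]-subsets of [A]: each occurs jointly with probability at most
    [P ^ -q]. *)
Lemma card_many_events (P q : nat) :
    {in A, forall i, \prod_(z in s i) md z = P} ->
  #|[set f | q <= #|[set i in A | event i f]|]| * P ^ q
    <= 'C(#|A|, q) * #|{ffun Z -> 'I_B}|.
Proof.
move=> prodP.
pose draws := [set Q : {set I} | Q \subset A & #|Q| == q].
apply: (@leq_trans (\sum_(Q in draws)
          #|[set f | [forall i in Q, event i f]]| * P ^ q)).
  rewrite -big_distrl /= leq_mul2r; apply/orP; right.
  apply: (@leq_trans #|\bigcup_(Q in draws)
                       [set f | [forall i in Q, event i f]]|); last first.
    exact: card_bigcup_leq.
  apply: subset_leq_card; apply/subsetP => f; rewrite inE => le_q.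
  have [Q sQ cQ] : exists2 Q : {set I}, Q \subset [set i in A | event i f]
                                     & #|Q| = q.
    have : 0 < #|[set Q : {set I} | Q \subset [set i in A | event i f]
                                 & #|Q| == q]|.
      by rewrite cards_draws bin_gt0.
    by case/card_gt0P => Q; rewrite inE => /andP [? /eqP ?]; exists Q.
  apply/bigcupP; exists Q; rewrite ?inE.
    rewrite cQ eqxx andbT; apply/subsetP => i /(subsetP sQ).
    by rewrite inE => /andP [].
  by apply/forall_inP => i /(subsetP sQ); rewrite inE => /andP [].
rewrite -cards_draws -/draws -sum_nat_const.
apply: leq_sum => Q; rewrite inE => /andP [sQA /eqP <-].
apply: leq_trans (card_events sQA).
rewrite -prod_nat_const [X in _ <= _ * X](eq_bigr (fun=> P)) //.
by move=> i /(subsetP sQA); apply: prodP.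
Qed.

End Independence.

(** For a mean [N / P] of at most [q / 8], the bound becomes [2 ^ -q]. This serves the loads of a
    single host, where [q] is of order [log n]. *)
Lemma bin_tail_log (N P q : nat) : 8 * N <= q * P -> 'C(N, q) * 2 ^ q <= P ^ q.
Proof.
move=> le8; case: (posnP q) => [->|q_gt0]; first by rewrite bin0.
have q4 : 0 < 4 ^ q * q ^ q by rewrite muln_gt0 !expn_gt0 q_gt0.
rewrite -(leq_pmul2l q4).
have -> : 4 ^ q * q ^ q * ('C(N, q) * 2 ^ q) = 'C(N, q) * q ^ q * 8 ^ q.
  rewrite -[8]/(4 * 2) expnMn; nia.
apply: (@leq_trans (4 ^ q * N ^ q * 8 ^ q)).
  by rewrite leq_mul2r bin_leq_expn orbT.
have -> : 4 ^ q * N ^ q * 8 ^ q = 4 ^ q * (8 * N) ^ q by rewrite expnMn; nia.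
by rewrite -mulnA -[q ^ q * _]expnMn leq_mul2l leq_exp2r // le8 orbT.
Qed.

(** For a mean of at most [l / n], the constant threshold [2 * e] already gives [n ^ -e]: half of
    the exponent pays for [l], which is about the square root of [n] at most. This serves the loads
    of pairs of hosts. *)
Lemma bin_tail_poly (N P n l e : nat) : 0 < n -> 0 < e ->
    N * n <= l * P -> 4 * l ^ 2 <= e ^ 2 * n ->
  'C(N, 2 * e) * n ^ e <= P ^ (2 * e).
Proof.
move=> n_gt0 e_gt0 leN lel; set q := 2 * e.
have q_gt0 : 0 < q by rewrite /q; lia.
have c_gt0 : 0 < q ^ q * n ^ e by rewrite muln_gt0 !expn_gt0 n_gt0 q_gt0.
rewrite -(leq_pmul2r c_gt0).
have -> : 'C(N, q) * n ^ e * (q ^ q * n ^ e) = 'C(N, q) * q ^ q * n ^ q.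
  by have -> : n ^ q = n ^ e * n ^ e; [rewrite /q mul2n -addnn expnD | rewrite mulnACA].
apply: (@leq_trans (4 ^ q * N ^ q * n ^ q)).
  by rewrite leq_mul2r bin_leq_expn orbT.
rewrite -mulnA -[N ^ q * _]expnMn.
apply: (@leq_trans (4 ^ q * (l * P) ^ q)).
  by rewrite leq_mul2l leq_exp2r // leN orbT.
rewrite expnMn mulnA -[4 ^ q * _]expnMn [P ^ q * _]mulnC leq_mul2r; apply/orP; right.
rewrite /q !expnM -expnMn leq_exp2r //.
nia.
Qed.

(** * Loads of a step under random hosting *)

Section Loads.

Variables (n N : nat) (V : finType).
Hypotheses (n_gt0 : 0 < n) (leqnN : n <= N).

Definition vnode : finType := ('I_n + V)%type.
Definition rvar : finType := (V + vnode * vnode)%type.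
(* All moduli used below are at most [N], hence divide [N`!], so reducing a
   coordinate of the seed modulo any of them is exactly uniform. *)
Definition seed : finType := {ffun rvar -> 'I_N`!}.

Definition hosted (f : seed) (x : vnode) (w : 'I_n) : bool :=
  match x with inl u => u == w | inr y => f (inl y) %% n == w :> nat end.

Definition slot (f : seed) (R : nat) (p : vnode * vnode) : nat :=
  f (inr p) %% R.

Definition isreal (x : vnode) : bool := if x is inl _ then true else false.

Definition host_var (b : bool) (x : vnode) : {set rvar} :=
  if x is inr y then if b then [set inl y] else set0 else set0.

(* [us] and [ud] tell whether the host of the source and of the destination
   are prescribed: send load, receive load and load of a pair of nodes are the
   cases (true, false), (false, true) and (true, true). *)
Definition msg_vars (us ud : bool) (p : vnode * vnode) : {set rvar} :=
  inr p |: (host_var us p.1 :|: host_var ud p.2).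

Definition in_load (us ud : bool) (w w' : 'I_n) (R rho : nat) (f : seed)
    (p : vnode * vnode) : bool :=
  [&& slot f R p == rho, us ==> hosted f p.1 w & ud ==> hosted f p.2 w'].

Lemma in_host_var b x z :
  (z \in host_var b x) = if z is inl y then b && (x == inr y) else false.
Proof.
case: x => [u|y] /=; case: z => [y'|p] //=; rewrite ?inE ?andbF //.
- by case: b; rewrite ?inE // eq_sym.
- by case: b; rewrite inE.
Qed.

(** Each message of [A] has its own slot variable and, if prescribed and virtual, its own host
    variables, so the events are independent. A real endpoint is not random and contributes the
    factor 1 to [P]. *)
Lemma card_load (A : {set vnode * vnode}) (us ud : bool) (w w' : 'I_n)
    (R rho P q : nat) :
    0 < R <= N ->
    {in A &, forall p p', p != p' ->
      [/\ forall y, p.1 = inr y -> p'.1 <> inr y,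
          forall y, p.2 = inr y -> p'.2 <> inr y
        & forall y, p.1 = inr y -> p'.2 <> inr y]} ->
    {in A, forall p, p.1 != p.2} ->
    {in A, forall p, R * (if us && ~~ isreal p.1 then n else 1) *
                     (if ud && ~~ isreal p.2 then n else 1) = P} ->
  #|[set f | q <= #|[set p in A | in_load us ud w w' R rho f p]|]| * P ^ q
    <= 'C(#|A|, q) * #|seed|.
Proof.
move=> /andP [R_gt0 leRN] sepA neqA prodA.
pose md (z : rvar) := if z is inl _ then n else R.
pose vl (p : vnode * vnode) (z : rvar) : nat :=
  if z is inl y then if us && (p.1 == inr y) then w else w' else rho.
have md_gt0 z : 0 < md z by case: z.
have md_dvd z : md z %| N`! by case: z => *; apply: dvdn_fact; apply/andP.
have disj : {in A &, forall p p', p != p' ->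
                 [disjoint msg_vars us ud p & msg_vars us ud p']}.
  move=> p p' pA p'A npp'; have [h1 h2 h3] := sepA p p' pA p'A npp'.
  have np'p : p' != p by rewrite eq_sym.
  (* The last clause of [sepA] compares one source with the other destination, so the swapped
     instance covers the opposite pairing. *)
  have [_ _ h4] := sepA p' p p'A pA np'p.
  apply/pred0P => z /=; rewrite !in_setU1 !in_setU !in_host_var.
  case: z => [y|p0] /=; last first.
    rewrite !orbF; apply/negP => /andP [/eqP [e1] /eqP [e2]].
    by move: npp'; rewrite -e1 e2 eqxx.
  apply/negP => /andP [].
  by move=> /orP [] /andP [_ /eqP e1] /orP [] /andP [_ /eqP e2];
    [apply: (h1 y)|apply: (h3 y)|apply: (h4 y)|apply: (h2 y)].
have prod_md : {in A, forall p, \prod_(z in msg_vars us ud p) md z = P}.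
  move=> p pA; rewrite -(prodA p pA) big_setU1 /=; last first.
    by rewrite in_setU !in_host_var.
  rewrite -mulnA; congr (_ * _).
  have prod_hv b x : \prod_(z in host_var b x) md z =
                     if b && ~~ isreal x then n else 1.
    by case: x => [u|y]; case: b; rewrite /= ?big_set0 ?big_set1.
  rewrite -!prod_hv -bigU /=; first by apply: eq_bigl => z; rewrite !inE.
  apply/pred0P => z /=; rewrite !in_host_var.
  case: z => // y; apply/negP => /andP [/andP [_ /eqP e1] /andP [_ /eqP e2]].
  by have := neqA p pA; rewrite e1 e2 eqxx.
apply: leq_trans (card_many_events vl disj md_gt0 md_dvd q prod_md).
rewrite leq_mul2r; apply/orP; right.
apply: subset_leq_card; apply/subsetP => f; rewrite !inE => le_q.
apply: leq_trans le_q _; apply: subset_leq_card; apply/subsetP => p.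
rewrite !inE => /andP [pA /and3P [hs h1 h2]]; rewrite pA /=.
apply/forall_inP => z; rewrite !in_setU1 !in_setU !in_host_var.
case: z => [y|p0] /=; last by rewrite orbF => /eqP [->].
case: (boolP (us && (p.1 == inr y))) => [/andP [us1 /eqP e1] _|_ /=].
  by move: h1; rewrite us1 e1 /=.
case/andP => ud1 /eqP e2; by move: h2; rewrite ud1 e2.
Qed.

Variables (K : finType) (col : vnode * vnode -> K) (allowed : pred (vnode * vnode)).
Hypothesis col_sep : forall p p', allowed p -> allowed p' -> col p = col p' ->
  p != p' ->
  [/\ forall y, p.1 = inr y -> p'.1 <> inr y,
      forall y, p.2 = inr y -> p'.2 <> inr y
    & forall y, p.1 = inr y -> p'.2 <> inr y].
Hypothesis allowed_neq : forall p, allowed p -> p.1 != p.2.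

(** Spread over [R] rounds, every bound says [l] messages per node and round on average; messages
    between virtual nodes are averaged over all [n] hosts as well. *)
Record load_ok (l R : nat) (M : {set vnode * vnode}) : Prop := LoadOk {
  load_allowed : {in M, forall p, allowed p};
  load_RR1 : forall w, #|[set p in M | p.1 == inl w & isreal p.2]| <= 1;
  load_RR2 : forall w, #|[set p in M | isreal p.1 & p.2 == inl w]| <= 1;
  load_RV : forall w, #|[set p in M | p.1 == inl w & ~~ isreal p.2]| <= l * R;
  load_VR : forall w, #|[set p in M | ~~ isreal p.1 & p.2 == inl w]| <= l * R;
  load_VV : #|[set p in M | ~~ isreal p.1 & ~~ isreal p.2]| <= l * (n * R)
}.

Definition good_step (c1 c2 R : nat) (M : {set vnode * vnode}) (f : seed) : bool :=
  [forall rho : 'I_R, forall w : 'I_n, forall w' : 'I_n,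
    [&& #|[set p in M | in_load true false w w' R rho f p]| <= c1,
        #|[set p in M | in_load false true w w' R rho f p]| <= c1
      & #|[set p in M | in_load true true w w' R rho f p]| <= c2]].

(** Recording the kinds of both ends makes the probability [1 / P] the same for all messages of a
    class. *)
Definition class_of (p : vnode * vnode) : K * bool * bool :=
  (col p, isreal p.1, isreal p.2).

Lemma card_class_load (l R q1 e : nat) (M : {set vnode * vnode})
    (c : K * bool * bool) (us ud : bool) (w w' : 'I_n) (rho : nat) :
    0 < R <= N -> load_ok l R M -> us || ud ->
    0 < l -> 8 * l <= q1 -> n ^ e <= 2 ^ q1 ->
    0 < e -> 4 * l ^ 2 <= e ^ 2 * n ->
  #|[set f | (if us && ud then 2 * e else q1) <=
      #|[set p in M | (class_of p == c) && in_load us ud w w' R rho f p]|]| * n ^ e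
    <= #|seed|.
Proof.
case: c => [[k b1] b2] RN [al rr1 rr2 rv vr vv] usd l_gt0 le8 le2 e_gt0 le4.
(* Only messages whose prescribed real ends are [w] and [w'] can contribute; discarding the others
   is what makes [A] small when an end is not random. *)
pose A := [set p in M | [&& class_of p == (k, b1, b2),
             (us && b1) ==> (p.1 == inl w) & (ud && b2) ==> (p.2 == inl w')]].
pose P := R * (if us && ~~ b1 then n else 1) * (if ud && ~~ b2 then n else 1).
set q := if _ then _ else _.
have A_sub : {subset A <= M} by move=> p; rewrite inE => /andP [].
have A_cl p : p \in A -> class_of p = (k, b1, b2).
  by rewrite inE => /and4P [_ /eqP].
have sepA : {in A &, forall p p', p != p' ->
      [/\ forall y, p.1 = inr y -> p'.1 <> inr y,
          forall y, p.2 = inr y -> p'.2 <> inr y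
        & forall y, p.1 = inr y -> p'.2 <> inr y]}.
  move=> p p' pA p'A; apply: col_sep; rewrite ?al ?A_sub //.
  by have := A_cl p pA; have := A_cl p' p'A; case=> -> _ _ [-> _ _].
have neqA : {in A, forall p, p.1 != p.2}.
  by move=> p /A_sub /al; apply: allowed_neq.
have prodA : {in A, forall p, R * (if us && ~~ isreal p.1 then n else 1) *
                     (if ud && ~~ isreal p.2 then n else 1) = P}.
  by move=> p /A_cl [_ -> ->].
have main := card_load w w' rho q RN sepA neqA prodA.
have P_gt0 : 0 < P.
  by rewrite /P !muln_gt0; case/andP: RN => -> _; do 2 case: ifP; rewrite ?n_gt0.
apply: (@leq_trans (#|[set f | q <= #|[set p in A | in_load us ud w w' R rho f p]|]|
                     * n ^ e)).
  rewrite leq_mul2r; apply/orP; right; apply: subset_leq_card.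
  apply/subsetP => f; rewrite !inE => le_q; apply: leq_trans le_q _.
  apply: subset_leq_card; apply/subsetP => p; rewrite !inE.
  case/and3P => -> /[dup] /eqP [ek eb1 eb2] -> /[dup] il ->.
  case/and3P: il => _ h1 h2; rewrite /= andbT.
  apply/andP; split; apply/implyP => /andP [u1 u2].
    by move: h1 u2; rewrite u1 -eb1 /=; case: (p.1) => //= u /eqP ->.
  by move: h2 u2; rewrite u1 -eb2 /=; case: (p.2) => //= u /eqP ->.
suff tail : 'C(#|A|, q) * n ^ e <= P ^ q.
  rewrite -(@leq_pmul2r (P ^ q)) ?expn_gt0 ?P_gt0 //.
  rewrite mulnAC; apply: leq_trans (leq_mul main (leqnn _)) _.
  by rewrite mulnAC [_ * #|seed|]mulnC leq_mul2l tail orbT.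
have R_gt0 : 0 < R by case/andP: RN.
have rvT : #|[set p in M | isreal p.1 & ~~ isreal p.2]| <= n * (l * R).
  apply: (@leq_trans #|\bigcup_(v : 'I_n) [set p in M | p.1 == inl v & ~~ isreal p.2]|).
    apply: subset_leq_card; apply/subsetP => -[[v|v] y]; rewrite inE ?andbF //=.
    by case/andP => h1 h2; apply/bigcupP; exists v; rewrite // inE h1 /= eqxx.
  apply: leq_trans (card_bigcup_leq xpredT _) _.
  by rewrite -[n in n * _]card_ord -sum_nat_const leq_sum.
have vrT : #|[set p in M | ~~ isreal p.1 & isreal p.2]| <= n * (l * R).
  apply: (@leq_trans #|\bigcup_(v : 'I_n) [set p in M | ~~ isreal p.1 & p.2 == inl v]|).
    apply: subset_leq_card; apply/subsetP => -[y [v|z]]; rewrite inE ?andbF //=.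
    rewrite andbT => /andP [h1 h2]; apply/bigcupP; exists v => //.
    by rewrite inE h1 h2 /= eqxx.
  apply: leq_trans (card_bigcup_leq xpredT _) _.
  by rewrite -[n in n * _]card_ord -sum_nat_const leq_sum.
have leA (D : pred (vnode * vnode)) m : #|[set p in M | D p]| <= m ->
    {in A, forall p, D p} -> #|A| <= m.
  move=> leD AD; apply: leq_trans leD; apply: subset_leq_card.
  by apply/subsetP => p pA; rewrite inE A_sub // AD.
have A1 p : p \in A -> us -> b1 -> p.1 = inl w.
  by rewrite inE => /and4P [_ _ h _] u1 u2; move: h; rewrite u1 u2 => /eqP.
have A2 p : p \in A -> ud -> b2 -> p.2 = inl w'.
  by rewrite inE => /and4P [_ _ _ h] u1 u2; move: h; rewrite u1 u2 => /eqP.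
have Ab p : p \in A -> isreal p.1 = b1 /\ isreal p.2 = b2.
  by move/A_cl => [_ -> ->].
have one_leq : 1 <= l * R by rewrite muln_gt0 l_gt0.
have {}Ab1 p : p \in A -> isreal p.1 = b1 by case/Ab.
have {}Ab2 p : p \in A -> isreal p.2 = b2 by case/Ab.
have Av : ~~ b1 -> ~~ b2 -> #|A| <= l * (n * R).
  by move=> n1 n2; apply: leA vv _ => p pA; rewrite Ab1 // Ab2 // n1 n2.
have Arv1 : us -> b1 -> ~~ b2 -> #|A| <= l * R.
  by move=> u1 n1 n2; apply: leA (rv w) _ => p pA; rewrite A1 // Ab2 // eqxx n2.
have Arv2 : b1 -> ~~ b2 -> #|A| <= n * (l * R).
  by move=> n1 n2; apply: leA rvT _ => p pA; rewrite Ab1 // Ab2 // n1 n2.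
have Avr1 : ud -> ~~ b1 -> b2 -> #|A| <= l * R.
  by move=> u1 n1 n2; apply: leA (vr w') _ => p pA; rewrite A2 // Ab1 // eqxx n1.
have Avr2 : ~~ b1 -> b2 -> #|A| <= n * (l * R).
  by move=> n1 n2; apply: leA vrT _ => p pA; rewrite Ab1 // Ab2 // n1 n2.
have Arr1 : us -> b1 -> b2 -> #|A| <= 1.
  by move=> u1 n1 n2; apply: leA (rr1 w) _ => p pA; rewrite A1 // Ab2 // eqxx n2.
have Arr2 : ud -> b1 -> b2 -> #|A| <= 1.
  by move=> u1 n1 n2; apply: leA (rr2 w') _ => p pA; rewrite A2 // Ab1 // eqxx n1.
have [usud|/negbTE usud] := boolP (us && ud).
  have -> : q = 2 * e by rewrite /q usud.
  case/andP: usud => u1 u2.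
  (* Between two real nodes there is at most one message, so the threshold is never reached.
     Otherwise [#|A| * n <= l * P], because at least one end has a random host. *)
  have [b12|nb12] := boolP (b1 && b2).
    case/andP: b12 => n1 n2; rewrite bin_small //.
    by apply: leq_ltn_trans (Arr1 u1 n1 n2) _; lia.
  apply: bin_tail_poly le4 => //; rewrite /P u1 u2 /=.
  move: nb12 Av Arv1 Avr1; rewrite negb_and u1 u2.
  by case: (b1); case: (b2) => //= _ h1 h2 h3;
    [have := h2 isT isT isT|have := h3 isT isT isT|have := h1 isT isT]; nia.
have -> : q = q1 by rewrite /q usud.
apply: (@leq_trans ('C(#|A|, q1) * 2 ^ q1)); first by rewrite leq_mul2l le2 orbT.
apply: bin_tail_log.
suff : #|A| <= l * P by nia.
move: usd usud Av Arv1 Arv2 Avr1 Avr2 Arr1 Arr2 one_leq.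
rewrite /P; move: #|A| => m; clear.
case: us; case: ud => //= _ _; case: b1; case: b2 => //= h1 h2 h3 h4 h5 h6 h7 lR;
  (try have := h1 isT isT); (try have := h2 isT isT isT);
  (try have := h3 isT isT); (try have := h4 isT isT isT);
  (try have := h5 isT isT); (try have := h6 isT isT isT);
  (try have := h7 isT isT isT); nia.
Qed.

(** If every one of the [4 * #|K|] classes stays below its threshold, the total load stays below the
    sum of the thresholds. The union bound runs over classes, kinds of load, pairs of nodes and
    rounds. *)
Lemma card_bad_step (l R q1 e : nat) (M : {set vnode * vnode}) :
    0 < R <= N -> load_ok l R M ->
    0 < l -> 8 * l <= q1 -> n ^ e <= 2 ^ q1 ->
    0 < e -> 4 * l ^ 2 <= e ^ 2 * n ->
  #|[set f | ~~ good_step (4 * #|K| * q1) (4 * #|K| * (2 * e)) R M f]| * n ^ e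
    <= 16 * #|K| * n ^ 2 * R * #|seed|.
Proof.
move=> RN ok l_gt0 le8 le2 e_gt0 le4.
pose q us ud := if us && ud then 2 * e else q1.
pose idx : finType := ((K * bool * bool) * (bool * bool) * ('I_n * 'I_n) * 'I_R)%type.
pose bad (i : idx) :=
  let: (c, (us, ud), (w, w'), rho) := i in
  if us || ud then [set f | q us ud <=
      #|[set p in M | (class_of p == c) && in_load us ud w w' R rho f p]|]
  (* The index with no prescribed end is padding. *)
  else set0.
have card_idx : #|{: idx}| = 16 * #|K| * n ^ 2 * R.
  by rewrite !card_prod !card_bool !card_ord; nia.
apply: (@leq_trans (\sum_(i : idx) #|bad i| * n ^ e)).
  rewrite -big_distrl /= leq_mul2r; apply/orP; right.
  apply: leq_trans (card_bigcup_leq xpredT _); apply: subset_leq_card.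
  apply/subsetP => f; rewrite inE => /forallPn [rho] /forallPn [w] /forallPn [w'] nb.
  have split_class us ud : #|[set p in M | in_load us ud w w' R rho f p]| =
      \sum_(c : K * bool * bool)
        #|[set p in M | (class_of p == c) && in_load us ud w w' R rho f p]|.
    rewrite -sum1_card (partition_big class_of xpredT) //=.
    apply: eq_bigr => c _; rewrite -sum1_card; apply: eq_bigl => p.
    by rewrite !inE; case: (p \in M); rewrite //= andbC.
  have find_class us ud : us || ud ->
      ~~ (#|[set p in M | in_load us ud w w' R rho f p]| <= 4 * #|K| * q us ud) ->
      f \in \bigcup_i bad i.
    move=> usd; rewrite split_class => h.
    have [c hc] : exists c, q us ud <=
        #|[set p in M | (class_of p == c) && in_load us ud w w' R rho f p]|.
      apply/existsP; apply: contraR h => /existsPn h.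
      have -> : 4 * #|K| * q us ud = \sum_(c : K * bool * bool) q us ud.
        by rewrite sum_nat_const !card_prod card_bool; nia.
      by apply: leq_sum => c _; have := h c; rewrite -ltnNge; apply: ltnW.
    by apply/bigcupP; exists (c, (us, ud), (w, w'), rho); rewrite // /bad usd inE.
  by move: nb; rewrite !negb_and => /or3P [] h; apply: find_class h.
rewrite -card_idx -sum_nat_const; apply: leq_sum => -[[[c [us ud]] [w w']] rho] _.
rewrite /bad; case: ifP => usd; last by rewrite cards0.
exact: card_class_load RN ok usd l_gt0 le8 le2 e_gt0 le4.
Qed.

End Loads.

(** * Simulation of an ideal execution *)

Definition bits_of_nat (W k : nat) : seq bool := mkseq (fun i => odd (k %/ 2 ^ i)) W.

Definition nat_of_bits (s : seq bool) : nat := foldr (fun (b : bool) r => b + r.*2) 0 s.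

Lemma bits_of_natK W k : k < 2 ^ W -> nat_of_bits (bits_of_nat W k) = k.
Proof.
elim: W k => [|W IHW] k; first by case: k.
rewrite /bits_of_nat /mkseq /= -[1]/(1 + 0) iotaDl -map_comp => ltk.
have -> : [seq odd (k %/ 2 ^ (1 + i)) | i <- iota 0 W] = bits_of_nat W k./2.
  by apply: eq_map => i; rewrite /= expnD expn1 divnMA divn2.
have hlf : k./2 < 2 ^ W by rewrite -divn2 ltn_divLR // -expnSr.
by rewrite /= IHW // divn1 odd_double_half.
Qed.

(** * Several packets in one bit string *)

Section Packing.

Variables (T : finType) (Q : nat).

(** Padding with [None] turns all lists of at most [Q] items into tuples, so that every message is a
    rank written with the same number of bits. *)
Definition width : nat := (trunc_log 2 #|{: Q.-tuple (option T)}|).+1.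

Definition to_tuple (l : seq T) : Q.-tuple (option T) :=
  [tuple nth None (map Some l) i | i < Q].

Definition pack (l : seq T) : seq bool :=
  bits_of_nat width (enum_rank (to_tuple l)).

Definition unpack (s : seq bool) : seq T :=
  if insub (nat_of_bits s) is Some i then
    pmap id (enum_val (i : 'I_#|{: Q.-tuple (option T)}|)) else [::].

Lemma size_pack l : size (pack l) = width.
Proof. by rewrite size_mkseq. Qed.

Lemma pmap_some (l : seq T) k :
  pmap id (map Some l ++ nseq k None) = l.
Proof.
elim: l => [|x l IHl] /=; last by rewrite IHl.
by elim: k.
Qed.

Lemma packK l : size l <= Q -> unpack (pack l) = l.
Proof.
move=> le_l; rewrite /unpack /pack bits_of_natK; last first.
  apply: ltn_trans (ltn_ord _) _; exact: trunc_log_ltn.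
rewrite valK enum_rankK.
have -> : tval (to_tuple l) = map Some l ++ nseq (Q - size l) None.
  apply: (@eq_from_nth _ None).
    by rewrite size_tuple size_cat size_map size_nseq subnKC.
  move=> i; rewrite size_tuple => ltiQ.
  rewrite -[i]/(val (Ordinal ltiQ)) -tnth_nth tnth_mktuple /=.
  rewrite nth_cat size_map; case: ltnP => // le_i.
  by rewrite nth_default ?size_map // nth_nseq; case: ifP.
exact: pmap_some.
Qed.

End Packing.

Lemma size_pmap_enum (T : finType) (rT : Type) (g : T -> option rT) :
  size (pmap g (enum T)) = #|[set p | isSome (g p)]|.
Proof.
rewrite size_pmap -size_filter cardE; congr size.
rewrite /enum_mem -filter_predI; apply: eq_filter => p /=.
by rewrite !inE andbT.
Qed.

(** * Hosts executing the virtual nodes *)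

Section Simulation.

Variables (n N : nat) (V : finType) (M : Type) (C : finType).
Variables (enc : M -> C) (dec : C -> M) (Q : nat).
Notation X := (vnode n V).
Variable S : X -> Type.
Variable vinit : forall x, bool -> {set 'I_n} -> S x.
Variable vsend : forall x, S x -> X -> option M.
Variable vrecv : forall x, S x -> {ffun X -> option M} -> S x.
Variable vlen : forall w : 'I_n, S (inl w) -> nat.

Definition packet : finType := ((X * X) * C)%type.

(* [nys] is meaningful only at the virtual nodes hosted by [nid]; [nbuf] holds
   the messages received so far in the current step. *)
Record nstate := NState {
  nid : 'I_n;
  nseed : seed n N V;
  nys : forall x, S x;
  nrnd : nat;
  nbuf : {ffun X * X -> option M}
}.

Definition nlen (st : nstate) : nat := (vlen (nys st (inl (nid st)))).+1.

Definition ninit (w : 'I_n) (b : bool) (nb : {set 'I_n}) (f : seed n N V) : nstate :=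
  NState w f (fun x => vinit x b nb) 0 [ffun=> None].

(** The first host in [in_load] is the node itself, so [nys] is read only at virtual nodes hosted
    here, where it is meaningful. *)
Definition outgoing (st : nstate) (d : 'I_n) : seq packet :=
  pmap (fun p : X * X =>
    if in_load true true (nid st) d (nlen st) (nrnd st) (nseed st) p
    then omap (fun m => (p, enc m)) (vsend (nys st p.1) p.2) else None)
    (enum {: X * X}).

Definition nsend (st : nstate) (d : 'I_n) : option (seq bool) :=
  let l := outgoing st d in if nilp l then None else Some (pack Q l).

(** The virtual states stay frozen until the last round of a step, so [nlen] is constant during the
    step; only then is the whole inbox, with the packets of that last round, handed to the virtual
    nodes. *)
Definition nrecv (st : nstate) (l : seq ('I_n * seq bool)) : nstate :=
  let pk := flatten [seq unpack packet Q m.2 | m <- l] in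
  let bf : {ffun X * X -> option M} :=
    [ffun p => if [seq k <- pk | k.1 == p] is k :: _ then Some (dec k.2)
               else nbuf st p] in
  if (nrnd st).+1 == nlen st then
    NState (nid st) (nseed st)
      (fun x => vrecv (nys st x) [ffun x' => bf (x', x)]) 0 [ffun=> None]
  else NState (nid st) (nseed st) (nys st) (nrnd st).+1 bf.

Definition ndests (cap : nat) (st : nstate) : seq 'I_n :=
  take cap [seq d <- enum 'I_n | isSome (nsend st d)].

Definition nincoming (cap : nat) (st : 'I_n -> nstate) (w : 'I_n) :=
  pmap (fun v => omap (fun m => (v, m))
    (if w \in ndests cap (st v) then omap (take cap) (nsend (st v) w) else None))
    (enum 'I_n).

Definition vmsg (Y : forall x, S x) (p : X * X) : option M := vsend (Y p.1) p.2.

Definition vmsgs (Y : forall x, S x) : {set X * X} := [set p | isSome (vmsg Y p)].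

Definition vstep (Y : forall x, S x) (x : X) : S x :=
  vrecv (Y x) [ffun x' => vmsg Y (x', x)].

Section Round.

Variables (f : seed n N V) (cap : nat) (Y : forall x, S x) (R : nat).
Hypothesis n_gt0 : 0 < n.
Hypothesis sync : forall w : 'I_n, (vlen (Y (inl w))).+1 = R.
Hypothesis good : good_step cap Q R (vmsgs Y) f.
Hypothesis width_cap : width packet Q <= cap.
Hypothesis decK : forall p m, vmsg Y p = Some m -> dec (enc m) = m.

(** Ideal states and buffers are claimed only at the host of the virtual node concerned. The buffer
    contains exactly the messages whose slot has passed. *)
Definition at_round (Y' : forall x, S x) (R' rho : nat) (st : 'I_n -> nstate) : Prop :=
  forall w, [/\ nid (st w) = w, nseed (st w) = f, nrnd (st w) = rho,
    forall x, hosted f x w -> nys (st w) x = Y' x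
  & forall x' x, hosted f x w -> nbuf (st w) (x', x) =
      if slot f R' (x', x) < rho then vmsg Y' (x', x) else None].

Definition host (x : X) : 'I_n :=
  match x with
  | inl u => u
  | inr y => Ordinal (ltn_pmod (f (inl y)) n_gt0)
  end.

Lemma hostedE x w : hosted f x w = (host x == w).
Proof. by case: x. Qed.

Variables (rho : nat) (st : 'I_n -> nstate).
Hypothesis rho_lt : rho < R.
Hypothesis Inv : at_round Y R rho st.

Lemma len_at w : nlen (st w) = R.
Proof.
have [e1 e2 e3 e4 e5] := Inv w.
by rewrite /nlen e1 e4 ?sync //= eqxx.
Qed.

Definition ideal_out (v w : 'I_n) : seq packet :=
  pmap (fun p : X * X => if in_load true true v w R rho f p
    then omap (fun m => (p, enc m)) (vmsg Y p) else None) (enum {: X * X}).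

Lemma outgoingE v w : outgoing (st v) w = ideal_out v w.
Proof.
have [e1 e2 e3 e4 e5] := Inv v.
rewrite /outgoing /ideal_out; apply: eq_pmap => p; rewrite len_at e1 e2 e3.
by case: ifP => // /and3P [_ /= h _]; rewrite e4.
Qed.

Lemma ideal_outP v w k : reflect
  (exists2 m, vmsg Y k.1 = Some m & in_load true true v w R rho f k.1 /\ k.2 = enc m)
  (k \in ideal_out v w).
Proof.
rewrite mem_pmap; apply: (iffP mapP) => [[p _]|[m em [il ek]]].
  case: ifP => // il; case em: vmsg => [m|] //= [->].
  by exists m.
exists k.1; first by rewrite mem_enum.
by rewrite il em /= -ek; case: (k).
Qed.

Lemma good_at v w : [/\ #|[set p in vmsgs Y | in_load true false v w R rho f p]| <= cap,
        #|[set p in vmsgs Y | in_load false true v w R rho f p]| <= cap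
      & #|[set p in vmsgs Y | in_load true true v w R rho f p]| <= Q].
Proof.
by move/forallP/(_ (Ordinal rho_lt))/forallP/(_ v)/forallP/(_ w)/and3P: good.
Qed.

Lemma size_ideal_out v w : size (ideal_out v w) <= Q.
Proof.
have [_ _] := good_at v w; apply: leq_trans.
rewrite size_pmap_enum; apply: subset_leq_card; apply/subsetP => p.
by rewrite !inE; case: ifP => // il; case: vmsg.
Qed.

Lemma nsendE v w : nsend (st v) w =
  if nilp (ideal_out v w) then None else Some (pack Q (ideal_out v w)).
Proof. by rewrite /nsend outgoingE. Qed.

Lemma ideal_out_neq0 v w : ~~ nilp (ideal_out v w) ->
  exists2 p, p \in vmsgs Y & in_load true true v w R rho f p.
Proof.
case e: ideal_out => [|k l] // _.
have : k \in ideal_out v w by rewrite e mem_head.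
case/ideal_outP => m em [il _]; exists k.1 => //; by rewrite inE em.
Qed.

(** The truncation to [cap] destinations is void: distinct destinations require distinct messages,
    and the send load of [v] in this round is at most [cap]. *)
Lemma ndestsE v w : (w \in ndests cap (st v)) = ~~ nilp (ideal_out v w).
Proof.
rewrite /ndests take_oversize; last first.
  have [le_cap _ _] := good_at v v; apply: leq_trans le_cap.
  set A := [set p in _ | _].
  apply: leq_trans (leq_imset_card (fun p : X * X => host p.2) A).
  rewrite -(card_uniqP (filter_uniq _ (enum_uniq 'I_n))).
  apply: subset_leq_card; apply/subsetP => d; rewrite mem_filter nsendE.
  case: ifP => // /negbT /ideal_out_neq0 [p pM /and3P [h1 h2 h3]] _.
  apply/imsetP; exists p; first by rewrite inE pM /in_load h1 h2.
  by move: h3; rewrite hostedE => /eqP.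
by rewrite mem_filter mem_enum andbT nsendE; case: nilp.
Qed.

Lemma nincomingE w : nincoming cap st w =
  pmap (fun v => if nilp (ideal_out v w) then None
                 else Some (v, pack Q (ideal_out v w))) (enum 'I_n).
Proof.
apply: eq_pmap => v; rewrite ndestsE nsendE; case: nilp => //=.
by rewrite take_oversize // size_pack.
Qed.

Lemma size_nincoming w : size (nincoming cap st w) <= cap.
Proof.
have [_ le_cap _] := good_at w w; apply: leq_trans le_cap.
rewrite nincomingE size_pmap_enum; set A := [set p in _ | _].
apply: leq_trans (leq_imset_card (fun p : X * X => host p.1) A).
apply: subset_leq_card; apply/subsetP => v; rewrite inE.
case: ifP => // /negbT /ideal_out_neq0 [p pM /and3P [h1 h2 h3]] _.
apply/imsetP; exists p; first by rewrite inE pM /in_load h1 h3.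
by move: h2; rewrite hostedE => /eqP.
Qed.

Lemma mem_unpacked w k :
  (k \in flatten [seq unpack packet Q m.2 | m <- nincoming cap st w]) =
  [exists v, k \in ideal_out v w].
Proof.
rewrite nincomingE; apply/flattenP/existsP => [[s /mapP [[v b] vb /= ->]]|[v kv]].
  move: vb; rewrite mem_pmap => /mapP [v0 _].
  case: ifP => // _ [_ ->]; rewrite packK ?size_ideal_out // => kv.
  by exists v0.
exists (ideal_out v w) => //; apply/mapP; exists (v, pack Q (ideal_out v w)).
  rewrite mem_pmap; apply/mapP; exists v; first by rewrite mem_enum.
  by case e : (ideal_out v w) kv.
by rewrite packK ?size_ideal_out.
Qed.

Variable st' : 'I_n -> nstate.
Hypothesis st'E : forall w, exists l,
  [/\ subseq l (nincoming cap st w), size l = minn (size (nincoming cap st w)) cap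
    & st' w = nrecv (st w) l].

(** Since at most [cap] messages arrive, the adversary delivers a subsequence of full length, which
    is the whole list. *)
Lemma delivered w : st' w = nrecv (st w) (nincoming cap st w).
Proof.
have [l [sub sz ->]] := st'E w; congr nrecv.
apply/eqP; rewrite -(size_subseq_leqif sub) sz.
by rewrite (minn_idPl (size_nincoming w)).
Qed.

(** The step length 1 after a completed step is a placeholder: at round 0 no slot has passed,
    whatever the length. *)
Lemma at_round_step : if rho.+1 == R then at_round (vstep Y) 1 0 st'
                      else at_round Y R rho.+1 st'.
Proof.
suff H : forall w, if rho.+1 == R then
   [/\ nid (st' w) = w, nseed (st' w) = f, nrnd (st' w) = 0,
    forall x, hosted f x w -> nys (st' w) x = vstep Y x
  & nbuf (st' w) = [ffun=> None]] else
   [/\ nid (st' w) = w, nseed (st' w) = f, nrnd (st' w) = rho.+1,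
    forall x, hosted f x w -> nys (st' w) x = Y x
  & forall x' x, hosted f x w -> nbuf (st' w) (x', x) =
      if slot f R (x', x) < rho.+1 then vmsg Y (x', x) else None].
  case: ifP H => _ H w; have [h1 h2 h3 h4 h5] := H w; split=> //.
  by move=> x' x _; rewrite h5 ffunE.
move=> w; rewrite delivered /nrecv len_at.
have [e1 e2 e3 e4 e5] := Inv w; rewrite e1 e2 e3.
set pk := flatten _; set bf : {ffun X * X -> option M} := finfun _.
have bfE x' x : hosted f x w -> bf (x', x) =
      if slot f R (x', x) < rho.+1 then vmsg Y (x', x) else None.
  move=> hx; rewrite ffunE e5 //.
  have memk k : k \in [seq k <- pk | k.1 == (x', x)] ->
      slot f R (x', x) = rho /\
      exists2 m, vmsg Y (x', x) = Some m & k.2 = enc m.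
    rewrite mem_filter mem_unpacked => /andP [/eqP <-] /existsP [v].
    case/ideal_outP => m em [/and3P [/eqP h1 h2 h3] h4]; split => //.
    by exists m.
  case ek : [seq k <- pk | k.1 == (x', x)] => [|k l].
    case: (ltngtP (slot f R (x', x)) rho) => [lt|gt|e].
    - by rewrite ltnW.
    - by rewrite ltnNge (leq_trans _ gt).
    - rewrite e ltnSn; case em : vmsg => [m|] //.
      suff : ((x', x), enc m) \in [seq k <- pk | k.1 == (x', x)] by rewrite ek.
      rewrite mem_filter eqxx mem_unpacked; apply/existsP; exists (host x').
      apply/ideal_outP; exists m => //=; split=> //.
      by apply/and3P; split; rewrite /= ?e ?eqxx ?hostedE //= -hostedE.
  have [|sl [m em e2k]] := memk k; first by rewrite ek mem_head.
  by rewrite sl ltnSn em e2k (decK em).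
case: (boolP (rho.+1 == R)) => [/eqP eR|neR]; split=> //=.
move=> x hx; rewrite /vstep e4 //; congr vrecv.
apply/ffunP => x'; rewrite [LHS]ffunE [RHS]ffunE bfE // eR.
by rewrite ltn_pmod // -eR.
Qed.

End Round.

Section Run.

Variables (f : seed n N V) (cap : nat) (Y0 : forall x, S x) (len : nat -> nat).
Hypothesis n_gt0 : 0 < n.

Fixpoint vexec (tau : nat) : forall x, S x :=
  if tau is tau'.+1 then vstep (vexec tau') else Y0.

Variable taumax : nat.
Hypothesis sync : forall tau, tau < taumax ->
  forall w : 'I_n, (vlen (vexec tau (inl w))).+1 = len tau.
Hypothesis good : forall tau, tau < taumax ->
  good_step cap Q (len tau) (vmsgs (vexec tau)) f.
Hypothesis width_cap : width packet Q <= cap.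
Hypothesis decK : forall tau p m, tau < taumax ->
  vmsg (vexec tau) p = Some m -> dec (enc m) = m.

Variable ex : nat -> 'I_n -> nstate.
Hypothesis ex0 : at_round f Y0 1 0 (ex 0).
Hypothesis exS : forall t w, exists l,
  [/\ subseq l (nincoming cap (ex t) w),
      size l = minn (size (nincoming cap (ex t) w)) cap
    & ex t.+1 w = nrecv (ex t w) l].

Definition start_time (tau : nat) : nat := \sum_(sigma < tau) len sigma.

Lemma at_round_vexec tau rho : tau < taumax -> rho < len tau ->
  at_round f (vexec tau) 1 0 (ex (start_time tau)) ->
  at_round f (vexec tau) (len tau) rho (ex (start_time tau + rho)).
Proof.
move=> lt_tau lt_rho at0; elim: rho lt_rho => [_|rho IH lt_rho].
  by rewrite addn0 => w; have [h1 h2 h3 h4 h5] := at0 w; split.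
have lt_rho' := ltnW lt_rho.
have := at_round_step n_gt0 (sync lt_tau) (good lt_tau) width_cap
   (fun p m => decK (p := p) (m := m) lt_tau) lt_rho' (IH lt_rho') (exS _).
by rewrite ltn_eqF // addnS.
Qed.

Lemma at_round_start tau : tau <= taumax ->
  at_round f (vexec tau) 1 0 (ex (start_time tau)).
Proof.
elim: tau => [_|tau IH lt_tau]; first by rewrite /start_time big_ord0.
have len_gt0 : 0 < len tau.
  by have [h _ _ _ _] := ex0 (Ordinal n_gt0); rewrite -(sync lt_tau (Ordinal n_gt0)).
have lt_rho : (len tau).-1 < len tau by rewrite prednK.
have at0 := IH (ltnW lt_tau).
have := at_round_step n_gt0 (sync lt_tau) (good lt_tau) width_cap
   (fun p m => decK (p := p) (m := m) lt_tau) lt_rho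
   (at_round_vexec lt_tau lt_rho at0) (exS _).
rewrite prednK // eqxx /start_time big_ord_recr /= -addnS prednK //.
Qed.

(** Needed because outputs are irrevocable: at every time, also in the middle of a step, a real node
    shows a state of the ideal execution. *)
Lemma observe_run t : t <= start_time taumax ->
  exists2 tau, tau <= taumax & forall w, nys (ex t w) (inl w) = vexec tau (inl w).
Proof.
suff H tau : tau <= taumax -> t <= start_time tau ->
  exists2 tau, tau <= taumax & forall w, nys (ex t w) (inl w) = vexec tau (inl w).
  exact: H.
elim: tau => [_|tau IH lt_tau].
  rewrite /start_time big_ord0 leqn0 => /eqP ->; exists 0 => // w.
  by have [_ _ _ h _] := ex0 w; rewrite h //= eqxx.
have [le_t _|lt_t] := leqP t (start_time tau); first exact: IH (ltnW lt_tau) le_t.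
rewrite leq_eqVlt => /orP [/eqP ->|].
  exists tau.+1 => // w; have [_ _ _ h _] := at_round_start lt_tau w.
  by rewrite h //= eqxx.
rewrite /start_time big_ord_recr /= -/(start_time tau) => lt_t'.
exists tau; first exact: ltnW.
have lt_rho : t - start_time tau < len tau by rewrite ltn_subLR // ltnW.
move=> w; have := at_round_vexec lt_tau lt_rho (at_round_start (ltnW lt_tau)).
by rewrite subnKC ?(ltnW lt_t) // => /(_ w) [_ _ _ h _]; rewrite h //= eqxx.
Qed.

End Run.

End Simulation.

(** * The ideal algorithm *)

Definition tnode (n : nat) : finType := ('I_n * 'I_(logc n).+1 * 'I_n)%type.

Inductive msg :=
  | MSum of nat & nat & nat
  | MQuery
  | MReply of nat
  | MInsert
  | MUpC of nat
  | MDown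
  | MCross
  | MUpM of nat.

Definition tag (m : msg) : nat :=
  match m with
  | MSum _ _ _ => 0 | MQuery => 1 | MReply _ => 2 | MInsert => 3
  | MUpC _ => 4 | MDown => 5 | MCross => 6 | MUpM _ => 7
  end.

Definition payload (m : msg) : nat * nat * nat :=
  match m with
  | MSum a b c => (a, b, c)
  | MReply a | MUpC a | MUpM a => (a, 0, 0)
  | _ => (0, 0, 0)
  end.

(** All payloads are identifiers, counts or sums of degrees, hence at most [n * n]. *)
Definition code (n : nat) : finType :=
  ('I_8 * ('I_(n * n).+1 * 'I_(n * n).+1 * 'I_(n * n).+1))%type.

Definition enc (n : nat) (m : msg) : code n :=
  (inord (tag m),
   (inord (payload m).1.1, inord (payload m).1.2, inord (payload m).2)).

Definition dec (n : nat) (k : code n) : msg :=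
  let: (t, (a, b, c)) := k in
  match val t with
  | 0 => MSum a b c | 1 => MQuery | 2 => MReply a | 3 => MInsert
  | 4 => MUpC a | 5 => MDown | 6 => MCross | _ => MUpM a
  end.

Lemma encK n m : [&& (payload m).1.1 <= n * n, (payload m).1.2 <= n * n
                   & (payload m).2 <= n * n] -> dec (enc n m) = m.
Proof.
by case/and3P; case: m => /= *; rewrite /dec /enc /= !inordK.
Qed.

Section Algorithm.

Variable n : nat.
Notation L := (logc n).
Notation X := (vnode n (tnode n)).

Definition own (y : tnode n) : 'I_n := y.1.1.
Definition ht (y : tnode n) : nat := y.1.2.
Definition key (y : tnode n) : 'I_n := y.2.

Definition par (y y' : tnode n) : bool :=
  [&& own y' == own y, ht y' == (ht y).+1 & key y' == (key y)./2 :> nat].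

Definition mir (y y' : tnode n) : bool :=
  [&& ht y == 0, ht y' == 0, own y' == key y, key y' == own y & own y != key y].

(* [r_rem] counts the incident edges not yet inserted, [r_fr] is the set of
   keys reached by the top-down search, [r_acc] holds the all-reduce sums (live
   nodes, missing edges, degrees of the BFS layer), [r_pc] is the step within
   the phase and [r_ph] the number of completed BFS layers. *)
Record rstate := RState {
  r_nb : {set 'I_n};
  r_rem : nat;
  r_fr : {set 'I_n};
  r_acc : nat * nat * nat;
  r_pc : nat;
  r_ph : nat;
  r_dist : option (nat * option 'I_n)
}.

(* The number of inserted edges below the trie node, and the pending action. *)
Definition tstate : Type := nat * option msg.

Definition vstate (x : X) : Type :=
  match x with inl _ => rstate | inr _ => tstate end.

Definition active (ph : nat) (d : option (nat * option 'I_n)) : bool :=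
  if d is Some (k, _) then k == ph else false.

Definition start_acc (nb : {set 'I_n}) (rem ph : nat)
    (d : option (nat * option 'I_n)) : nat * nat * nat :=
  (nat_of_bool (0 < rem), rem, if active ph d then #|nb| else 0).

Definition rstart (nb : {set 'I_n}) (rem ph : nat) (d : option (nat * option 'I_n)) :=
  RState nb rem set0 (start_acc nb rem ph d) 0 ph d.

Definition setup (acc : nat * nat * nat) : bool := 0 < acc.1.1.

(* Fewer than half of the live nodes have more than [theta acc] missing edges. *)
Definition theta (acc : nat * nat * nat) : nat := 2 * (acc.1.2 %/ acc.1.1) + 2.

(** The lengths keep the load at [O(L)] per node and round. An insertion body may load a single node
    with about [theta] messages; in a BFS body only trie nodes carry the load, which is thus spread
    over [n] hosts. *)
Definition body_len (acc : nat * nat * nat) : nat :=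
  if setup acc then theta acc %/ L else acc.2 %/ (n * L).

Definition rlen (st : rstate) : nat :=
  if r_pc st < 2 * L then 0 else body_len (r_acc st).

Definition poor (acc : nat * nat * nat) (rem : nat) : bool := 0 < rem <= theta acc.

(* A phase consists of [2 * L] all-reduce steps followed by the body. In an
   insertion body, step [2 * j] queries the trie counters at height
   [L - j.+1] and step [2 * j + 1] answers; step [2 * L] inserts leaves, and
   the next [L + 1] steps carry the new counts upwards. In a BFS body, the nodes
   of the layer wake up their roots at step [0]. *)
Definition rsend (w : 'I_n) (st : rstate) (x : X) : option msg :=
  let: pc := r_pc st in
  let: acc := r_acc st in
  let: o := pc - 2 * L in
  match x with
  | inl w' =>
      if (if pc < L then w == w' + 2 ^ pc :> nat
          else [&& pc < 2 * L, w < 2 ^ (pc - L) & w' == w + 2 ^ (pc - L) :> nat])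
      then Some (MSum acc.1.1 acc.1.2 acc.2) else None
  | inr y =>
      if pc < 2 * L then None else
      if setup acc then
        if o < 2 * L then
          if [&& ~~ odd o, own y == w, ht y == L - (o./2).+1
               & [exists k in r_fr st, k == (key y)./2 :> nat]]
          then Some MQuery else None
        else if [&& o == 2 * L, ht y == 0
               & (own y == w) && (key y \in r_fr st)
                 || (key y == w) && (own y \in r_fr st)]
          then Some MInsert else None
      else if [&& o == 0, active (r_ph st) (r_dist st), own y == w, ht y == L
             & key y == 0 :> nat]
        then Some MDown else None
  end.

Definition sum3 (o : option msg) : nat * nat * nat :=
  if o is Some m then payload m else (0, 0, 0).

Definition least (P : pred nat) : nat := find P (iota 0 n).

Definition is_upm (k : nat) (o : option msg) : bool :=
  if o is Some (MUpM j) then j == k else false.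

(** What the counter of a complete trie would show. *)
Definition expected (nb : {set 'I_n}) (h k : nat) : nat :=
  #|[set u in nb | u %/ 2 ^ h == k]|.

(** In the search a key stays in the frontier when its counter falls short of [expected], that is,
    when some edge below it is missing. At the end of an insertion body the root reports how many
    edges were added, including those inserted by the other endpoints. *)
Definition rrecv (w : 'I_n) (st : rstate) (ib : {ffun X -> option msg}) : rstate :=
  let: RState nb rem fr acc pc ph d := st in
  let: o := pc - 2 * L in
  if pc < L then
    RState nb rem fr (acc.1.1 + \sum_x (sum3 (ib x)).1.1,
                      acc.1.2 + \sum_x (sum3 (ib x)).1.2,
                      acc.2 + \sum_x (sum3 (ib x)).2) pc.+1 ph d
  else if pc < 2 * L then
    let: acc' := if [pick x | isSome (ib x)] is Some x then sum3 (ib x) else acc in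
    RState nb rem (if pc.+1 == 2 * L then
        [set k : 'I_n | (k == 0 :> nat) && poor acc' rem] else fr) acc' pc.+1 ph d
  else if setup acc then
    if o == 3 * L + 1 then
      rstart nb (rem - \sum_x (sum3 (ib x)).1.1) ph d
    else if (o < 2 * L) && odd o then
      let: h := L - (o./2).+1 in
      RState nb rem
        [set k : 'I_n | if ib (inr (w, inord h, k)) is Some (MReply c)
                        then c < expected nb h k else false] acc pc.+1 ph d
    else RState nb rem fr acc pc.+1 ph d
  else
    if o == 2 * L + 2 then
      rstart nb rem ph.+1
        (if d is Some _ then d else
         if [exists x, isSome (ib x)]
         then Some (ph.+1, insub (least (fun k => [exists x, is_upm k (ib x)])))
         else None)
    else RState nb rem fr acc pc.+1 ph d.

(** A broadcast turns into [MCross] exactly at the leaves, which have a mirror but no children.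
    Reports leave the trie for the owner at height [L]. *)
Definition tsend (y : tnode n) (st : tstate) (x : X) : option msg :=
  match st.2 with
  | Some (MReply _) => if x == inl (own y) then st.2 else None
  | Some (MUpC _) | Some (MUpM _) =>
      match x with
      | inl w => if (w == own y) && (ht y == L) then st.2 else None
      | inr y' => if par y y' then st.2 else None
      end
  | Some MDown =>
      match x with
      | inl _ => None
      | inr y' => if par y' y then Some MDown
                  else if mir y y' then Some MCross else None
      end
  | _ => None
  end.

(** A leaf adds 1 however many [MInsert] it receives, so an edge inserted by both endpoints counts
    once. The test [0 < cnt] stops the broadcast at empty subtries, which keeps the load
    proportional to the degrees. *)
Definition react (t : nat) (y : tnode n) (cnt : nat) (ib : {ffun X -> option msg})
    : tstate :=
  match t with
  | 1 => (cnt, Some (MReply cnt))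
  | 3 => (cnt.+1, Some (MUpC 1))
  | 4 => let: s := \sum_x (sum3 (ib x)).1.1 in (cnt + s, Some (MUpC s))
  | 5 => (cnt, if 0 < cnt then Some MDown else None)
  | 6 => (cnt, Some (MUpM (key y)))
  | 7 => (cnt, Some (MUpM (least (fun k => [exists x, is_upm k (ib x)]))))
  | _ => (cnt, None)
  end.

(** Trie nodes keep no program counter. All messages that reach a trie node in one step are of the
    same kind, so the tag of any of them selects the reaction. *)
Definition trecv (y : tnode n) (st : tstate) (ib : {ffun X -> option msg}) : tstate :=
  if [pick x | isSome (ib x)] is Some x then
    if ib x is Some m then react (tag m) y st.1 ib else (st.1, None)
  else (st.1, None).

Definition vinit (x : X) : bool -> {set 'I_n} -> vstate x :=
  match x with
  | inl w => fun b nb =>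
      rstart nb #|nb| 0 (if b then Some (0, None) else None)
  | inr y => fun _ _ => (0, None)
  end.

Definition vsend (x : X) : vstate x -> X -> option msg :=
  match x with inl w => rsend w | inr y => tsend y end.

Definition vrecv (x : X) : vstate x -> {ffun X -> option msg} -> vstate x :=
  match x with inl w => rrecv w | inr y => trecv y end.

Definition vlen (w : 'I_n) (st : vstate (inl w)) : nat := rlen st.

Definition vallowed (p : X * X) : bool :=
  match p with
  | (inl w, inl w') => w != w'
  | (inl w, inr y) => (own y == w) || (ht y == 0) && (key y == w)
  | (inr y, inl w) => own y == w
  | (inr y, inr y') => [|| par y y', par y' y | mir y y']
  end.

(* Within a colour class the hosts of all sources and destinations are distinct
   random variables: parities of heights and keys separate siblings and
   consecutive levels, and comparing owners separates the two directions
   between mirror leaves. *)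
Definition vcol (p : X * X) : bool * bool * bool * bool * bool :=
  match p with
  | (inl w, inr y) => (own y == w, true, true, true, true)
  | (inr y, inr y') =>
      (ht y < ht y', ht y' < ht y, odd (ht y),
       odd (if ht y < ht y' then key y else key y'), own y < own y')
  | (inr _, inl _) => (true, true, false, true, true)
  | (inl _, inl _) => (true, true, true, true, true)
  end.

Lemma tnode_eqP (y y' : tnode n) :
  own y = own y' -> ht y = ht y' -> key y = key y' -> y = y'.
Proof.
case: y => [[a b] c]; case: y' => [[a' b'] c']; rewrite /own /ht /key /=.
by move=> -> /val_inj -> ->.
Qed.

Lemma parP y y' : reflect
  [/\ own y' = own y, ht y' = (ht y).+1 & val (key y') = (val (key y))./2] (par y y').
Proof.
by apply: (iffP and3P) => -[/eqP h1 /eqP h2 /eqP h3].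
Qed.

Lemma mirP y y' : reflect
  [/\ ht y = 0, ht y' = 0, own y' = key y, key y' = own y & own y <> key y] (mir y y').
Proof.
apply: (iffP and5P) => -[/eqP h1 /eqP h2 /eqP h3 /eqP h4 /eqP h5]; split=> //; exact/eqP.
Qed.

Lemma vallowed_neq p : vallowed p -> p.1 != p.2.
Proof.
case: p => [[w|y] [w'|y']] //= al; apply/eqP => -[e]; subst y'.
by case/or3P: al => [/parP [_ e _]|/parP [_ e _]|/mirP [_ _ e _]]; [lia|lia|].
Qed.

Lemma par_uniq u v v' : par u v -> par u v' -> v = v'.
Proof.
move=> /parP [a1 a2 a3] /parP [b1 b2 b3]; apply: tnode_eqP; rewrite ?a1 ?a2 ?b1 ?b2 //.
by apply: val_inj; rewrite a3 b3.
Qed.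

Lemma child_uniq u u' v : par u v -> par u' v -> odd (key u) = odd (key u') -> u = u'.
Proof.
move=> /parP [a1 a2 a3] /parP [b1 b2 b3] e; apply: tnode_eqP.
- by rewrite -a1 -b1.
- by lia.
- apply: val_inj; rewrite -(odd_double_half (val (key u))).
  by rewrite -(odd_double_half (val (key u'))) -a3 -b3 e.
Qed.

Lemma mir_uniq u v v' : mir u v -> mir u v' -> v = v'.
Proof.
by move=> /mirP [a1 a2 a3 a4 a5] /mirP [b1 b2 b3 b4 b5]; apply: tnode_eqP; congruence.
Qed.

Lemma mir_sym u v : mir u v = mir v u.
Proof.
by apply/mirP/mirP => -[a1 a2 a3 a4 a5]; split=> //; rewrite ?a3 ?a4 //; apply: nesym.
Qed.

Lemma vallowed_vv_sep y t y' t' : vallowed (inr y, inr t) -> vallowed (inr y', inr t') ->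
  vcol (inr y, inr t) = vcol (inr y', inr t') ->
  (y = y' \/ t = t' -> (y, t) = (y', t')) /\ y <> t'.
Proof.
rewrite /vallowed /vcol => al al' [c1 c2 c3 c4 c5].
have htp u v : par u v -> ht v = (ht u).+1 by case/parP.
have htm u v : mir u v -> ht u = 0 /\ ht v = 0 by case/mirP.
(* Of the nine combinations of directions (up, down, across), the height comparisons in the colour
   leave the three diagonal ones. *)
case/or3P: al => al; case/or3P: al' => al';
  first [have h := htp _ _ al | have [h0 h] := htm _ _ al];
  first [have h' := htp _ _ al' | have [h0' h'] := htm _ _ al'];
  try (by exfalso; lia).
- have e : odd (key y) = odd (key y') by move: c4; rewrite h h' !ltnSn.
  split; last by move=> ey; move: c3; rewrite ey h' /=; case: odd.
  case=> [ey|et]; subst; first by rewrite (par_uniq al al').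
  by rewrite (child_uniq al al' e).
- have e : odd (key t) = odd (key t').
    by move: c4; rewrite h h' !ltnNge !leqnSn /=.
  split; last by move=> ey; move: c3; rewrite h' -ey /=; case: odd.
  case=> [ey|et]; subst; last by rewrite (par_uniq al al').
  by rewrite (child_uniq al al' e).
- split.
    case=> [ey|et]; subst; first by rewrite (mir_uniq al al').
    by move: al al'; rewrite !(mir_sym _ t') => al al'; rewrite (mir_uniq al al').
  move=> ey; subst y; move: c5; case/mirP: al => _ _ -> _ ne.
  case/mirP: al' ne => _ _ -> -> ne' ne.
  by case: (ltngtP (val (key y')) (val (own y'))) => // /val_inj.
Qed.

(** Separates messages inside tries from all others, whose colours have both components true: parent
    and child share their owner, mirror leaves share their height. *)
Lemma vallowed_vv_col y t : vallowed (inr y, inr t) ->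
  (ht t < ht y) && (own y < own t) = false.
Proof.
case/or3P => [/parP [_ -> _]|/parP [-> _ _]|/mirP [-> -> _]] //.
  by rewrite ltnNge leqnSn.
by rewrite ltnn andbF.
Qed.

Lemma vcol_sep p p' : vallowed p -> vallowed p' -> vcol p = vcol p' -> p != p' ->
  [/\ forall y, p.1 = inr y -> p'.1 <> inr y,
      forall y, p.2 = inr y -> p'.2 <> inr y
    & forall y, p.1 = inr y -> p'.2 <> inr y].
Proof.
case: p => [[w|y] [z|t]]; case: p' => [[w'|y'] [z'|t']] // al al' ec /eqP ne;
  (split=> x //= => -[<-] // [e]; subst) => //; try (by case: ec);
  try (by case: ec => e1 e2 e3 e4 e5; have := vallowed_vv_col al;
          rewrite e5 e2);
  try (by case: ec => e1 e2 e3 e4 e5; have := vallowed_vv_col al';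
          rewrite -e5 -e2);
  try (by have [h1 h2] := vallowed_vv_sep al al' ec; apply: h2);
  try (by have [h1 h2] := vallowed_vv_sep al al' ec; apply: ne;
       have [-> ->] : (y, t) = (y', t') by apply: h1; (left; congruence) || (right; congruence)).
- case: ec => ec; apply: ne; move: al al'; rewrite /= -ec.
  case: eqP ec => [<-|] /= ec; first by move/esym/eqP: ec => <-.
  by move=> _ /andP [_ /eqP <-] /andP [_ /eqP <-].
- by apply: ne; move: al al' => /= /eqP <- /eqP <-.
all: have [h1 h2] := vallowed_vv_sep al al' ec; apply: ne.
- by case: (h1 (or_introl erefl)) => ->.
- by case: (h1 (or_intror erefl)) => ->.
Qed.

Section Static.

Variable Y : forall x : X, vstate x.
Variable pc : nat.
Hypothesis pcE : forall w, r_pc (Y (inl w)) = pc.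
Notation vm := (vmsg vsend Y).
Notation M := (vmsgs vsend Y).

Lemma rsend_rr w st w' : isSome (rsend w st (inl w')) ->
  if r_pc st < L then nat_of_ord w = w' + 2 ^ r_pc st
  else w < 2 ^ (r_pc st - L) /\ nat_of_ord w' = w + 2 ^ (r_pc st - L).
Proof.
by rewrite /=; case: ifP => //; case: ifP => [_ /eqP //|_ /and3P [_ h1 /eqP h2]] _.
Qed.

Lemma rsend_rv w st y : isSome (rsend w st (inr y)) ->
  (own y == w) || (ht y == 0) && (key y == w).
Proof.
rewrite /=; case: ifP => // _; case: ifP => _.
  case: ifP => _.
    by case: ifP => // /and4P [_ -> _ _].
  by case: ifP => // /and3P [_ -> /orP [/andP [-> _]|/andP [-> _]]] //=; rewrite orbT.
by case: ifP => // /and5P [_ _ -> _ _].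
Qed.

Lemma tsend_vr y st w : isSome (tsend y st (inl w)) -> own y == w.
Proof.
by rewrite /tsend; case: st => c [[]|] //=; intros;
  match goal with h : is_true _ |- _ => move: h end; case: ifP => // h _;
  [case/eqP: h => ->|case/andP: h => /eqP ->|case/andP: h => /eqP ->].
Qed.

Definition is_down (o : option msg) : bool := if o is Some MDown then true else false.

Lemma tsend_vv y st y' : isSome (tsend y st (inr y')) ->
  isSome st.2 /\ if is_down st.2 then par y' y || mir y y' else par y y'.
Proof.
rewrite /tsend; case: st => c [[]|] //=; intros;
  match goal with h : is_true _ |- _ => move: h end; case: ifP => //.
by move=> _; case: ifP => // ->.
Qed.

Lemma vv_target_uniq y st y' y'' :
  isSome (tsend y st (inr y')) -> isSome (tsend y st (inr y'')) ->
  odd (key y') = odd (key y'') -> y' = y''.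
Proof.
move=> /tsend_vv [_ h'] /tsend_vv [_ h''].
case: is_down h' h'' => [h' h'' e|h' h'' _]; last exact: par_uniq h' h''.
case/orP: h' => h'; case/orP: h'' => h''.
- exact: child_uniq h' h'' e.
- by case/parP: h' => _ h' _; case/mirP: h'' => h'' _ _ _ _; lia.
- by case/parP: h'' => _ h'' _; case/mirP: h' => h' _ _ _ _; lia.
- exact: mir_uniq h' h''.
Qed.

Lemma in_vmsgs p : (p \in M) = isSome (vsend (Y p.1) p.2).
Proof. by rewrite inE. Qed.

(** Messages between real nodes need no hypothesis: all nodes are in the same step and shift
    identifiers by the same power of two. The factor 2 arises because a trie node writes to at most
    two trie nodes, told apart by the parity of their keys. *)
Lemma static_load l R :
    (forall w, #|[set y | isSome (rsend w (Y (inl w)) (inr y))]| <= l * R) ->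
    (forall w, #|[set y | isSome (tsend y (Y (inr y)) (inl w))]| <= l * R) ->
    2 * #|[set y | isSome (Y (inr y)).2]| <= l * (n * R) ->
  load_ok vallowed l R M.
Proof.
move=> hrv hvr hvv; split.
- case=> [[w|y] [w'|y']]; rewrite in_vmsgs /=.
  + move/rsend_rr; rewrite pcE.
    have h1 : 0 < 2 ^ pc by rewrite expn_gt0.
    have h2 : 0 < 2 ^ (pc - L) by rewrite expn_gt0.
    by case: ifP => _ h; apply/eqP => e; subst w'; [|case: h => _ h]; move: h => /=; lia.
  + exact: rsend_rv.
  + exact: tsend_vr.
  + case/tsend_vv => _; case: is_down => [/orP [] ->|->] //; rewrite ?orbT //.
- move=> w; apply/card_le1_eqP => -[x1 x2] [x1' x2'].
  rewrite !inE /vmsg /= => /and3P [h1 /eqP e1 h2] /and3P [h1' /eqP e1' h2']; subst.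
  case: x2 h1 h2 => // w1 /rsend_rr h1 _; case: x2' h1' h2' => // w2 /rsend_rr h2 _.
  congr (_, inl _); apply: val_inj => /=; move: h1 h2; rewrite pcE; case: ifP => _; lia.
- move=> w; apply/card_le1_eqP => -[x1 x2] [x1' x2'].
  rewrite !inE /vmsg /= => /and3P [h1 h2 /eqP e1] /and3P [h1' h2' /eqP e1']; subst.
  case: x1 h1 h2 => // w1 /rsend_rr h1 _; case: x1' h1' h2' => // w2 /rsend_rr h2 _.
  congr (inl _, _); apply: val_inj => /=; move: h1 h2; rewrite !pcE; case: ifP => _; lia.
- move=> w; apply: leq_trans (hrv w).
  pose g (p : X * X) : tnode n := if p.2 is inr y then y else (w, ord0, w).
  rewrite -(card_in_imset (f := g)).
    apply: subset_leq_card; apply/subsetP => y /imsetP [[x1 x2]].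
    by rewrite !inE /vmsg /= => /and3P [h1 /eqP e1 h2]; case: x2 h1 h2; rewrite ?e1 // => y' h _ ->.
  move=> [x1 x2] [x1' x2']; rewrite !inE /vmsg /=.
  move=> /and3P [h1 /eqP -> h2] /and3P [h1' /eqP -> h2'].
  by rewrite /g /=; case: x2 h2 {h1} => // y _; case: x2' h2' {h1'} => // y' _ ->.
- move=> w; apply: leq_trans (hvr w).
  pose g (p : X * X) : tnode n := if p.1 is inr y then y else (w, ord0, w).
  rewrite -(card_in_imset (f := g)).
    apply: subset_leq_card; apply/subsetP => y /imsetP [[x1 x2]].
    by rewrite !inE /vmsg /= => /and3P [h1 h2 /eqP e1]; case: x1 h1 h2; rewrite ?e1 // => y' h _ ->.
  move=> [x1 x2] [x1' x2']; rewrite !inE /vmsg /=.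
  move=> /and3P [h1 h2 /eqP ->] /and3P [h1' h2' /eqP ->].
  by rewrite /g /=; case: x1 h2 {h1} => // y _; case: x1' h2' {h1'} => // y' _ ->.
- apply: leq_trans hvv; case: (posnP n) => [n0|n_gt0].
    rewrite (eq_card0 _) // => -[[w|[[w a] b]] x2].
      by rewrite !inE /= andbF.
    by exfalso; have := ltn_ord w; rewrite [X in _ < X]n0.
  pose w := Ordinal n_gt0; pose y0 : tnode n := (w, ord0, w).
  pose g (p : X * X) : tnode n * bool :=
    if p is (inr y, inr y') then (y, odd (key y')) else (y0, true).
  have -> : 2 * #|[set y | isSome (Y (inr y)).2]| =
            #|setX [set y | isSome (Y (inr y)).2] [set: bool]|.
    by rewrite cardsX cardsT card_bool mulnC.
  rewrite -(card_in_imset (f := g)).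
    apply: subset_leq_card; apply/subsetP => yb /imsetP [[[?|y] [?|y']]]; rewrite !inE ?andbF //.
    by rewrite /vmsg /= andbT => /tsend_vv [h _] ->; rewrite /= h.
  move=> [[?|y1] [?|y1']] [[?|y2] [?|y2']]; rewrite !inE ?andbF //.
  by rewrite /vmsg /= !andbT => h1 h2 [e1 e2]; subst; rewrite (vv_target_uniq h1 h2 e2).
Qed.

End Static.
End Algorithm.

(** * All-reduce *)

Lemma logc_gt0 n : 0 < logc n.
Proof. by []. Qed.

Lemma ltn_exp_logc n : n < 2 ^ logc n.
Proof. exact: trunc_log_ltn. Qed.

Section Phases.

Variables (n : nat) (nb : 'I_n -> {set 'I_n}) (l N : nat).
Notation L := (logc n).
Notation X := (vnode n (tnode n)).
Notation dist := ('I_n -> option (nat * option 'I_n)).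
Notation vst := (forall x : X, vstate x).
Notation step := (@vstep n (tnode n) msg (@vstate n) (@vsend n) (@vrecv n)).
Notation vm := (vmsg (@vsend n)).
Hypothesis n_gt0 : 0 < n.
Hypothesis l_ge : 4 * L <= l.

Definition conf (Y : vst) (rem : 'I_n -> nat) (ph : nat) (dd : dist)
    (fr : 'I_n -> {set 'I_n}) (acc : 'I_n -> nat * nat * nat) (pc : nat)
    (cnt : tnode n -> nat) (act : tnode n -> option msg) : Prop :=
  (forall w, Y (inl w) = RState (nb w) (rem w) (fr w) (acc w) pc ph (dd w)) /\
  (forall y, Y (inr y) = (cnt y, act y)).

(** All that the simulation needs from one ideal step; [ok_dist] exposes the outputs visible during
    that step. *)
Record step_ok (Y : vst) (R : nat) (dd : dist) : Prop := StepOk {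
  ok_sync : forall w, (rlen (Y (inl w))).+1 = R;
  ok_len : 0 < R <= N;
  ok_load : load_ok (@vallowed n) l R (vmsgs (@vsend n) Y);
  ok_dec : forall p m, vm Y p = Some m -> dec (enc n m) = m;
  ok_dist : forall w, r_dist (Y (inl w)) = dd w
}.

Definition small (m : msg) : bool :=
  [&& (payload m).1.1 <= n * n, (payload m).1.2 <= n * n & (payload m).2 <= n * n].

Lemma tsend_msg (y : tnode n) st x m : tsend y st x = Some m ->
  st.2 = Some m \/ (m = MDown \/ m = MCross).
Proof.
by rewrite /tsend; case: st => c [[]|] //=; case: x => // ?; intros;
  match goal with h : _ = Some m |- _ => move: h end; repeat (case: ifP => // _);
  case=> <-; auto.
Qed.

(** A trie node below the root writes to its owner only to answer a query; count and minimum reports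
    reach the owner from the root alone. Hence the two alternatives for the load received by a real
    node. *)
Lemma conf_ok Y rem ph dd fr acc pc cnt act R :
    conf Y rem ph dd fr acc pc cnt act ->
    (forall w, small (MSum (acc w).1.1 (acc w).1.2 (acc w).2)) ->
    (forall y m, act y = Some m -> small m) ->
    (forall w, (if pc < 2 * L then 0 else body_len n (acc w)).+1 = R) ->
    R <= N ->
    (forall w, #|[set y | isSome (rsend w (Y (inl w)) (inr y))]| <= l * R) ->
    (forall w, #|[set y | own y == w & isSome (act y)]| <= l * R \/
               #|[set y | [&& own y == w, ht y == L & isSome (act y)]]| <= l * R /\
               (forall y c, act y <> Some (MReply c))) ->
    2 * #|[set y | isSome (act y)]| <= l * (n * R) ->
  step_ok Y R dd.
Proof.
move=> [cr ct] sacc sact syn RN hrv hvr hvv; split.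
- by move=> w; rewrite cr; apply: syn.
- by rewrite RN andbT -(syn (Ordinal n_gt0)).
- apply: (@static_load _ _ pc); first by move=> w; rewrite cr.
  + exact: hrv.
  + move=> w; case: (hvr w) => [h|[h nr]].
      apply: leq_trans h; apply: subset_leq_card; apply/subsetP => y.
      rewrite !inE ct => h; rewrite (tsend_vr h) /=.
      by move: h; rewrite /tsend /=; case: (act y).
    apply: leq_trans h; apply: subset_leq_card; apply/subsetP => y.
    rewrite !inE ct => h; rewrite (tsend_vr h) /=.
    move: h; rewrite /tsend /=; case e: (act y) => [[]|] //=;
      try (by case: ifP => // /andP [_ ->]).
    by have := nr y; rewrite e => /(_ _ erefl).
  + apply: leq_trans hvv; rewrite leq_mul2l /=; apply: subset_leq_card.
    by apply/subsetP => y; rewrite !inE ct.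
- move=> [[w|y] x] m; rewrite /vmsg /= ?ct ?cr.
    move=> h; apply: encK; move: h; case: x => [w'|y] /=.
      by case: ifP => // _ [<-]; apply: sacc.
    by repeat (case: ifP => // _); case=> <-.
  move=> h; apply: encK.
  by case: (tsend_msg h) => [/sact //|[->|->]].
- by move=> w; rewrite cr.
Qed.

Lemma exists_vnode (P : pred X) :
  [exists x, P x] = [exists w, P (inl w)] || [exists y, P (inr y)].
Proof.
apply/existsP/orP => [[[w|y] Px]|[/existsP [w Pw]|/existsP [y Py]]].
- by left; apply/existsP; exists w.
- by right; apply/existsP; exists y.
- by exists (inl w).
- by exists (inr y).
Qed.

Lemma sum_vnode (F : X -> nat) :
  \sum_x F x = \sum_w F (inl w) + \sum_y F (inr y).
Proof. exact: big_sumType. Qed.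

Lemma trecv_kind (t : nat) (y : tnode n) st (ib : {ffun X -> option msg}) :
  (forall x m, ib x = Some m -> tag m = t) ->
  trecv y st ib = if [exists x, isSome (ib x)] then react t y st.1 ib else (st.1, None).
Proof.
move=> ht; rewrite /trecv; case: pickP => [x sx|none].
  have -> : [exists x, isSome (ib x)] by apply/existsP; exists x.
  by case e : (ib x) sx => [m|] // _; rewrite (ht x m e).
case: ifP => // /existsP [x]; by rewrite none.
Qed.

Definition ext (g : 'I_n -> nat) (i : nat) : nat := if insub i is Some j then g j else 0.

(* Partial sums over windows of length [2 ^ k], truncated at [n]. *)
Definition win (g : 'I_n -> nat) (k i : nat) : nat := \sum_(i <= j < i + 2 ^ k) ext g j.

Lemma ext_ord g (w : 'I_n) : ext g w = g w.
Proof. by rewrite /ext valK. Qed.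

Lemma ext_out g i : n <= i -> ext g i = 0.
Proof. by move=> le_n; rewrite /ext insubN // -leqNgt. Qed.

Lemma win0 g (w : 'I_n) : win g 0 w = g w.
Proof. by rewrite /win addn1 big_nat1 ext_ord. Qed.

Lemma winS g k i : win g k.+1 i = win g k i + win g k (i + 2 ^ k).
Proof.
rewrite /win expnS mul2n -addnn addnA.
by rewrite -big_cat_nat //= leq_addr.
Qed.

Lemma sum_ext g m : n <= m -> \sum_(0 <= j < m) ext g j = \sum_w g w.
Proof.
move=> le_n; rewrite (big_cat_nat (leq0n n) le_n) /= [X in _ + X]big_nat_cond.
rewrite [X in _ + X]big1 ?addn0; last first.
  by move=> i /andP [/andP [h _] _]; apply: ext_out.
by rewrite big_mkord; apply: eq_bigr => w _; rewrite ext_ord.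
Qed.

Lemma win_total g : win g L 0 = \sum_w g w.
Proof. by rewrite /win add0n sum_ext // ltnW // ltn_exp_logc. Qed.

Lemma win_out g k i : n <= i -> win g k i = 0.
Proof.
move=> le_n; rewrite /win big_nat_cond big1 // => j /andP [/andP [h _] _].
by apply: ext_out; apply: leq_trans h.
Qed.

Lemma win_leq g k i : win g k i <= \sum_w g w.
Proof.
rewrite -(@sum_ext g (maxn n (i + 2 ^ k))) ?leq_maxl //.
have h1 : i <= i + 2 ^ k by rewrite leq_addr.
have h2 : i + 2 ^ k <= maxn n (i + 2 ^ k) by rewrite leq_maxr.
rewrite (big_cat_nat (leq0n i) (leq_trans h1 h2)) /= (big_cat_nat h1 h2) /=.
by rewrite /win; lia.
Qed.

Lemma win_recv g k (w : 'I_n) :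
  \sum_(w' : 'I_n) (if w' == w + 2 ^ k :> nat then win g k w' else 0)
    = win g k (w + 2 ^ k).
Proof.
rewrite -big_mkcond /=; case: (ltnP (w + 2 ^ k) n) => [lt|le].
  by rewrite (big_pred1 (Ordinal lt)).
rewrite win_out // big_pred0 // => w'.
by apply/negP => /eqP e; have := ltn_ord w'; lia.
Qed.

Definition idle : tnode n -> option msg := fun=> None.

Section AllReduce.

Variables (rem : 'I_n -> nat) (ph : nat) (dd : dist) (cnt : tnode n -> nat).
Variables g1 g2 g3 : 'I_n -> nat.
Hypotheses (le1 : \sum_w g1 w <= n * n) (le2 : \sum_w g2 w <= n * n)
  (le3 : \sum_w g3 w <= n * n).
Hypothesis N_gt0 : 0 < N.

Definition acc_up k (w : 'I_n) := (win g1 k w, win g2 k w, win g3 k w).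

Definition total : nat * nat * nat := (\sum_w g1 w, \sum_w g2 w, \sum_w g3 w).

(** The broadcast doubles the informed prefix of identifiers in each step; nodes beyond it still
    hold their window sums. *)
Definition acc_down k (w : 'I_n) := if w < 2 ^ k then total else acc_up L w.

Lemma idle_ok Y fr acc pc :
  conf Y rem ph dd fr acc pc cnt idle -> pc < 2 * L ->
  (forall w, small (MSum (acc w).1.1 (acc w).1.2 (acc w).2)) ->
  step_ok Y 1 dd.
Proof.
move=> cf lt_pc sm; apply: (conf_ok cf) => //.
- by rewrite lt_pc.
- move=> w; rewrite (eq_card0 _) // => y.
  by rewrite !inE (cf.1 w) /= lt_pc.
- by move=> w; left; rewrite (eq_card0 _) // => y; rewrite !inE /idle andbF.
- by rewrite (eq_card0 _) ?muln0 // => y; rewrite !inE.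
Qed.

Lemma idle_tree Y fr acc pc y :
  conf Y rem ph dd fr acc pc cnt idle -> pc < 2 * L ->
  step Y (inr y) = (cnt y, None).
Proof.
move=> [cr ct] lt_pc; rewrite /vstep /= (@trecv_kind 0) ?ct.
  case: ifP => // /existsP [[w|y']]; rewrite ffunE /vmsg /= ?ct ?cr //=.
by case=> [w|y'] m; rewrite ffunE /vmsg /= ?ct ?cr //= lt_pc.
Qed.

Lemma up_step Y fr k : conf Y rem ph dd fr (acc_up k) k cnt idle -> k < L ->
  conf (step Y) rem ph dd fr (acc_up k.+1) k.+1 cnt idle /\ step_ok Y 1 dd.
Proof.
move=> cf lt_k; have lt_2 : k < 2 * L by lia.
split; last first.
  by apply: idle_ok cf lt_2 _ => w; rewrite /small /= !(leq_trans (win_leq _ _ _)).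
split=> [w|y]; last exact: idle_tree cf lt_2.
case: cf => cr ct; rewrite /vstep /= cr /rrecv lt_k /acc_up /=.
have ibE (pr : nat * nat * nat -> nat) (g : 'I_n -> nat) :
   pr (0, 0, 0) = 0 -> (forall w', pr (acc_up k w') = win g k w') ->
   \sum_x pr (sum3 ([ffun x' => vm Y (x', inl w)] x)) = win g k (w + 2 ^ k).
  move=> pr0 prE; rewrite sum_vnode [X in _ + X]big1 ?addn0; last first.
    by move=> y _; rewrite ffunE /vmsg /= ct.
  rewrite -win_recv; apply: eq_bigr => w' _; rewrite ffunE /vmsg /= cr /= lt_k.
  by case: ifP => _; rewrite /= ?pr0 ?prE.
rewrite (ibE (fun p => p.1.1) g1) // (ibE (fun p => p.1.2) g2) //.
by rewrite (ibE (fun p => p.2) g3) // -!winS.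
Qed.

Lemma down_step Y fr fr' k :
    conf Y rem ph dd fr (acc_down k) (L + k) cnt idle -> k < L ->
    (forall w, fr' w = if (L + k).+1 == 2 * L then
       [set j : 'I_n | (j == 0 :> nat) && poor (acc_down k.+1 w) (rem w)] else fr w) ->
  conf (step Y) rem ph dd fr' (acc_down k.+1) (L + k).+1 cnt idle /\ step_ok Y 1 dd.
Proof.
move=> cf lt_k fr'E; have lt_2 : L + k < 2 * L by lia.
split; last first.
  apply: idle_ok cf lt_2 _ => w; rewrite /acc_down; case: ifP => _.
    by rewrite /small /= le1 le2 le3.
  by rewrite /small /= !(leq_trans (win_leq _ _ _)).
split=> [w|y]; last exact: idle_tree cf lt_2.
case: cf => cr ct; rewrite /vstep /= cr /rrecv.
have nlt : L + k < L = false by lia.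
rewrite nlt lt_2 fr'E.
have msgE x : [ffun x' => vm Y (x', inl w)] x =
    if x is inl w' then
      if (w' < 2 ^ k) && (w == w' + 2 ^ k :> nat) then
        Some (MSum total.1.1 total.1.2 total.2) else None
    else None.
  rewrite ffunE /vmsg; case: x => [w'|y] /=; rewrite ?ct // cr /= nlt lt_2 addKn /=.
  by rewrite /acc_down; case: (w' < 2 ^ k).
have -> : (if [pick x | isSome ([ffun x' => vm Y (x', inl w)] x)] is Some x
   then sum3 ([ffun x' => vm Y (x', inl w)] x) else acc_down k w) = acc_down k.+1 w.
  case: pickP => [x|none].
    rewrite msgE; case: x => // w'; case: ifP => // /andP [h1 /eqP h2] _.
    by rewrite /acc_down h2 expnS mul2n -addnn ltn_add2r h1.
  rewrite /acc_down; case: ifP => [h|h].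
    by rewrite (leq_trans h) // leq_exp2l.
  case: ifP => // h'; exfalso.
  have le_w : w - 2 ^ k < n by apply: leq_ltn_trans (ltn_ord w); rewrite leq_subr.
  have := none (inl (Ordinal le_w)); rewrite msgE /=.
  have -> : w - 2 ^ k < 2 ^ k by move: h'; rewrite expnS; lia.
  by rewrite subnK ?eqxx // leqNgt h.
by [].
Qed.

(** Recursive doubling: windows double until the window of node 0 covers everything, because
    [n < 2 ^ L]; then the total travels back by doubling. *)
Lemma all_reduce Y : conf Y rem ph dd (fun=> set0) (fun w => (g1 w, g2 w, g3 w)) 0 cnt idle ->
  conf (iter (2 * L) step Y) rem ph dd
    (fun w => [set j : 'I_n | (j == 0 :> nat) && poor total (rem w)])
    (fun=> total) (2 * L) cnt idle /\
  (forall k, k < 2 * L -> step_ok (iter k step Y) 1 dd).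
Proof.
move=> cf0.
have up k : k <= L ->
  conf (iter k step Y) rem ph dd (fun=> set0) (acc_up k) k cnt idle /\
  (forall j, j < k -> step_ok (iter j step Y) 1 dd).
  elim: k => [_|k IH lt_k].
    split=> //; case: cf0 => cr ct; split=> // w.
    by rewrite /= cr /acc_up !win0.
  have [cf ok] := IH (ltnW lt_k); have [cf' ok'] := up_step cf lt_k; split=> //.
  by move=> j; rewrite ltnS leq_eqVlt => /orP [/eqP ->|/ok].
pose frk k w := if L + k == 2 * L then
  [set j : 'I_n | (j == 0 :> nat) && poor (acc_down k w) (rem w)] else set0.
have down k : k <= L ->
  conf (iter (L + k) step Y) rem ph dd (frk k) (acc_down k) (L + k) cnt idle /\
  (forall j, j < L + k -> step_ok (iter j step Y) 1 dd).
  elim: k => [_|k IH lt_k].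
    rewrite addn0; have [[cr ct] ok] := up L (leqnn L); split=> //; split=> // w.
    rewrite cr /frk /acc_down; have -> : L + 0 == 2 * L = false.
      by have := logc_gt0 n; lia.
    case: ifP => // h; congr RState; rewrite expn0 ltnS leqn0 in h.
    by rewrite /acc_up (eqP h) !win_total.
  have [cf ok] := IH (ltnW lt_k).
  rewrite addnS.
  have [|cf' ok'] := down_step (fr' := frk k.+1) cf lt_k.
    move=> w; rewrite /frk addnS; case: ifP => // _.
    by have -> : L + k == 2 * L = false by lia.
  split=> //.
  by move=> j; rewrite ltnS leq_eqVlt => /orP [/eqP ->|/ok].
have eL : L + L = 2 * L by lia.
have := down L (leqnn L); rewrite eL => -[[cr ct] ok]; split=> //; split=> // w.
rewrite cr /frk eL eqxx /acc_down.
by rewrite (leq_trans (ltn_ord w)) // ltnW // ltn_exp_logc.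
Qed.

End AllReduce.

End Phases.

(** * Counting in tries *)

Section Counting.

Variable n : nat.
Notation L := (logc n).
Implicit Types (A : 'I_n -> {set 'I_n}) (y : tnode n).

Definition below A y : {set 'I_n} := [set u in A (own y) | u %/ 2 ^ ht y == key y].

Definition cntS A y : nat := #|below A y|.

Lemma div_ord_lt (u : 'I_n) h : u %/ 2 ^ h < n.
Proof. exact: leq_ltn_trans (leq_div _ _) (ltn_ord u). Qed.

(** The ancestor at height [h] of the leaf [u] in the trie of [w]. *)
Definition nd (w : 'I_n) (h : nat) (u : 'I_n) : tnode n :=
  (w, inord h, Ordinal (div_ord_lt u h)).

Lemma ht_le y : ht y <= L.
Proof. by rewrite -ltnS /ht. Qed.

Lemma ht_nd w h u : h <= L -> ht (nd w h u) = h.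
Proof. by move=> le_h; rewrite /ht /nd /= inordK. Qed.

Lemma divn_expS u h : u %/ 2 ^ h.+1 = (u %/ 2 ^ h)./2.
Proof. by rewrite expnSr divnMA divn2. Qed.

Lemma ord_div0 (u : 'I_n) : u %/ 2 ^ L = 0.
Proof. by rewrite divn_small // (ltn_trans (ltn_ord u)) // ltn_exp_logc. Qed.

Lemma ndE w h u y : h <= L ->
  (nd w h u == y) = [&& own y == w, ht y == h & u %/ 2 ^ h == key y].
Proof.
move=> le_h; apply/eqP/and3P => [<-|[/eqP h1 /eqP h2 /eqP h3]].
  by rewrite (ht_nd _ _ le_h) /own /key !eqxx.
by apply: tnode_eqP; rewrite ?ht_nd //; apply: val_inj.
Qed.

Lemma sum_children A y : 0 < ht y -> \sum_(y' | par y' y) cntS A y' = cntS A y.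
Proof.
case eh : (ht y) => [//|h] _; have le_h : h <= L by have := ht_le y; lia.
rewrite /cntS -sum1_card.
rewrite (partition_big (nd (own y) h) (fun y' => par y' y)) /=.
  apply: eq_bigr => y' /parP [e1 e2 e3].
  have eh' : ht y' = h by lia.
  rewrite -sum1_card; apply: eq_bigl => u; rewrite !inE ndE // -e1 eqxx eh' eqxx eh /=.
  by rewrite divn_expS e3; case: (u \in _) => //=; case: eqP => [->|]; rewrite ?eqxx ?andbF.
move=> u; rewrite inE => /andP [_ /eqP hu]; apply/parP; split=> //.
  by rewrite ht_nd.
by rewrite -[LHS]hu eh divn_expS.
Qed.

Lemma sum_level A w h : h <= L ->
  \sum_(y | (own y == w) && (ht y == h)) cntS A y = #|A w|.
Proof.
move=> le_h; rewrite -[RHS]sum1_card.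
rewrite (partition_big (nd w h) (fun y => (own y == w) && (ht y == h))) /=.
  apply: eq_bigr => y /andP [/eqP e1 /eqP e2].
  rewrite /cntS -sum1_card; apply: eq_bigl => u; rewrite !inE ndE // e1 e2 !eqxx.
  by [].
by move=> u _; rewrite ht_nd // /own !eqxx.
Qed.

(** Every element of [A w] lies below one node of the level, so the nonempty nodes of a level are at
    most as many as the elements. *)
Lemma card_level A w h : h <= L ->
  #|[set y | [&& own y == w, ht y == h & 0 < cntS A y]]| <= #|A w|.
Proof.
move=> le_h; rewrite -(sum_level A w le_h) -sum1_card.
rewrite [X in X <= _](eq_bigl (fun y => (own y == w) && (ht y == h) && (0 < cntS A y))).
  rewrite big_mkcondr; apply: leq_sum => y _; case: ifP => //.
by move=> y; rewrite inE -andbA.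
Qed.

Lemma card_layer A h : h <= L ->
  #|[set y | (ht y == h) && (0 < cntS A y)]| <= \sum_w #|A w|.
Proof.
move=> le_h; rewrite -sum1_card (partition_big (@own n) xpredT) //=.
apply: leq_sum => w _; apply: leq_trans (card_level A w le_h).
rewrite -sum1_card; apply: eq_leq; apply: eq_bigl => y.
by rewrite !inE andbC.
Qed.

Lemma cntS_leq A y : cntS A y <= n.
Proof. by rewrite -[X in _ <= X]card_ord max_card. Qed.

Lemma cntS_gt0 A y : (0 < cntS A y) = [exists u in A (own y), u %/ 2 ^ ht y == key y].
Proof.
apply/card_gt0P/exists_inP => [[u]|[u h1 h2]].
  by rewrite inE => /andP [h1 h2]; exists u.
by exists u; rewrite inE h1.
Qed.

Lemma cntS_leaf A y : ht y = 0 -> cntS A y = (key y \in A (own y)).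
Proof.
move=> h0; rewrite /cntS; have -> : below A y = if key y \in A (own y) then [set key y] else set0.
  apply/setP => u; rewrite !inE h0 expn0 divn1.
  case: (eqVneq u (key y)) => [->|ne]; first by rewrite eqxx andbT; case: ifP; rewrite ?inE ?eqxx.
  have -> : (nat_of_ord u == key y) = false by apply/negbTE; rewrite (inj_eq val_inj).
  by rewrite andbF; case: ifP; rewrite ?inE // (negbTE ne).
by case: ifP; rewrite ?cards1 ?cards0.
Qed.

Lemma card_half (F : {set 'I_n}) :
  #|[set k : 'I_n | [exists j in F, j == k./2 :> nat]]| <= 2 * #|F|.
Proof.
have lt (k : 'I_n) : k./2 < n by have := ltn_ord k; lia.
pose g (k : 'I_n) := (Ordinal (lt k), odd k).
rewrite -(card_imset (f := g)).
  have -> : 2 * #|F| = #|setX F [set: bool]| by rewrite cardsX cardsT card_bool mulnC.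
  apply: subset_leq_card; apply/subsetP => p /imsetP [k]; rewrite inE => /exists_inP [j jF /eqP e] ->.
  by rewrite inE in_setT andbT; have -> : (g k).1 = j by apply: val_inj.
move=> k k' [e1 e2]; apply: val_inj; rewrite /= -(odd_double_half k) -(odd_double_half k').
by rewrite e1 e2.
Qed.

End Counting.

(** * Insertion phases *)

Section SetupPhase.

Variables (n : nat) (nb : 'I_n -> {set 'I_n}) (l N : nat).
Notation L := (logc n).
Notation X := (vnode n (tnode n)).
Notation vst := (forall x : X, vstate x).
Notation step := (@vstep n (tnode n) msg (@vstate n) (@vsend n) (@vrecv n)).
Notation vm := (vmsg (@vsend n)).
Hypothesis n_gt0 : 0 < n.
Hypothesis l_ge : 4 * L <= l.

(** [U v] is the set of neighbours whose edge with [v] is still missing. No node stores it; a node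
    starts the phase knowing only its size. *)
Variables (U : 'I_n -> {set 'I_n}) (ph : nat) (dd : 'I_n -> option (nat * option 'I_n)).
Variable t : nat * nat * nat.
Hypothesis U_sub : forall v, U v \subset nb v.
Hypothesis U_sym : forall u v, (u \in U v) = (v \in U u).
Hypothesis t_setup : setup t.
Hypothesis t_small : small n (MSum t.1.1 t.1.2 t.2).

Definition rlenS : nat := (theta t %/ L).+1.
Hypothesis R_le : rlenS <= N.

Definition isP (v : 'I_n) : bool := poor t #|U v|.
Definition ins (v : 'I_n) : {set 'I_n} := nb v :\: U v.
Definition new (v : 'I_n) : {set 'I_n} := [set u in U v | isP v || isP u].
Definition rest (v : 'I_n) : {set 'I_n} := U v :\: new v.
Definition remU (v : 'I_n) : nat := #|U v|.

Definition frS (h : nat) (w : 'I_n) : {set 'I_n} :=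
  [set k : 'I_n | isP w && [exists u in U w, u %/ 2 ^ h == k]].

Definition asked (h : nat) (y : tnode n) : bool :=
  (ht y == h) && [exists k in frS h.+1 (own y), k == (key y)./2 :> nat].

Definition act_reply (h : nat) (y : tnode n) : option msg :=
  if asked h y then Some (MReply (cntS ins y)) else None.

Definition cnt_up (h : nat) (y : tnode n) : nat :=
  cntS ins y + if ht y <= h then cntS new y else 0.

Definition act_up (h : nat) (y : tnode n) : option msg :=
  if (ht y == h) && (0 < cntS new y) then Some (MUpC (cntS new y)) else None.

Notation confS Y fr pc cnt act := (conf nb Y remU ph dd fr (fun=> t) pc cnt act).

Lemma theta_lt : theta t < L * rlenS.
Proof. by rewrite /rlenS mulnC; apply: ltn_ceil. Qed.

Lemma poor_card w : isP w -> #|U w| <= theta t.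
Proof. by case/andP. Qed.

Lemma card_frS h w : #|frS h w| <= theta t.
Proof.
case Pw: (isP w); last first.
  by rewrite (eq_card0 _) // => k; rewrite !inE Pw.
apply: leq_trans (poor_card Pw).
pose g (u : 'I_n) : 'I_n := Ordinal (div_ord_lt u h).
apply: leq_trans (leq_imset_card g (U w)); apply: subset_leq_card.
apply/subsetP => k; rewrite inE => /andP [_ /exists_inP [u uU /eqP e]].
by apply/imsetP; exists u => //; apply: val_inj.
Qed.

(** Charge each new edge to an endpoint satisfying [isP], which has at most [theta t] missing edges;
    the factor 2 counts the two tries. *)
Lemma card_new : \sum_w #|new w| <= 2 * (n * theta t).
Proof.
pose b w u : nat := (u \in U w) && isP w.
have sb : \sum_w \sum_u b w u <= n * theta t.
  rewrite -[n in n * _]card_ord -sum_nat_const; apply: leq_sum => w _; rewrite /b.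
  case Pw: (isP w); last by rewrite big1 // => u _; rewrite andbF.
  apply: leq_trans (poor_card Pw); rewrite -sum1_card [X in _ <= X]big_mkcond.
  by apply: leq_sum => u _; rewrite andbT; case: (u \in U w).
apply: (@leq_trans (\sum_w \sum_u b w u + \sum_w \sum_u b u w)).
  rewrite -big_split /=; apply: leq_sum => w _; rewrite -big_split /= -sum1_card.
  rewrite big_mkcond; apply: leq_sum => u _; rewrite inE /b (U_sym w u).
  by case: (u \in U w) => //; case: (isP w); case: (isP u).
by rewrite [X in _ + X]exchange_big /= mul2n -addnn leq_add.
Qed.

Lemma frS_top w : [set j : 'I_n | (j == 0 :> nat) && poor t (remU w)] = frS L w.
Proof.
apply/setP => j; rewrite !inE andbC -/(isP w); case Pw: (isP w) => //=.
have [u uU] : exists u, u \in U w.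
  by apply/card_gt0P; case/andP: Pw.
apply/idP/exists_inP => [/eqP ->|[u' _ /eqP <-]]; last by rewrite ord_div0.
by exists u => //; rewrite ord_div0.
Qed.

Lemma real_pass Y fr pc cnt act w :
    confS Y fr pc cnt act -> 2 * L <= pc -> pc - 2 * L != 3 * L + 1 ->
    ~~ ((pc - 2 * L < 2 * L) && odd (pc - 2 * L)) ->
  step Y (inl w) = RState (nb w) (remU w) (fr w) t pc.+1 ph (dd w).
Proof.
move=> [cr ct] le_pc ne nodd; rewrite /vstep /= cr /rrecv.
have -> : pc < L = false by lia.
have -> : pc < 2 * L = false by lia.
by rewrite t_setup (negbTE ne) (negbTE nodd).
Qed.

Lemma rsend_tree Y fr pc cnt act w y :
    confS Y fr pc cnt act -> 2 * L <= pc ->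
  vm Y (inl w, inr y) =
    if pc - 2 * L < 2 * L then
      if [&& ~~ odd (pc - 2 * L), own y == w, ht y == L - ((pc - 2 * L)./2).+1
           & [exists k in fr w, k == (key y)./2 :> nat]]
      then Some MQuery else None
    else if [&& pc - 2 * L == 2 * L, ht y == 0
           & (own y == w) && (key y \in fr w) || (key y == w) && (own y \in fr w)]
      then Some MInsert else None.
Proof.
move=> [cr ct] le_pc; rewrite /vmsg /= cr /= t_setup.
by have -> : pc < 2 * L = false by lia.
Qed.

(** From [theta t < L * rlenS] and [4 * L <= l], a step has room for [4 * theta t] messages per
    node. *)
Lemma body_ok Y fr pc cnt act :
    confS Y fr pc cnt act -> 2 * L <= pc ->
    (forall y m, act y = Some m -> small n m) ->
    (forall w, #|[set y | isSome (vm Y (inl w, inr y))]| <= 2 * theta t) ->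
    (forall w, #|[set y | own y == w & isSome (act y)]| <= 2 * theta t \/
               #|[set y | [&& own y == w, ht y == L & isSome (act y)]]| <= 2 * theta t /\
               (forall y c, act y <> Some (MReply c))) ->
    #|[set y | isSome (act y)]| <= 2 * (n * theta t) ->
  step_ok l N Y rlenS dd.
Proof.
move=> cf le_pc sact h1 h2 h3.
have th := theta_lt; have le_th : 2 * theta t <= l * rlenS by nia.
apply: (conf_ok n_gt0 cf) => //.
- by move=> _; rewrite ltnNge le_pc /= /body_len t_setup.
- by move=> w; apply: leq_trans (h1 w) le_th.
- move=> w; case: (h2 w) => [h|[h h']]; [left|right; split=> //]; exact: leq_trans h le_th.
- apply: (@leq_trans (2 * (2 * (n * theta t)))); first by rewrite leq_mul2l h3.
  have le4 : 4 * theta t <= l * rlenS by nia.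
  have -> : 2 * (2 * (n * theta t)) = n * (4 * theta t) by lia.
  by rewrite [l * _]mulnCA leq_mul2l le4 orbT.
Qed.

Lemma act_small (act : tnode n -> option msg) h :
  act = act_reply h \/ act = act_up h -> forall y m, act y = Some m -> small n m.
Proof.
have nn : n <= n * n by nia.
by case=> -> y m; rewrite /act_reply /act_up; case: ifP => // _ [<-];
  rewrite /small /= (leq_trans (cntS_leq _ _) nn).
Qed.

Lemma card_asked h w : h <= L -> #|[set y | (own y == w) && asked h y]| <= 2 * theta t.
Proof.
move=> le_h; apply: leq_trans (_ : 2 * #|frS h.+1 w| <= _); last first.
  by rewrite leq_mul2l card_frS.
apply: leq_trans (card_half _).
rewrite -(card_in_imset (f := (@key n))).
  apply: subset_leq_card; apply/subsetP => k /imsetP [y].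
  by rewrite !inE => /and3P [/eqP <- _ h'] ->.
move=> y y'; rewrite !inE => /and3P [/eqP e1 /eqP e2 _] /and3P [/eqP e1' /eqP e2' _] e3.
by apply: tnode_eqP; rewrite ?e1 ?e2.
Qed.

Lemma query_step Y j : j < L ->
    confS Y (frS (L - j)) (2 * L + 2 * j) (cntS ins) (@idle n) ->
  confS (step Y) (frS (L - j)) (2 * L + 2 * j).+1 (cntS ins) (act_reply (L - j.+1)) /\
  step_ok l N Y rlenS dd.
Proof.
move=> lt_j cf; have le_pc : 2 * L <= 2 * L + 2 * j by lia.
have eo : 2 * L + 2 * j - 2 * L = 2 * j by lia.
have eh : L - j = (L - j.+1).+1 by lia.
have sendE w y : vm Y (inl w, inr y) =
    if (own y == w) && asked (L - j.+1) y then Some MQuery else None.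
  rewrite (rsend_tree _ _ cf) // eo.
  have -> : 2 * j < 2 * L by lia.
  have -> : odd (2 * j) = false by rewrite oddM.
  have -> : (2 * j)./2 = j by rewrite mul2n doubleK.
  rewrite /asked -eh /=; case: (eqVneq (own y) w) => [->|] //=.
split; last first.
  apply: (body_ok cf) => //.
  - move=> w; apply: leq_trans (@card_asked (L - j.+1) w _); last by lia.
    apply: subset_leq_card; apply/subsetP => y; rewrite !inE sendE.
    by case: ifP.
  - by move=> w; left; rewrite (eq_card0 _) // => y; rewrite !inE /idle andbF.
  - by rewrite (eq_card0 _) // => y; rewrite !inE.
split=> [w|y].
  by apply: (real_pass _ cf) => //; rewrite eo ?oddM ?andbF //; lia.
have [cr ct] := cf; rewrite /vstep /= (@trecv_kind _ 1) ?ct.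
  rewrite exists_vnode; have -> : [exists y', isSome ([ffun x' => vm Y (x', inr y)] (inr y'))] = false.
    by apply/existsP => -[y']; rewrite ffunE /vmsg /= ct.
  rewrite orbF /act_reply.
  have -> : [exists w, isSome ([ffun x' => vm Y (x', inr y)] (inl w))] = asked (L - j.+1) y.
    apply/existsP/idP => [[w]|h]; first by rewrite ffunE sendE; case: ifP => // /andP [].
    by exists (own y); rewrite ffunE sendE eqxx h.
  by case: ifP.
case=> [w|y'] m; rewrite ffunE; first by rewrite sendE; case: ifP => // _ [<-].
by rewrite /vmsg /= ct.
Qed.

Lemma reply_step Y j : j < L ->
    confS Y (frS (L - j)) (2 * L + 2 * j).+1 (cntS ins) (act_reply (L - j.+1)) ->
  confS (step Y) (frS (L - j.+1)) (2 * L + 2 * j.+1) (cntS ins) (@idle n) /\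
  step_ok l N Y rlenS dd.
Proof.
move=> lt_j cf; have le_pc : 2 * L <= (2 * L + 2 * j).+1 by lia.
have eo : (2 * L + 2 * j).+1 - 2 * L = (2 * j).+1 by lia.
have eh : L - j = (L - j.+1).+1 by lia.
set h := L - j.+1 in cf eh *; have le_h : h <= L by rewrite /h; lia.
have lt_o : (2 * j).+1 < 2 * L by lia.
have sendE w y : vm Y (inl w, inr y) = None.
  by rewrite (rsend_tree _ _ cf) // eo lt_o /= oddM.
have cact w : #|[set y | own y == w & isSome (act_reply h y)]| <= 2 * theta t.
  apply: leq_trans (@card_asked h w le_h).
  by apply: subset_leq_card; apply/subsetP => y; rewrite !inE /act_reply; case: asked.
split; last first.
  apply: (body_ok cf) => //.
  - by apply: act_small; left.
  - by move=> w; rewrite (eq_card0 _) // => y; rewrite !inE sendE.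
  - by move=> w; left.
  - rewrite -sum1_card (partition_big (@own n) xpredT) //=.
    rewrite mulnCA -[n in n * _]card_ord -sum_nat_const.
    apply: leq_sum => w _; rewrite sum1_card; apply: leq_trans (cact w).
    by apply: subset_leq_card; apply/subsetP => y; rewrite !inE unfold_in /= inE andbC.
have [cr ct] := cf; split=> [w|y].
  rewrite /vstep /= cr /rrecv.
  have -> : (2 * L + 2 * j).+1 < L = false by lia.
  have -> : (2 * L + 2 * j).+1 < 2 * L = false by lia.
  rewrite t_setup eo lt_o /= oddM /=.
  have -> : (2 * j).+1 == 3 * L + 1 = false by lia.
  have -> : uphalf (2 * j) = j by rewrite mul2n uphalf_double.
  have -> : (2 * L + 2 * j).+2 = 2 * L + 2 * j.+1 by lia.
  congr RState; apply/setP => k; rewrite !inE -/h.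
  pose y : tnode n := (w, inord h, k).
  have hy : ht y = h by rewrite /ht /= inordK.
  rewrite ffunE -/y /vmsg /= ct /tsend /= /act_reply /asked hy eqxx /=.
  have -> : own y = w by [].
  (* The neighbours split into inserted and missing ones, so the deficit of the counter is the
     number of missing edges below the key. *)
  have expE : (cntS ins y < expected (nb w) h k) = [exists u in U w, u %/ 2 ^ h == k].
    have -> : expected (nb w) h k = cntS ins y + cntS U y.
      rewrite /expected /cntS /below hy -cardsUI.
      rewrite [X in _ + X](eq_card0 _) ?addn0; last first.
        by move=> u; rewrite !inE; case: (u \in U _); rewrite ?andbF.
      apply: eq_card => u; rewrite !inE /own /key /=.
      have := subsetP (U_sub w) u; case: (u \in U w) => [->|_] //=.
      by rewrite orbF.
    by rewrite -[X in X < _]addn0 ltn_add2l cntS_gt0 hy.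
  case Pw: (isP w); last first.
    case: ifP => // /exists_inP [k']; by rewrite inE Pw.
  case: ifP => [_|/negbT]; first by rewrite eqxx /= expE.
  (* A key that was not asked has no parent in the frontier, hence nothing is missing below it. *)
  move/exists_inPn => none; rewrite /=; apply/esym/negbTE/exists_inPn => u uU.
  apply/eqP => e.
  have mem : Ordinal (div_ord_lt u h.+1) \in frS h.+1 w.
    by rewrite inE Pw; apply/exists_inP; exists u.
  by move/eqP: (none _ mem); apply; rewrite /= divn_expS e.
rewrite /vstep /= (@trecv_kind _ 1) ?ct.
  case: ifP => // /existsP [[w|y']]; rewrite ffunE ?sendE // /vmsg /= ct /tsend /= /act_reply.
  by case: asked.
case=> [w|y'] m; rewrite ffunE ?sendE //.
by rewrite /vmsg /= ct /tsend /= /act_reply; case: asked.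
Qed.

Lemma query_phase Y :
    confS Y (frS L) (2 * L) (cntS ins) (@idle n) ->
  confS (iter (2 * L) step Y) (frS 0) (4 * L) (cntS ins) (@idle n) /\
  (forall i, i < 2 * L -> step_ok l N (iter i step Y) rlenS dd).
Proof.
move=> cf0.
have H j : j <= L ->
  confS (iter (2 * j) step Y) (frS (L - j)) (2 * L + 2 * j) (cntS ins) (@idle n) /\
  (forall i, i < 2 * j -> step_ok l N (iter i step Y) rlenS dd).
  elim: j => [_|j IH lt_j]; first by rewrite muln0 addn0 subn0.
  have [cf ok] := IH (ltnW lt_j).
  have [cf1 ok1] := query_step lt_j cf; have [cf2 ok2] := reply_step lt_j cf1.
  have e2 : 2 * j.+1 = (2 * j).+2 by lia.
  rewrite [X in iter X]e2; split=> // i; rewrite e2 ltnS leq_eqVlt ltnS leq_eqVlt.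
  by case/or3P => [/eqP ->|/eqP ->|/ok].
have := H L (leqnn L); rewrite subnn; have -> : 2 * L + 2 * L = 4 * L by lia.
by [].
Qed.

Lemma in_frS0 k w : (k \in frS 0 w) = isP w && (k \in U w).
Proof.
rewrite inE; case: (isP w) => //=; apply/exists_inP/idP => [[u uU]|kU].
  by rewrite expn0 divn1 => /eqP /val_inj <-.
by exists k => //; rewrite expn0 divn1.
Qed.

Lemma insert_step Y :
    confS Y (frS 0) (4 * L) (cntS ins) (@idle n) ->
  confS (step Y) (frS 0) (4 * L).+1 (cnt_up 0) (act_up 0) /\
  step_ok l N Y rlenS dd.
Proof.
move=> cf; have Lgt0 := logc_gt0 n; have le_pc : 2 * L <= 4 * L by lia.
have eo : 4 * L - 2 * L = 2 * L by lia.
have sendE w y : vm Y (inl w, inr y) =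
    if (ht y == 0) && ((own y == w) && (key y \in frS 0 w)
                        || (key y == w) && (own y \in frS 0 w)) then Some MInsert else None.
  by rewrite (rsend_tree _ _ cf) // eo ltnn eqxx.
split; last first.
  apply: (body_ok cf) => //.
  (* [B1] contains the leaves in the trie of [w] itself, [B2] their mirrors in the tries of the
     neighbours. *)
  - move=> w; pose B1 := [set y | [&& ht y == 0, own y == w & key y \in frS 0 w]].
    pose B2 := [set y | [&& ht y == 0, key y == w & own y \in frS 0 w]].
    apply: (@leq_trans #|B1 :|: B2|).
      apply: subset_leq_card; apply/subsetP => y; rewrite !(inE, sendE).
      by case: (ht y == 0) => //=; case: ifP.
    apply: leq_trans (leq_card_setU _ _) _; rewrite mul2n -addnn.
    apply: leq_add; apply: leq_trans (card_frS 0 w).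
      rewrite -(card_in_imset (f := (@key n))).
        apply: subset_leq_card; apply/subsetP => k /imsetP [y].
        by rewrite [y \in B1]inE => /and3P [_ _ h] ->.
      move=> y y'; rewrite !inE => /and3P [/eqP e1 /eqP e2 _] /and3P [/eqP e1' /eqP e2' _] e3.
      by apply: tnode_eqP; rewrite ?e1 ?e2.
    rewrite -(card_in_imset (f := (@own n))).
      apply: subset_leq_card; apply/subsetP => k /imsetP [y].
      by rewrite [y \in B2]inE => /and3P [_ _ h] ->.
    move=> y y'; rewrite !inE => /and3P [/eqP e1 /eqP e2 _] /and3P [/eqP e1' /eqP e2' _] e3.
    by apply: tnode_eqP; rewrite ?e1 ?e2.
  - by move=> w; left; rewrite (eq_card0 _) // => y; rewrite !inE /idle andbF.
  - by rewrite (eq_card0 _) // => y; rewrite !inE.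
split=> [w|y].
  by apply: (real_pass _ cf) => //; rewrite eo ?ltnn //; lia.
have [cr ct] := cf; rewrite /vstep /= (@trecv_kind _ 3) ?ct.
  rewrite exists_vnode; have -> : [exists y', isSome ([ffun x' => vm Y (x', inr y)] (inr y'))] = false.
    by apply/existsP => -[y']; rewrite ffunE /vmsg /= ct.
  rewrite orbF /act_up /cnt_up leqn0.
  have -> : [exists w, isSome ([ffun x' => vm Y (x', inr y)] (inl w))] =
            (ht y == 0) && (key y \in new (own y)).
    rewrite inE; apply/existsP/andP => [[w]|[h0 /andP [kU Pk]]].
      rewrite ffunE sendE; case: ifP => // /andP [-> /orP [] /andP [/eqP <-]];
        rewrite in_frS0 => /andP [-> h] _; first by rewrite h.
      by rewrite U_sym h orbT.
    case/orP: Pk => Pk; [exists (own y)|exists (key y)]; rewrite ffunE sendE h0 eqxx.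
      by have -> : key y \in frS 0 (own y) by rewrite in_frS0 Pk kU.
    have -> : own y \in frS 0 (key y) by rewrite in_frS0 Pk U_sym kU.
    by rewrite orbT.
  case: (eqVneq (ht y) 0) => [h0|_] /=; last by rewrite addn0.
  rewrite (cntS_leaf new h0); case: (key y \in new (own y)) => /=; last by rewrite addn0.
  by rewrite addn1.
case=> [w|y'] m; rewrite ffunE; first by rewrite sendE; case: ifP => // _ [<-].
by rewrite /vmsg /= ct.
Qed.

Lemma send_late Y pc cnt act w y :
  confS Y (frS 0) pc cnt act -> 4 * L < pc -> vm Y (inl w, inr y) = None.
Proof.
move=> cf lt_pc; rewrite (rsend_tree _ _ cf); last by lia.
have -> : pc - 2 * L < 2 * L = false by lia.
by have -> : pc - 2 * L == 2 * L = false by lia.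
Qed.

(** Active trie nodes of a level are charged to the new edges below them. At height [L] only key 0
    can be nonempty, so an owner hears from one root. *)
Lemma up_ok Y pc cnt h :
    confS Y (frS 0) pc cnt (act_up h) -> 4 * L < pc -> h <= L ->
  step_ok l N Y rlenS dd.
Proof.
move=> cf lt_pc le_h; apply: (body_ok cf); first by lia.
- by apply: act_small; right.
- by move=> w; rewrite (eq_card0 _) // => y; rewrite !inE (send_late _ _ cf).
- move=> w; right; split; last by move=> y c; rewrite /act_up; case: ifP.
  apply: leq_trans (_ : 1 <= _); last by rewrite muln_gt0 /theta addn_gt0 orbT.
  have root y : y \in [set y | [&& own y == w, ht y == L & isSome (act_up h y)]] ->
      [/\ own y = w, ht y = L & val (key y) = 0].
    rewrite inE /act_up => /and3P [/eqP o1 /eqP h1]; case: ifP => // /andP [_ c] _.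
    move: c; rewrite cntS_gt0 h1 => /exists_inP [u _ /eqP e]; split=> //.
    by rewrite /= -e ord_div0.
  apply/card_le1_eqP => y y' /root [o1 h1 e1] /root [o2 h2 e2].
  apply: tnode_eqP; rewrite ?o1 ?o2 ?h1 ?h2 //; apply: val_inj.
  by rewrite e1 e2.
- apply: leq_trans card_new; apply: leq_trans (card_layer new le_h).
  by apply: subset_leq_card; apply/subsetP => y; rewrite !inE /act_up; case: ifP.
Qed.

Lemma upc_tsend y x h : tsend y (cnt_up h y, act_up h y) x =
  match x with
  | inl w => if (w == own y) && (ht y == L) then act_up h y else None
  | inr y' => if par y y' then act_up h y else None
  end.
Proof.
by rewrite /tsend /= /act_up; case: ifP => //= _; case: x => ?; case: ifP.
Qed.

Lemma upc_pay h y : (sum3 (act_up h y)).1.1 = if ht y == h then cntS new y else 0.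
Proof.
rewrite /act_up; case: (ht y == h) => //=; case: ifP => //=.
by move/negbT; rewrite -eqn0Ngt => /eqP ->.
Qed.

Lemma up_stepS Y h : h < L ->
    confS Y (frS 0) (4 * L + 1 + h) (cnt_up h) (act_up h) ->
  confS (step Y) (frS 0) (4 * L + 1 + h.+1) (cnt_up h.+1) (act_up h.+1) /\
  step_ok l N Y rlenS dd.
Proof.
move=> lt_h cf; have lt_pc : 4 * L < 4 * L + 1 + h by lia.
split; last exact: up_ok cf lt_pc (ltnW lt_h).
have sendN := fun w y => send_late w y cf lt_pc.
split=> [w|y]; first by rewrite addnS; apply: (real_pass _ cf); lia.
have [cr ct] := cf; rewrite /vstep /= (@trecv_kind _ 4) ?ct.
  have ibE x : [ffun x' => vm Y (x', inr y)] x =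
      if x is inr y' then if par y' y then act_up h y' else None else None.
    by case: x => [w|y']; rewrite ffunE ?sendN // /vmsg /= ct upc_tsend.
  have sumE : \sum_x (sum3 ([ffun x' => vm Y (x', inr y)] x)).1.1 =
              if ht y == h.+1 then cntS new y else 0.
    rewrite sum_vnode [X in X + _]big1 ?add0n; last by move=> w _; rewrite ibE.
    case: (eqVneq (ht y) h.+1) => [hy|nhy].
      rewrite -(@sum_children _ new) ?hy // [RHS]big_mkcond; apply: eq_bigr => y' _.
      rewrite ibE; case: ifP => // /parP [_ e _]; rewrite upc_pay.
      by have -> : ht y' == h by apply/eqP; lia.
    rewrite big1 // => y' _; rewrite ibE; case: ifP => // /parP [_ e _].
    rewrite upc_pay; case: eqP => // e'.
    by move: nhy; rewrite e e' eqxx.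
  (* Only positive counts are sent, so an inbox is nonempty exactly when its sum is positive. *)
  have exE : [exists x, isSome ([ffun x' => vm Y (x', inr y)] x)] =
      (ht y == h.+1) && (0 < cntS new y).
    have -> : (ht y == h.+1) && (0 < cntS new y) =
        (0 < \sum_x (sum3 ([ffun x' => vm Y (x', inr y)] x)).1.1).
      by rewrite sumE; case: ifP.
    rewrite lt0n sum_nat_eq0 negb_forall; apply: eq_existsb => x /=; rewrite ibE.
    case: x => // y'; case: ifP => // _; rewrite upc_pay /act_up.
    by case: (ht y' == h) => //=; rewrite lt0n; case: eqP.
  rewrite exE /act_up /cnt_up /= sumE [ht y <= h.+1]leq_eqVlt ltnS.
  case: (eqVneq (ht y) h.+1) => [hy|nhy] /=; last by [].
  rewrite hy ltnn addn0; case: ifP => // /negbT; rewrite -eqn0Ngt => /eqP ->.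
  by rewrite addn0.
case=> [w|y'] m; rewrite ffunE ?sendN // /vmsg /= ct upc_tsend; case: ifP => // _.
by rewrite /act_up; case: ifP => // _ [<-].
Qed.

Lemma final_stepS Y :
    confS Y (frS 0) (4 * L + 1 + L) (cnt_up L) (act_up L) ->
  conf nb (step Y) (fun w => #|rest w|) ph dd (fun=> set0)
    (fun w => start_acc (nb w) #|rest w| ph (dd w)) 0
    (cntS (fun v => nb v :\: rest v)) (@idle n) /\
  step_ok l N Y rlenS dd.
Proof.
move=> cf; have lt_pc : 4 * L < 4 * L + 1 + L by lia.
split; last exact: up_ok cf lt_pc (leqnn L).
have sendN := fun w y => send_late w y cf lt_pc.
have [cr ct] := cf; split=> [w|y].
  rewrite /vstep /= cr /rrecv.
  have -> : 4 * L + 1 + L < L = false by lia.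
  have -> : 4 * L + 1 + L < 2 * L = false by lia.
  have -> : 4 * L + 1 + L - 2 * L == 3 * L + 1 by lia.
  rewrite t_setup.
  have -> : \sum_x (sum3 ([ffun x' => vm Y (x', inl w)] x)).1.1 = #|new w|.
    rewrite sum_vnode [X in X + _]big1 ?add0n; last first.
      move=> w' _; rewrite ffunE /vmsg /= cr /=.
      have -> : 4 * L + 1 + L < L = false by lia.
      by have -> : 4 * L + 1 + L < 2 * L = false by lia.
    rewrite -(sum_level new w (leqnn L)) [RHS]big_mkcond; apply: eq_bigr => y _.
    rewrite ffunE /vmsg /= ct upc_tsend eq_sym; case: ifP => // /andP [_ h].
    by rewrite upc_pay h.
  have -> : remU w - #|new w| = #|rest w|.
    rewrite /remU /rest cardsD; congr (_ - #|pred_of_set _|); apply/esym/setIidPr.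
    by apply/subsetP => u; rewrite inE => /andP [].
  by [].
rewrite /vstep /= (@trecv_kind _ 4) ?ct.
  have -> : [exists x, isSome ([ffun x' => vm Y (x', inr y)] x)] = false.
    apply/existsP => -[[w|y']]; rewrite ffunE ?sendN // /vmsg /= ct upc_tsend.
    case: ifP => // /parP [_ e _]; rewrite /act_up.
    by have -> : ht y' == L = false by have := ht_le y; lia.
  rewrite /= /cnt_up ht_le /cntS /below; congr (_, _); rewrite -cardsUI.
  rewrite [X in _ + X](eq_card0 _) ?addn0; last first.
    by move=> u; rewrite !inE; case: (u \in U _); rewrite ?andbF //=.
  apply: eq_card => u; rewrite !inE; have := subsetP (U_sub (own y)) u.
  case: (u \in U (own y)) => [->|_] //=; last by rewrite ?andbF ?orbF.
  by rewrite negb_and negbK orbF andbT.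
case=> [w|y'] m; rewrite ffunE ?sendN // /vmsg /= ct upc_tsend; case: ifP => // _.
by rewrite /act_up; case: ifP => // _ [<-].
Qed.

(** The steps are [2 * L] for the search, one for insertion, [L] for carrying counts to the roots,
    and one from the roots to the owners. *)
Lemma setup_body Y :
    confS Y (fun w => [set j : 'I_n | (j == 0 :> nat) && poor t (remU w)])
      (2 * L) (cntS ins) (@idle n) ->
  conf nb (iter (3 * L + 2) step Y) (fun w => #|rest w|) ph dd (fun=> set0)
    (fun w => start_acc (nb w) #|rest w| ph (dd w)) 0
    (cntS (fun v => nb v :\: rest v)) (@idle n) /\
  (forall i, i < 3 * L + 2 -> step_ok l N (iter i step Y) rlenS dd).
Proof.
move=> [cr ct].
have cf0 : confS Y (frS L) (2 * L) (cntS ins) (@idle n).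
  by split=> // w; rewrite cr frS_top.
have [cf1 ok1] := query_phase cf0.
have [cf2 ok2] := insert_step cf1.
have up h : h <= L ->
  confS (iter (2 * L + 1 + h) step Y) (frS 0) (4 * L + 1 + h) (cnt_up h) (act_up h) /\
  (forall i, i < 2 * L + 1 + h -> step_ok l N (iter i step Y) rlenS dd).
  elim: h => [_|h IH lt_h].
    rewrite !addn0 !addn1; split=> // i; rewrite ltnS leq_eqVlt.
    by case/orP => [/eqP ->|/ok1].
  have [cf ok] := IH (ltnW lt_h); have [cf' ok'] := up_stepS lt_h cf.
  rewrite [2 * L + 1 + h.+1]addnS; split=> // i; rewrite ltnS leq_eqVlt.
  by case/orP => [/eqP ->|/ok].
have [cf3 ok3] := up L (leqnn L); have [cf4 ok4] := final_stepS cf3.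
have -> : 3 * L + 2 = (2 * L + 1 + L).+1 by lia.
split=> // i; rewrite ltnS leq_eqVlt; by case/orP => [/eqP ->|/ok3].
Qed.

End SetupPhase.

(** * BFS phases *)

Section Least.

Variable n : nat.

Lemma least_uniq (P : pred nat) m : m < n -> P m ->
  (forall j, j < m -> ~~ P j) -> least n P = m.
Proof.
move=> lt_m Pm min; have hasP : has P (iota 0 n).
  by apply/hasP; exists m; rewrite ?mem_iota.
have lt_f : least n P < n by rewrite /least -[X in _ < X](size_iota 0) -has_find.
case: (ltngtP (least n P) m) => // [lt|gt].
  have := nth_find 0 hasP; rewrite -/(least n P) nth_iota // add0n => h.
  by have := min _ lt; rewrite h.
by have := before_find 0 gt; rewrite nth_iota // add0n Pm.
Qed.

Lemma leastP (P : pred nat) k : k < n -> P k ->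
  [/\ least n P < n, P (least n P) & forall j, j < least n P -> ~~ P j].
Proof.
move=> lt_k Pk; have hasP : has P (iota 0 n).
  by apply/hasP; exists k; rewrite ?mem_iota.
have lt_f : least n P < n by rewrite /least -[X in _ < X](size_iota 0) -has_find.
split=> //.
  by have := nth_find 0 hasP; rewrite -/(least n P) nth_iota.
move=> j lt_j; have := before_find 0 lt_j.
by rewrite nth_iota ?(ltn_trans lt_j) // add0n => ->.
Qed.

End Least.

Section BfsPhase.

Variables (n : nat) (nb : 'I_n -> {set 'I_n}) (l N : nat).
Notation L := (logc n).
Notation X := (vnode n (tnode n)).
Notation vst := (forall x : X, vstate x).
Notation step := (@vstep n (tnode n) msg (@vstate n) (@vsend n) (@vrecv n)).
Notation vm := (vmsg (@vsend n)).
Hypothesis n_gt0 : 0 < n.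
Hypothesis l_ge : 4 * L <= l.
Implicit Types (y : tnode n) (A : 'I_n -> {set 'I_n}).

Variables (ph : nat) (dd : 'I_n -> option (nat * option 'I_n)).
Variable t : nat * nat * nat.
Hypothesis nb_sym : forall u v, (u \in nb v) = (v \in nb u).
Hypothesis nb_irr : forall v, v \notin nb v.
Hypothesis t_bfs : setup t = false.
Hypothesis t_small : small n (MSum t.1.1 t.1.2 t.2).

Definition front (v : 'I_n) : bool := active ph (dd v).
(** [dnS] and [upS] express the current layer as sets of directed edges, so that [cntS] tells which
    trie nodes take part: whole tries of layer nodes on the way down, leaves pointing into the layer
    on the way up. *)
Definition dnS (v : 'I_n) : {set 'I_n} := [set u in nb v | front v].
Definition upS (v : 'I_n) : {set 'I_n} := [set u in nb v | front u].

Hypothesis t_load : t.2 = \sum_w #|dnS w|.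

Definition rlenB : nat := (t.2 %/ (n * L)).+1.
Hypothesis R_le : rlenB <= N.

Definition act_dn (h : nat) (y : tnode n) : option msg :=
  if (ht y == h) && (0 < cntS dnS y) then Some MDown else None.

Definition lowest (A : {set 'I_n}) : nat := least n (fun k => [exists u in A, u == k :> nat]).

Definition act_um (h : nat) (y : tnode n) : option msg :=
  if (ht y == h) && (0 < cntS upS y) then Some (MUpM (lowest (below upS y))) else None.

Variable (rem : 'I_n -> nat) (fr : 'I_n -> {set 'I_n}).

Notation confB Y pc act := (conf nb Y rem ph dd fr (fun=> t) pc (cntS nb) act).

(** The two edge sets are transposes of each other; this lets one step length serve both
    directions. *)
Lemma sum_upS : \sum_w #|upS w| = \sum_w #|dnS w|.
Proof.
have E (P : 'I_n -> 'I_n -> bool) : \sum_w #|[set u in nb w | P w u]| =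
    \sum_w \sum_u ((u \in nb w) && P w u : nat).
  apply: eq_bigr => w _; rewrite -sum1_card big_mkcond; apply: eq_bigr => u _.
  by rewrite inE; case: (_ && _).
rewrite (E (fun _ u => front u)) (E (fun w _ => front w)) exchange_big /=.
by apply: eq_bigr => w _; apply: eq_bigr => u _; rewrite nb_sym.
Qed.

Lemma lowestP (A : {set 'I_n}) u0 : u0 \in A ->
  exists2 u, u \in A & lowest A = u /\ forall v, v \in A -> u <= v.
Proof.
move=> u0A; pose P k := [exists u in A, nat_of_ord u == k].
have [|lt Pl min] := leastP (P := P) (ltn_ord u0).
  by apply/exists_inP; exists u0.
case/exists_inP: (Pl) => u uA /eqP eu; exists u => //; split; first by rewrite eu.
move=> v vA; rewrite leqNgt; apply/negP; rewrite eu => /min /exists_inPn /(_ v vA).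
by rewrite eqxx.
Qed.

Lemma lowest_small (A : {set 'I_n}) : lowest A <= n.
Proof. by rewrite /lowest /least -[X in _ <= X](size_iota 0 n) find_size. Qed.

Lemma below_child A y u : u \in below A y -> 0 < ht y ->
  par (nd (own y) (ht y).-1 u) y /\ u \in below A (nd (own y) (ht y).-1 u).
Proof.
rewrite inE => /andP [uA /eqP hu]; case eh : (ht y) => [//|h] _ /=.
have le_h : h <= L by have := ht_le y; lia.
split; last by rewrite inE uA (ht_nd _ _ le_h) /= eqxx.
by apply/parP; split; rewrite ?ht_nd // -[LHS]hu eh divn_expS.
Qed.

Lemma below_par A y y' : par y' y -> below A y' \subset below A y.
Proof.
move=> /parP [e1 e2 e3]; apply/subsetP => u; rewrite !inE e1 e2 => /andP [-> /eqP h].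
by rewrite divn_expS h e3 /=.
Qed.

Lemma cntS_below A y : (0 < cntS A y) = [exists u, u \in below A y].
Proof. by apply/card_gt0P/existsP. Qed.

Lemma root_key A y : ht y = L -> 0 < cntS A y -> val (key y) = 0.
Proof.
move=> hL; rewrite cntS_gt0 hL => /exists_inP [u _ /eqP e].
by rewrite /= -e ord_div0.
Qed.

(** Active trie nodes lie on one level and each covers an element of [A], so there are at most
    [t.2 < n * L * rlenB] of them. A real node exchanges messages with its root only. *)
Lemma body_okB Y pc act :
    confB Y pc act -> 2 * L <= pc ->
    (forall y m, act y = Some m -> small n m) ->
    (forall w, #|[set y | isSome (vm Y (inl w, inr y))]| <= 1) ->
    (exists2 A, (forall y, isSome (act y) -> 0 < cntS A y) &
       exists2 h, h <= L & \sum_w #|A w| <= t.2 /\ forall y, isSome (act y) -> ht y = h) ->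
    (forall y c, act y <> Some (MReply c)) ->
  step_ok l N Y rlenB dd.
Proof.
move=> cf le_pc sact h1 [A hA [h le_h [sA hh]]] h3.
have Lgt0 := logc_gt0 n.
have le1 : 1 <= l * rlenB by rewrite muln_gt0 /rlenB andbT; lia.
apply: (conf_ok n_gt0 cf) => //.
- by move=> _; rewrite ltnNge le_pc /= /body_len t_bfs.
- by move=> w; apply: leq_trans (h1 w) le1.
- move=> w; right; split=> //; apply: leq_trans le1.
  apply/card_le1_eqP => y y'; rewrite !inE => /and3P [/eqP o1 /eqP e1 a1] /and3P [/eqP o2 /eqP e2 a2].
  apply: tnode_eqP; rewrite ?o1 ?o2 ?e1 ?e2 //; apply: val_inj.
  by rewrite (root_key e1 (hA _ a1)) (root_key e2 (hA _ a2)).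
- have lt : t.2 < n * L * rlenB by rewrite mulnC; apply: ltn_ceil; rewrite muln_gt0 n_gt0.
  have le2 : #|[set y | isSome (act y)]| <= t.2.
    apply: leq_trans sA; apply: leq_trans (card_layer A le_h).
    apply: subset_leq_card; apply/subsetP => y; rewrite !inE => ha.
    by rewrite (hh _ ha) eqxx hA.
  apply: (@leq_trans (4 * L * (n * rlenB))); last by rewrite leq_mul2r l_ge orbT.
  by lia.
Qed.

Lemma real_passB Y pc act w :
    confB Y pc act -> 2 * L <= pc -> pc - 2 * L != 2 * L + 2 ->
  step Y (inl w) = RState (nb w) (rem w) (fr w) t pc.+1 ph (dd w).
Proof.
move=> [cr ct] le_pc ne; rewrite /vstep /= cr /rrecv.
have -> : pc < L = false by lia.
have -> : pc < 2 * L = false by lia.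
by rewrite t_bfs (negbTE ne).
Qed.

Lemma send_lateB Y pc act w y :
  confB Y pc act -> 2 * L < pc -> vm Y (inl w, inr y) = None.
Proof.
move=> [cr ct] lt_pc; rewrite /vmsg /= cr /= t_bfs.
have -> : pc < 2 * L = false by lia.
by have -> : pc - 2 * L == 0 = false by lia.
Qed.

Lemma dn_stepok Y pc h : confB Y pc (act_dn h) -> 2 * L < pc -> h <= L ->
  step_ok l N Y rlenB dd.
Proof.
move=> cf lt_pc le_h; apply: (body_okB cf); first by lia.
- by move=> y m; rewrite /act_dn; case: ifP => // _ [<-].
- by move=> w; rewrite (eq_card0 _) // => y; rewrite !inE (send_lateB _ _ cf).
- exists dnS; first by move=> y; rewrite /act_dn; case: ifP => // /andP [].
  exists h => //; split; first by rewrite t_load.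
  by move=> y; rewrite /act_dn; case: ifP => // /andP [/eqP].
- by move=> y c; rewrite /act_dn; case: ifP.
Qed.

Lemma um_stepok Y pc h : confB Y pc (act_um h) -> 2 * L < pc -> h <= L ->
  step_ok l N Y rlenB dd.
Proof.
move=> cf lt_pc le_h; apply: (body_okB cf); first by lia.
- move=> y m; rewrite /act_um; case: ifP => // _ [<-]; rewrite /small /= andbT.
  by apply: leq_trans (lowest_small _) _; nia.
- by move=> w; rewrite (eq_card0 _) // => y; rewrite !inE (send_lateB _ _ cf).
- exists upS; first by move=> y; rewrite /act_um; case: ifP => // /andP [].
  exists h => //; split; first by rewrite t_load sum_upS.
  by move=> y; rewrite /act_um; case: ifP => // /andP [/eqP].
- by move=> y c; rewrite /act_um; case: ifP.
Qed.

Lemma cntS_dnS y : (0 < cntS dnS y) = front (own y) && (0 < cntS nb y).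
Proof.
rewrite !cntS_gt0; case fr_y : (front (own y)) => /=; last first.
  by apply/exists_inP => -[u]; rewrite inE fr_y andbF.
by apply: eq_existsb => u; rewrite inE fr_y andbT.
Qed.

Lemma root_step Y : confB Y (2 * L) (@idle n) ->
  confB (step Y) (2 * L + 1) (act_dn L) /\ step_ok l N Y rlenB dd.
Proof.
move=> cf; have [cr ct] := cf.
have sendE w y : vm Y (inl w, inr y) =
    if [&& front w, own y == w, ht y == L & key y == 0 :> nat] then Some MDown else None.
  by rewrite /vmsg /= cr /= t_bfs ltnn subnn.
split; last first.
  apply: (body_okB cf) => //.
  - move=> w; apply/card_le1_eqP => y y'; rewrite !inE !sendE.
    case: ifP => // /and4P [_ /eqP o1 /eqP h1 /eqP k1] _.
    case: ifP => // /and4P [_ /eqP o2 /eqP h2 /eqP k2] _.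
    by apply: tnode_eqP; rewrite ?o1 ?o2 ?h1 ?h2 //; apply: val_inj; rewrite /= k1 k2.
  - exists dnS => //; exists 0 => //; by rewrite t_load.
split=> [w|y].
  by rewrite addn1; apply: (real_passB _ cf) => //; lia.
rewrite /vstep /= (@trecv_kind _ 5) ?ct.
  rewrite exists_vnode; have -> : [exists y', isSome ([ffun x' => vm Y (x', inr y)] (inr y'))] = false.
    by apply/existsP => -[y']; rewrite ffunE /vmsg /= ct.
  rewrite orbF /act_dn cntS_dnS.
  have -> : [exists w, isSome ([ffun x' => vm Y (x', inr y)] (inl w))] =
            [&& front (own y), ht y == L & key y == 0 :> nat].
    apply/existsP/idP => [[w]|h].
      by rewrite ffunE sendE; case: ifP => // /and4P [h1 /eqP -> -> ->] _; rewrite h1.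
    by exists (own y); rewrite ffunE sendE eqxx /= h.
  case: (front (own y)) => //=; last by rewrite andbF.
  case: (eqVneq (ht y) L) => //= hL.
  case c0 : (0 < cntS nb y); last by rewrite if_same.
  by rewrite (root_key hL c0).
case=> [w|y'] m; rewrite ffunE; first by rewrite sendE; case: ifP => // _ [<-].
by rewrite /vmsg /= ct.
Qed.

Lemma dn_tsend y x h c : tsend y (c, act_dn h y) x =
  if x is inr y' then
    if isSome (act_dn h y) then
      if par y' y then Some MDown else if mir y y' then Some MCross else None
    else None
  else None.
Proof.
by rewrite /tsend /= /act_dn; case: ifP => //= _; case: x.
Qed.

Lemma dn_step Y h : h < L ->
    confB Y (2 * L + 1 + (L - h.+1)) (act_dn h.+1) ->
  confB (step Y) (2 * L + 1 + (L - h)) (act_dn h) /\ step_ok l N Y rlenB dd.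
Proof.
move=> lt_h cf; have lt_pc : 2 * L < 2 * L + 1 + (L - h.+1) by lia.
split; last exact: dn_stepok cf lt_pc lt_h.
have sendN := fun w y => send_lateB w y cf lt_pc.
have [cr ct] := cf; split=> [w|y].
  have -> : 2 * L + 1 + (L - h) = (2 * L + 1 + (L - h.+1)).+1 by lia.
  by apply: (real_passB _ cf); lia.
have ibE x : [ffun x' => vm Y (x', inr y)] x =
    if x is inr y' then
      if isSome (act_dn h.+1 y') && par y y' then Some MDown else None else None.
  case: x => [w|y']; rewrite ffunE ?sendN // /vmsg /= ct dn_tsend.
  rewrite /act_dn; case: (eqVneq (ht y') h.+1) => //= hy'; case: ifP => //= _.
  case: ifP => // _; case: ifP => // /mirP [e _ _ _ _].
  by move: hy'; rewrite e.
rewrite /vstep /= (@trecv_kind _ 5) ?ct.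
  have -> : [exists x, isSome ([ffun x' => vm Y (x', inr y)] x)] =
      [exists y', isSome (act_dn h.+1 y') && par y y'].
    apply/existsP/existsP => [[[w|y']]|[y' hy']].
    - by rewrite ibE.
    - by rewrite ibE; case: ifP => // hy' _; exists y'.
    - by exists (inr y'); rewrite ibE hy'.
  rewrite /= {2}/act_dn cntS_dnS.
  case: (boolP (0 < cntS nb y)) => c0; last first.
    by rewrite !andbF if_same.
  rewrite !andbT.
  have -> : [exists y', isSome (act_dn h.+1 y') && par y y'] =
            (ht y == h) && front (own y).
    apply/existsP/andP => [[y' /andP [ha /parP [e1 e2 e3]]]|[/eqP hy fy]].
      move: ha; rewrite /act_dn cntS_dnS; case: ifP => // /andP [/eqP e4 /andP [f _]] _.
      by rewrite -e1 f; split=> //; apply/eqP; lia.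
    have lt_k : (key y)./2 < n by have := ltn_ord (key y); lia.
    pose y' : tnode n := (own y, inord h.+1, Ordinal lt_k).
    have hy' : ht y' = h.+1 by rewrite /ht /= inordK.
    have py : par y y' by apply/parP; split; rewrite ?hy' ?hy.
    exists y'; rewrite py andbT /act_dn hy' eqxx cntS_dnS fy /=.
    rewrite ifT //; move: c0; rewrite !cntS_below => /existsP [u hu].
    by apply/existsP; exists u; apply: (subsetP (below_par nb py)).
  by case: ifP.
case=> [w|y'] m; rewrite ibE //; case: ifP => // _ [<-] //.
Qed.

(** The leaf [(v, 0, u)] is reached across exactly when [u] is in the layer; its key is then the
    only candidate below it. Irreflexivity keeps a leaf from being its own mirror. *)
Lemma cross_step Y : confB Y (2 * L + 1 + L) (act_dn 0) ->
  confB (step Y) (3 * L + 2) (act_um 0) /\ step_ok l N Y rlenB dd.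
Proof.
move=> cf; have lt_pc : 2 * L < 2 * L + 1 + L by lia.
split; last exact: dn_stepok cf lt_pc (leq0n _).
have sendN := fun w y => send_lateB w y cf lt_pc.
have [cr ct] := cf; split=> [w|y].
  have -> : 3 * L + 2 = (2 * L + 1 + L).+1 by lia.
  by apply: (real_passB _ cf); lia.
have ibE x : [ffun x' => vm Y (x', inr y)] x =
    if x is inr y' then
      if isSome (act_dn 0 y') && mir y' y then Some MCross else None else None.
  case: x => [w|y']; rewrite ffunE ?sendN // /vmsg /= ct dn_tsend.
  rewrite /act_dn; case: (eqVneq (ht y') 0) => //= hy'; case: ifP => //= _.
  case: ifP => // /parP [_ e _].
  by move: hy'; rewrite e.
rewrite /vstep /= (@trecv_kind _ 6) ?ct.
  have -> : [exists x, isSome ([ffun x' => vm Y (x', inr y)] x)] =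
      (ht y == 0) && (0 < cntS upS y).
    apply/existsP/andP => [[[w|y']]|[/eqP hy c0]].
    - by rewrite ibE.
    - rewrite ibE; case: ifP => // /andP [ha /mirP [e1 e2 e3 e4 e5]] _.
      split; first by rewrite e2.
      move: ha; rewrite /act_dn e1 /= (cntS_leaf _ e1) (cntS_leaf _ e2) !inE -e3 -e4.
      by rewrite nb_sym; case: (_ && _).
    - move: c0; rewrite (cntS_leaf _ hy) inE; case: andP => // -[kn fk] _.
      pose y' : tnode n := (key y, ord0, own y).
      exists (inr y'); rewrite ibE.
      have -> : mir y' y.
        apply/mirP; split=> // e; have := nb_irr (own y).
        by rewrite [own y' in LHS]/own /key /= in e; rewrite -{1}e kn.
      rewrite /act_dn (@cntS_leaf _ dnS y') // !inE.
      have -> : (key y' \in nb (own y')) && front (own y') by rewrite nb_sym kn fk.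
      by [].
  rewrite /= /act_um; case: (eqVneq (ht y) 0) => //= hy; case: ifP => // c0.
  congr (_, Some (MUpM _)).
  move: c0; rewrite cntS_below => /existsP [u hu].
  have [v vb [-> _]] := lowestP hu; move: vb; rewrite inE hy expn0 divn1.
  by case/andP => _ /eqP.
case=> [w|y'] m; rewrite ibE //; case: ifP => // _ [<-] //.
Qed.

Lemma um_tsend y x h c : tsend y (c, act_um h y) x =
  match x with
  | inl w => if (w == own y) && (ht y == L) then act_um h y else None
  | inr y' => if par y y' then act_um h y else None
  end.
Proof.
by rewrite /tsend /= /act_um; case: ifP => //= _; case: x => ?; case: ifP.
Qed.

Lemma um_step Y h : h < L ->
    confB Y (3 * L + 2 + h) (act_um h) ->
  confB (step Y) (3 * L + 2 + h.+1) (act_um h.+1) /\ step_ok l N Y rlenB dd.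
Proof.
move=> lt_h cf; have lt_pc : 2 * L < 3 * L + 2 + h by lia.
split; last exact: um_stepok cf lt_pc (ltnW lt_h).
have sendN := fun w y => send_lateB w y cf lt_pc.
have [cr ct] := cf; split=> [w|y].
  by rewrite addnS; apply: (real_passB _ cf); lia.
have ibE x : [ffun x' => vm Y (x', inr y)] x =
    if x is inr y' then if par y' y then act_um h y' else None else None.
  by case: x => [w|y']; rewrite ffunE ?sendN // /vmsg /= ct um_tsend.
rewrite /vstep /= (@trecv_kind _ 7) ?ct.
  have -> : [exists x, isSome ([ffun x' => vm Y (x', inr y)] x)] =
      (ht y == h.+1) && (0 < cntS upS y).
    apply/existsP/andP => [[[w|y']]|[/eqP hy c0]].
    - by rewrite ibE.
    - rewrite ibE; case: ifP => // py; rewrite /act_um; case: ifP => // /andP [/eqP e c0] _.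
      case/parP: (py) => _ e2 _; rewrite e2 e eqxx; split=> //.
      move: c0; rewrite !cntS_below => /existsP [u hu].
      by apply/existsP; exists u; apply: (subsetP (below_par upS py)).
    - move: c0; rewrite cntS_below => /existsP [u hu].
      have [|py ub] := below_child hu; first by rewrite hy.
      exists (inr (nd (own y) (ht y).-1 u)); rewrite ibE py /act_um ht_nd ?hy //=; last by lia.
      rewrite eqxx ifT // cntS_below; apply/existsP; exists u.
      by move: ub; rewrite hy.
  rewrite /= /act_um; case: (eqVneq (ht y) h.+1) => //= hy; case: ifP => // c0.
  congr (_, Some (MUpM _)).
  move: (c0); rewrite cntS_below => /existsP [u0 hu0].
  have [u hu [-> umin]] := lowestP hu0.
  (* The minimum is attained by the child above the minimal element, and no child reports less,
     since its elements also lie below [y]. *)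
  apply: least_uniq => [//||j lt_j].
    have [|py ub] := below_child hu; first by rewrite hy.
    set y' := nd _ _ _ in py ub.
    apply/existsP; exists (inr y'); rewrite ibE py /act_um.
    have -> : ht y' == h by rewrite /y' ht_nd hy //=; lia.
    have -> : 0 < cntS upS y' by rewrite cntS_below; apply/existsP; exists u.
    rewrite /=; have [v vb [-> vmin]] := lowestP ub.
    rewrite eqn_leq vmin //= umin //.
    exact: (subsetP (below_par upS py)).
  apply/existsPn => x; rewrite ibE; case: x => // y'; case: ifP => // py.
  rewrite /act_um; case: ifP => // /andP [_]; rewrite cntS_below => /existsP [v hv] /=.
  have [v' v'b [-> _]] := lowestP hv; apply/eqP => e.
  have := umin v' (subsetP (below_par upS py) _ v'b).
  by rewrite e leqNgt lt_j.
case=> [w|y'] m; rewrite ibE //; case: ifP => // _; rewrite /act_um.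
by case: ifP => // _ [<-].
Qed.

(** [insub] succeeds where it is used: the lowest element of a nonempty set is an identifier. *)
Definition dd_next (w : 'I_n) : option (nat * option 'I_n) :=
  if dd w is Some _ then dd w else
  if upS w == set0 then None else Some (ph.+1, insub (lowest (upS w))).

Lemma final_stepB Y : confB Y (3 * L + 2 + L) (act_um L) ->
  conf nb (step Y) rem ph.+1 dd_next (fun=> set0)
    (fun w => start_acc (nb w) (rem w) ph.+1 (dd_next w)) 0 (cntS nb) (@idle n) /\
  step_ok l N Y rlenB dd.
Proof.
move=> cf; have lt_pc : 2 * L < 3 * L + 2 + L by lia.
split; last exact: um_stepok cf lt_pc (leqnn L).
have sendN := fun w y => send_lateB w y cf lt_pc.
have [cr ct] := cf; split=> [w|y]; last first.
  have ibE x : [ffun x' => vm Y (x', inr y)] x = None.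
    case: x => [w|y']; rewrite ffunE ?sendN // /vmsg /= ct um_tsend.
    case: ifP => // /parP [_ e _]; rewrite /act_um.
    by have -> : ht y' == L = false by have := ht_le y; lia.
  rewrite /vstep /= (@trecv_kind _ 7) ?ct; last by move=> x m; rewrite ibE.
  by case: ifP => // /existsP [x]; rewrite ibE.
rewrite /vstep /= cr /rrecv.
have nL : 3 * L + 2 + L < L = false by lia.
have n2L : 3 * L + 2 + L < 2 * L = false by lia.
rewrite nL n2L t_bfs.
have -> : 3 * L + 2 + L - 2 * L == 2 * L + 2 by lia.
have ibE x : [ffun x' => vm Y (x', inl w)] x =
    if x is inr y then
      if [&& own y == w, ht y == L & 0 < cntS upS y] then Some (MUpM (lowest (upS w)))
      else None
    else None.
  case: x => [w'|y]; rewrite ffunE /vmsg /=; first by rewrite cr /= nL n2L.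
  rewrite ct um_tsend eq_sym /act_um; case: (eqVneq (own y) w) => //= oy.
  case: (eqVneq (ht y) L) => //= hy; case: ifP => // c0.
  congr (Some (MUpM (lowest _))); apply/setP => u; rewrite !inE hy oy ord_div0.
  by rewrite (root_key hy c0) eqxx andbT.
suff -> : (if dd w is Some _ then dd w else
   if [exists x, isSome ([ffun x' => vm Y (x', inl w)] x)]
   then Some (ph.+1, insub (least n
     (fun k => [exists x, is_upm k ([ffun x' => vm Y (x', inl w)] x)])))
   else None) = dd_next w by [].
rewrite /dd_next; case: (dd w) => //.
have lt0 : 0 < n by [].
pose r : tnode n := (w, ord_max, Ordinal lt0).
have hr : ht r = L by [].
have cr0 : (0 < cntS upS r) = (upS w != set0).
  rewrite cntS_gt0 hr; apply/exists_inP/set0Pn => [[u uU _]|[u uU]]; exists u => //.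
  by rewrite ord_div0.
have -> : [exists x, isSome ([ffun x' => vm Y (x', inl w)] x)] = (upS w != set0).
  apply/existsP/idP => [[[w'|y]]|ne]; rewrite ?ibE //.
    case: ifP => // /and3P [/eqP oy _ c0] _.
    move: c0; rewrite cntS_gt0 oy => /exists_inP [u uU _].
    by apply/set0Pn; exists u.
  by exists (inr r); rewrite ibE hr /own /= !eqxx cr0 ne.
case: (eqVneq (upS w) set0) => //= ne; congr (Some (_, insub _)).
have [u0 hu0] := set0Pn _ ne; have [u uU [eu umin]] := lowestP hu0.
apply: least_uniq => [|| j lt_j].
- by rewrite eu.
- by apply/existsP; exists (inr r); rewrite ibE hr /own /= !eqxx cr0 ne /= eqxx.
- apply/existsPn => x; rewrite ibE; case: x => // y; case: ifP => // _ /=.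
  by rewrite neq_ltn lt_j orbT.
Qed.

(** One step wakes the roots, [L] steps go down, one crosses, [L] go up, and one informs the
    owners. *)
Lemma bfs_body Y : confB Y (2 * L) (@idle n) ->
  conf nb (iter (2 * L + 3) step Y) rem ph.+1 dd_next (fun=> set0)
    (fun w => start_acc (nb w) (rem w) ph.+1 (dd_next w)) 0 (cntS nb) (@idle n) /\
  (forall i, i < 2 * L + 3 -> step_ok l N (iter i step Y) rlenB dd).
Proof.
move=> cf0; have [cf1 ok1] := root_step cf0.
have dn j : j <= L ->
  confB (iter (1 + j) step Y) (2 * L + 1 + j) (act_dn (L - j)) /\
  (forall i, i < 1 + j -> step_ok l N (iter i step Y) rlenB dd).
  elim: j => [_|j IH lt_j].
    rewrite !addn0 subn0; split=> // i; rewrite ltnS leqn0 => /eqP -> //.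
  have [cf ok] := IH (ltnW lt_j); have lt_h : L - j.+1 < L by lia.
  have := @dn_step (iter (1 + j) step Y) _ lt_h.
  have -> : (L - j.+1).+1 = L - j by lia.
  have -> : L - (L - j) = j by lia.
  have -> : L - (L - j.+1) = j.+1 by lia.
  case/(_ cf) => cf' ok'; split=> // i; rewrite addnS ltnS leq_eqVlt.
  by case/orP => [/eqP ->|/ok].
have [cf2 ok2] := dn L (leqnn L); rewrite subnn in cf2.
have [cf3 ok3] := cross_step cf2.
have um h : h <= L ->
  confB (iter (2 + L + h) step Y) (3 * L + 2 + h) (act_um h) /\
  (forall i, i < 2 + L + h -> step_ok l N (iter i step Y) rlenB dd).
  elim: h => [_|h IH lt_h].
    rewrite !addn0; split=> // i; rewrite ltnS leq_eqVlt.
    by case/orP => [/eqP ->|/ok2].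
  have [cf ok] := IH (ltnW lt_h); have [cf' ok'] := um_step lt_h cf.
  rewrite [2 + L + h.+1]addnS; split=> // i; rewrite ltnS leq_eqVlt.
  by case/orP => [/eqP ->|/ok].
have [cf4 ok4] := um L (leqnn L); have [cf5 ok5] := final_stepB cf4.
have -> : 2 * L + 3 = (2 + L + L).+1 by lia.
split=> // i; rewrite ltnS leq_eqVlt; by case/orP => [/eqP ->|/ok4].
Qed.

End BfsPhase.

(** * Forests and distances *)

Section Forests.

Variables (n : nat) (F : rel 'I_n).
Hypotheses (F_sym : symmetric F) (F_irr : irreflexive F) (F_forest : forest F).

Definition deg_in (W : {set 'I_n}) (v : 'I_n) : nat := #|[set u in W | F v u]|.

(** The path grows at its head. If all neighbours of the head already lie on the path, one of them
    besides the next vertex closes a cycle. *)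
Lemma long_path (W : {set 'I_n}) x0 : x0 \in W ->
    {in W, forall v, 1 < deg_in W v} ->
  forall k, exists x p, [/\ size p = k, uniq (x :: p), path F x p & all (mem W) (x :: p)].
Proof.
move=> x0W deg2; elim=> [|k [x [p [sp up pp ap]]]].
  by exists x0, [::]; rewrite /= x0W.
have xW : x \in W by case/andP: ap.
case: (pickP [pred u | [&& u \in W, F x u & u \notin x :: p]]) => [u /and3P [uW Fxu nu]|none].
  exists u, (x :: p); split; rewrite //= ?sp ?uW //.
  - by rewrite nu.
  - by rewrite F_sym Fxu.
exfalso; have nbp u : u \in W -> F x u -> u \in p.
  move=> uW Fxu; have := none u; rewrite /= uW Fxu /= => /negbFE.
  by rewrite inE => /orP [/eqP e|//]; move: Fxu; rewrite e F_irr.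
have := deg2 x xW; case: p sp up pp ap nbp none => [|x1 p'] sp up pp ap nbp _.
  rewrite /deg_in (eq_card0 _) // => u; rewrite !inE.
  by apply/negP => /andP [uW /(nbp _ uW)].
rewrite /deg_in (cardsD1 x1) => h.
have : 0 < #|[set u in W | F x u] :\ x1| by case: posnP h => // ->; rewrite addn0 ltnNge leq_b1.
case/card_gt0P => u; rewrite !inE => /and3P [ux1 uW Fxu].
have := nbp u uW Fxu; rewrite inE (negbTE ux1) /= => up'.
case/splitPr: up' sp up pp ap nbp => q1 q2 sp up pp ap nbp.
(* The cycle leaves [x] along the path up to [u] and returns by the edge between [u] and [x]; [u]
   differs from [x1], so its length is at least 3. *)
have := F_forest (cyc := x :: x1 :: rcons q1 u).
rewrite /= !size_rcons ltnS => /(_ _ isT)/negP; apply.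
  move: up; rewrite -cat_rcons -!cat_cons cat_uniq => /andP [+ _].
  by rewrite /= !inE !mem_rcons !inE.
move: pp; rewrite /= -cat_rcons => /andP [-> pp].
rewrite rcons_path; move: pp; rewrite cat_path => /andP [-> _] /=.
by rewrite last_rcons F_sym.
Qed.

(** Otherwise [long_path] gives a simple path with [n + 1] vertices. *)
Lemma forest_leaf (W : {set 'I_n}) : W != set0 -> exists2 v, v \in W & deg_in W v <= 1.
Proof.
case/set0Pn => x0 x0W.
case: (pickP [pred v | (v \in W) && (deg_in W v <= 1)]) => [v /andP [vW h]|none].
  by exists v.
have [|x [p [sp up _ _]]] := long_path x0W _ n.
  by move=> v vW; have := none v; rewrite /= vW /= leqNgt => /negbFE.
have := card_uniqP up; have := max_card (mem (x :: p)).
by rewrite card_ord /= sp => h1 h2; move: h1; rewrite h2 ltnn.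
Qed.

(** Peel off a leaf: degrees count each edge twice, so at most 2 is lost. *)
Lemma forest_edges (W : {set 'I_n}) : \sum_(v in W) deg_in W v <= 2 * #|W|.
Proof.
have [m] := ubnP #|W|; elim: m W => // m IH W lt_m.
case: (eqVneq W set0) => [->|ne]; first by rewrite big_set0.
have [v vW dv] := forest_leaf ne.
have cW := cardsD1 v W; rewrite vW in cW.
have := IH (W :\ v); rewrite cW in lt_m *; move=> /(_ _) IHv.
have {}IHv : \sum_(i in W :\ v) deg_in (W :\ v) i <= 2 * #|W :\ v| by apply: IHv; lia.
rewrite (big_setD1 v) //=.
have degE i : deg_in W i = F i v + deg_in (W :\ v) i.
  rewrite /deg_in (cardsD1 v) inE vW /=; congr (_ + _).
  by apply: eq_card => u; rewrite !inE andbA.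
rewrite (eq_bigr (fun i => F i v + deg_in (W :\ v) i)); last by move=> i _; apply: degE.
rewrite big_split /=.
have -> : \sum_(i in W :\ v) F i v = deg_in (W :\ v) v.
  rewrite /deg_in -sum1_card big_mkcond [RHS]big_mkcond; apply: eq_bigr => i _.
  by rewrite !inE F_sym; case: (i != v) => //=; case: (i \in W) => //=; case: F.
move: dv; rewrite degE F_irr add0n mulnDr addnA => dv.
by apply: leq_add IHv; rewrite muln1 -[2]/(1 + 1) leq_add.
Qed.

End Forests.

Lemma sub_forest n (F F' : rel 'I_n) : subrel F' F -> forest F -> forest F'.
Proof.
move=> sub ff cyc uc sc; apply: contra (ff cyc uc sc).
by case: cyc {uc sc} => //= x p; apply: sub_path.
Qed.

(** Missing edges form a subgraph whose edges stay within [W]; each colour class is a forest there.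
    Counting only [W] bounds the average over live nodes rather than over all nodes. *)
Lemma arboricity_bound n (G : rel 'I_n) a (U : 'I_n -> {set 'I_n}) :
    symmetric G -> irreflexive G -> forest_partition G a ->
    (forall v, U v \subset neighbors G v) -> (forall u v, (u \in U v) = (v \in U u)) ->
  \sum_v #|U v| <= 2 * a * #|[set v | 0 < #|U v|]|.
Proof.
move=> symG irrG [col [colG forG]] U_sub U_sym; set W := [set v | _].
have UG v u : u \in U v -> G v u by move/(subsetP (U_sub v)); rewrite inE.
pose H (i : nat) := [rel v u | (u \in U v) && (col v u == i)].
have fH i : forest (H i).
  by apply: sub_forest (forG i) => v u /= /andP [/UG -> ->].
have symH i : symmetric (H i).
  move=> v u /=; rewrite U_sym; case: (boolP (v \in U u)) => //= h.
  by have [-> _] := colG u v (UG _ _ h).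
have irrH i : irreflexive (H i).
  by move=> v /=; apply/negP => /andP [/UG]; rewrite irrG.
have UW v u : u \in U v -> (v \in W) /\ (u \in W).
  move=> h; rewrite !inE; split; apply/card_gt0P; first by exists u.
  by exists v; rewrite U_sym.
have -> : \sum_v #|U v| = \sum_(i < a) \sum_(v in W) deg_in (H i) W v.
  rewrite exchange_big /= (bigID (mem W)) /= [X in _ + X]big1 ?addn0; last first.
    by move=> v; rewrite inE -eqn0Ngt => /eqP.
  apply: eq_bigr => v vW; rewrite -sum1_card.
  have [a0|a_gt0] := posnP a.
    rewrite big_pred0; last first.
      by move=> u; apply/negP => /UG h; have [_] := colG v u h; rewrite a0.
    by rewrite big1 // => i _; case: i => i; rewrite a0.
  (* The default is never taken on edges of [U], whose colours are below [a]. *)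
  pose g u : 'I_a := insubd (Ordinal a_gt0) (col v u).
  rewrite (partition_big g xpredT) //=; apply: eq_bigr => i _.
  rewrite /deg_in -sum1_card; apply: eq_bigl => u; rewrite !inE /=.
  case uU : (u \in U v); rewrite /= ?andbF //.
  have [_ h] := UW _ _ uU; have [_ lt] := colG v u (UG _ _ uU).
  by rewrite inE in h; rewrite h /= -val_eqE /= /g val_insubd lt.
apply: (@leq_trans (\sum_(i < a) 2 * #|W|)).
  by apply: leq_sum => i _; apply: forest_edges.
by rewrite sum_nat_const card_ord; lia.
Qed.

(** * Distances from the source and BFS layers *)

Section Distances.

Variables (n : nat) (G : rel 'I_n) (s : 'I_n).
Hypothesis symG : symmetric G.

Lemma walk_rcons k (x u v : 'I_n) : walkb G k x u -> G u v -> walkb G k.+1 x v.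
Proof.
elim: k x => [|k IH] x.
  by move=> /eqP -> Guv; apply/existsP; exists v; rewrite Guv /=.
case/existsP => w /andP [Gxw h] Guv; apply/existsP; exists w.
by rewrite Gxw; apply: IH.
Qed.

Lemma walk_last k (x v : 'I_n) : walkb G k.+1 x v ->
  exists2 u, walkb G k x u & G u v.
Proof.
elim: k x => [|k IH] x.
  by case/existsP => w /andP [Gxw /eqP <-]; exists x => //=.
case/existsP => w /andP [Gxw /IH [u h Guv]]; exists u => //.
by apply/existsP; exists w; rewrite Gxw.
Qed.

Variable delta : 'I_n -> nat.
Hypothesis deltaP : forall v, is_distb G s v (delta v).

Lemma delta_walk v : walkb G (delta v) s v.
Proof. by case/andP: (deltaP v). Qed.

Lemma delta_min k v : walkb G k s v -> delta v <= k.
Proof.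
move=> h; rewrite leqNgt; apply/negP => lt.
by case/andP: (deltaP v) => _ /forallP /(_ (Ordinal lt)); rewrite h.
Qed.

Lemma is_dist_delta v d : is_distb G s v d -> d = delta v.
Proof.
case/andP => w /forallP min; apply/eqP; rewrite eqn_leq delta_min // andbT leqNgt.
by apply/negP => lt; have := min (Ordinal lt); rewrite delta_walk.
Qed.

Lemma delta_s : delta s = 0.
Proof. by apply/eqP; rewrite -leqn0 delta_min //=. Qed.

Lemma delta_eq0 v : (delta v == 0) = (v == s).
Proof.
apply/eqP/eqP => [e|->]; last exact: delta_s.
by have := delta_walk v; rewrite e /= => /eqP ->.
Qed.

Lemma delta_edge u v : G u v -> delta v <= (delta u).+1.
Proof. by move=> Guv; apply: delta_min; apply: walk_rcons Guv; apply: delta_walk. Qed.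

Lemma delta_pred v k : delta v = k.+1 -> exists2 u, G u v & delta u = k.
Proof.
move=> e; have := delta_walk v; rewrite e => /walk_last [u h Guv]; exists u => //.
by have := delta_min h; have := delta_edge Guv; rewrite e; lia.
Qed.

(** All values from 0 to [delta v] are attained, by walking back along predecessors, and they need
    distinct nodes. *)
Lemma delta_lt v : delta v < n.
Proof.
have ex k : k <= delta v -> exists u, delta u = k.
  move=> le; rewrite -(subKn le); elim: (delta v - k) => [|j [u e]].
    by exists v; rewrite subn0.
  case e' : (delta v - j) => [|i]; first by exists u; rewrite e; lia.
  rewrite e' in e; have [u' _ eu'] := delta_pred e; exists u'; lia.
have h (k : 'I_(delta v).+1) : exists u, delta u = k by apply: ex; rewrite -ltnS.
have [g gP] := fin_all_exists h.
have gi : injective g by move=> i j e; apply: val_inj; rewrite /= -!gP e.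
by have := leq_card g gi; rewrite !card_ord.
Qed.

Definition preds (v : 'I_n) : {set 'I_n} :=
  [set u in neighbors G v | (delta u).+1 == delta v].

Definition parent (v : 'I_n) : option 'I_n :=
  if v == s then None else insub (lowest (preds v)).

Definition bfs_dist (i : nat) (v : 'I_n) : option (nat * option 'I_n) :=
  if delta v <= i then Some (delta v, parent v) else None.

Lemma bfs_dist0 v : bfs_dist 0 v = if v == s then Some (0, None) else None.
Proof.
rewrite /bfs_dist leqn0 delta_eq0 /parent; case: eqP => [->|] //.
by rewrite delta_s.
Qed.

Lemma bfs_front i v : front i (bfs_dist i) v = (delta v == i).
Proof.
rewrite /front /bfs_dist; case: leqP => // lt.
by rewrite /= gtn_eqF.
Qed.

Lemma bfs_upS i v : i < delta v ->
  upS (neighbors G) i (bfs_dist i) v = if delta v == i.+1 then preds v else set0.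
Proof.
move=> lt; apply/setP => u; rewrite inE bfs_front.
case: (eqVneq (delta v) i.+1) => [e|ne]; first by rewrite [RHS]inE e eqSS.
rewrite in_set0 inE; apply/negP => /andP [Gvu /eqP e].
have : delta v <= (delta u).+1 by apply: delta_edge; rewrite symG.
by rewrite e; lia.
Qed.

Lemma preds_neq0 v : v != s -> preds v != set0.
Proof.
rewrite -delta_eq0; case e : (delta v) => [//|k] _.
have [u Guv eu] := delta_pred e; apply/set0Pn; exists u.
by rewrite !inE symG Guv e eu /=.
Qed.

Lemma bfs_dist_next i v : dd_next (neighbors G) i (bfs_dist i) v = bfs_dist i.+1 v.
Proof.
rewrite /dd_next {1 2}/bfs_dist; case: leqP => [le|lt].
  by rewrite /bfs_dist leqW.
rewrite bfs_upS // /bfs_dist; case: (eqVneq (delta v) i.+1) => [e|ne].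
  have vs : v != s by rewrite -delta_eq0 e.
  by rewrite (negbTE (preds_neq0 vs)) e leqnn /parent (negbTE vs).
rewrite eqxx; have -> : delta v <= i.+1 = false by lia.
by [].
Qed.

Lemma bfs_dist_correct v : correct_output G s v (Some (delta v, parent v)).
Proof.
rewrite /= deltaP /parent; case: (eqVneq v s) => //= vs.
have [u0 hu0] := set0Pn _ (preds_neq0 vs).
have [u uU [-> umin]] := lowestP hu0.
rewrite valK; move: uU; rewrite !inE => /andP [Gvu /eqP e].
have pE : (delta v).-1 = delta u by rewrite -e.
rewrite symG Gvu pE deltaP /=; apply/forallP => w; apply/implyP => /andP [Gwv /is_dist_delta ew].
by apply: umin; rewrite !inE symG Gwv -ew e eqxx.
Qed.

End Distances.

(** * Composition of the phases *)

(* Bounds all step lengths; seeds are drawn modulo [(maxlen n)`!]. *)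
Definition maxlen (n : nat) : nat := n ^ 2 + 5.

Section Chain.

Variables (n : nat) (G : rel 'I_n) (s : 'I_n) (a : nat) (delta : 'I_n -> nat).
Notation L := (logc n).
Notation X := (vnode n (tnode n)).
Notation vst := (forall x : X, vstate x).
Notation step := (@vstep n (tnode n) msg (@vstate n) (@vsend n) (@vrecv n)).
Notation nb := (neighbors G).
Notation dist := (bfs_dist G s delta).
Hypotheses (symG : symmetric G) (irrG : irreflexive G).
Hypothesis arbG : forest_partition G a.
Hypothesis deltaP : forall v, is_distb G s v (delta v).

Lemma size_gt0 : 0 < n.
Proof. exact: leq_ltn_trans (leq0n s) (ltn_ord s). Qed.

Lemma nb_sym u v : (u \in nb v) = (v \in nb u).
Proof. by rewrite !inE symG. Qed.

Lemma nb_irr v : v \notin nb v.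
Proof. by rewrite inE irrG. Qed.

(** Read at [s]; by [ok_sync] any other node would give the same length. *)
Definition step_len (Y : vst) : nat := (rlen (Y (inl s))).+1.

Definition fine_step (Y : vst) : Prop :=
  exists ph, step_ok (4 * L) (maxlen n) Y (step_len Y) (dist ph).

Definition run (Y : vst) (k T : nat) : Prop :=
  (forall i, i < k -> fine_step (iter i step Y)) /\
  \sum_(i < k) step_len (iter i step Y) = T.

Lemma run_cat Y k T k' T' :
  run Y k T -> run (iter k step Y) k' T' -> run Y (k' + k) (T + T').
Proof.
move=> [ok1 <-] [ok2 <-]; split.
  move=> i lt; case: (ltnP i k) => [|le]; first exact: ok1.
  by rewrite -(subnK le) iterD; apply: ok2; rewrite ltn_subLR // addnC.
rewrite addnC -(big_mkord xpredT (fun i => step_len (iter i step Y))).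
rewrite (big_cat_nat (leq0n k) (leq_addr k' k)) /= big_mkord; congr (_ + _).
rewrite -{1}[k]add0n big_addn addKn big_mkord; apply: eq_bigr => i _.
by rewrite iterD.
Qed.

Lemma run_const Y k R ph :
  (forall i, i < k -> step_ok (4 * L) (maxlen n) (iter i step Y) R (dist ph)) ->
  run Y k (k * R).
Proof.
move=> ok; have lenE i : i < k -> step_len (iter i step Y) = R.
  by move=> lt; rewrite /step_len (ok_sync (ok i lt)).
split=> [i lt|]; first by exists ph; rewrite lenE //; apply: ok.
rewrite (eq_bigr (fun=> R)); first by rewrite sum_nat_const card_ord.
by move=> i _; apply: lenE.
Qed.

Record sub_graph (U : 'I_n -> {set 'I_n}) : Prop := SubGraph {
  sg_sub : forall v, U v \subset nb v;
  sg_sym : forall u v, (u \in U v) = (v \in U u)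
}.

Definition phase_start (Y : vst) (U : 'I_n -> {set 'I_n}) (ph : nat) : Prop :=
  conf nb Y (fun w => #|U w|) ph (dist ph) (fun=> set0)
    (fun w => start_acc (nb w) #|U w| ph (dist ph w)) 0
    (cntS (fun v => nb v :\: U v)) (@idle n).

Definition live (U : 'I_n -> {set 'I_n}) : nat := #|[set v | 0 < #|U v|]|.

Definition sums (U : 'I_n -> {set 'I_n}) (ph : nat) : nat * nat * nat :=
  total (fun w => nat_of_bool (0 < #|U w|)) (fun w => #|U w|)
        (fun w => if active ph (dist ph w) then #|nb w| else 0).

Lemma sums_live U ph : (sums U ph).1.1 = live U.
Proof.
rewrite /live -sum1_card [RHS]big_mkcond; apply: eq_bigr => w _; rewrite inE.
by case: (0 < #|U w|).
Qed.

Lemma sum_set_leq (A : 'I_n -> {set 'I_n}) : \sum_w #|A w| <= n * n.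
Proof.
rewrite -[X in X * _]card_ord -sum_nat_const; apply: leq_sum => w _.
by rewrite -[X in _ <= X]card_ord max_card.
Qed.

Lemma sums_dnS U ph : (sums U ph).2 = \sum_w #|dnS nb ph (dist ph) w|.
Proof.
apply: eq_bigr => w _; rewrite /dnS /front; case: active.
  by apply: eq_card => u; rewrite !inE andbT.
by rewrite (eq_card0 _) // => u; rewrite !inE andbF.
Qed.

Lemma sums_small U ph : small n (MSum (sums U ph).1.1 (sums U ph).1.2 (sums U ph).2).
Proof.
have n_gt0 := size_gt0.
have h1 : (sums U ph).1.1 <= n * n.
  rewrite sums_live; apply: (@leq_trans n); last by nia.
  by rewrite -[X in _ <= X]card_ord max_card.
have h2 : (sums U ph).1.2 <= n * n by apply: sum_set_leq.
have h3 : (sums U ph).2 <= n * n by rewrite sums_dnS sum_set_leq.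
by apply/and3P.
Qed.

Lemma reduce_phase Y U ph : phase_start Y U ph ->
  conf nb (iter (2 * L) step Y) (fun w => #|U w|) ph (dist ph)
    (fun w => [set j : 'I_n | (j == 0 :> nat) && poor (sums U ph) #|U w|])
    (fun=> sums U ph) (2 * L) (cntS (fun v => nb v :\: U v)) (@idle n) /\
  run Y (2 * L) (2 * L).
Proof.
move=> cf; have /and3P [s1 s2 s3] := sums_small U ph.
have m0 : 0 < maxlen n by rewrite /maxlen addn_gt0 orbT.
have [cf' ok] := all_reduce size_gt0 (leqnn (4 * L)) s1 s2 s3 m0 cf.
by split=> //; have := run_const ok; rewrite muln1.
Qed.

Lemma live_bound U : sub_graph U -> \sum_v #|U v| <= 2 * a * live U.
Proof. by case=> h1 h2; apply: arboricity_bound arbG h1 h2. Qed.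

(** The bound in [a] serves the running time, the bound in [n] serves [maxlen]. *)
Lemma theta_bound U ph : sub_graph U -> 0 < live U ->
  theta (sums U ph) <= 4 * a + 2 /\ theta (sums U ph) <= 2 * n + 2.
Proof.
move=> sg lv; rewrite /theta sums_live.
have h1 : (sums U ph).1.2 %/ live U <= 2 * a.
  by rewrite -(mulnK (2 * a) lv) leq_div2r // live_bound.
have h2 : (sums U ph).1.2 %/ live U <= n.
  rewrite -(mulnK n lv) leq_div2r //= (bigID (fun v => 0 < #|U v|)) /=.
  rewrite [X in _ + X]big1 ?addn0; last by move=> v; rewrite -eqn0Ngt => /eqP.
  rewrite mulnC /live -sum1_card big_distrl /= [X in _ <= X](eq_bigl (fun v => 0 < #|U v|)).
    by apply: leq_sum => v _; rewrite mul1n -[X in _ <= X]card_ord max_card.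
  by move=> v; rewrite inE.
by split; lia.
Qed.

(** All missing edges of a poor node are inserted, so a node stays live only if it exceeds [theta];
    by Markov's inequality these are fewer than half. *)
Lemma live_rest U ph : sub_graph U -> 0 < live U ->
  2 * live (rest U (sums U ph)) < live U.
Proof.
move=> sg lv; set t := sums U ph.
pose B := [set v | theta t < #|U v|].
have sB : live (rest U t) <= #|B|.
  apply: subset_leq_card; apply/subsetP => v; rewrite !inE => /card_gt0P [u].
  rewrite !inE => /andP [+ uU]; rewrite uU /= negb_or => /andP [+ _].
  rewrite /isP /poor negb_and => /orP [|]; last by rewrite -ltnNge.
  by rewrite -eqn0Ngt cards_eq0 => /eqP e; rewrite e inE in uU.
have cB : #|B| * (theta t).+1 <= t.1.2.
  rewrite -sum_nat_const; apply: (@leq_trans (\sum_(v in B) #|U v|)).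
    by apply: leq_sum => v; rewrite inE.
  by rewrite [X in _ <= X](bigID (mem B)) /= leq_addr.
have : t.1.2 < (t.1.2 %/ live U).+1 * live U by apply: ltn_ceil.
by move: cB; rewrite /theta sums_live -/t; nia.
Qed.

Lemma rest_sub_graph U t : sub_graph U -> sub_graph (rest U t).
Proof.
case=> h1 h2; split=> [v|u v].
  by apply: subset_trans (h1 v); apply: subsetDl.
by rewrite !inE (h2 u v) orbC.
Qed.

Lemma setup_phase Y U ph : sub_graph U -> 0 < live U -> phase_start Y U ph ->
  exists2 T, T <= 20 * (a + L) & run Y (5 * L + 2) T /\
    phase_start (iter (5 * L + 2) step Y) (rest U (sums U ph)) ph.
Proof.
move=> sg lv cf; have [cf1 r1] := reduce_phase cf.
have [th1 th2] := theta_bound ph sg lv; case: (sg) => U_sub U_sym.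
have R_le : rlenS n (sums U ph) <= maxlen n.
  rewrite /rlenS /maxlen; have := leq_div (theta (sums U ph)) L; nia.
have st : setup (sums U ph) by rewrite /setup sums_live.
have [cf2 ok2] := setup_body size_gt0 (leqnn (4 * L)) U_sub U_sym st (sums_small U ph) R_le cf1.
have r2 := run_const ok2; have := run_cat r1 r2.
have -> : 3 * L + 2 + 2 * L = 5 * L + 2 by lia.
move=> r; exists (2 * L + (3 * L + 2) * rlenS n (sums U ph)).
  have Lgt0 := logc_gt0 n.
  have : theta (sums U ph) %/ L * L <= theta (sums U ph) by apply: leq_trunc_div.
  by rewrite /rlenS; nia.
split=> //; have -> : 5 * L + 2 = 3 * L + 2 + 2 * L by lia.
by rewrite iterD.
Qed.

(** Each phase halves the number of live nodes, so [j] phases suffice below [2 ^ j]. *)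
Lemma setup_chain j Y U : sub_graph U -> live U < 2 ^ j -> phase_start Y U 0 ->
  exists k T V, [/\ k <= j * (5 * L + 2), T <= j * (20 * (a + L)), run Y k T,
     forall v, V v = set0 & phase_start (iter k step Y) V 0].
Proof.
elim: j Y U => [|j IH] Y U sg lt cf; case: (posnP (live U)) => [lv0|lv_gt0].
- exists 0, 0, U; split=> //; last first.
    move=> v; apply/eqP; rewrite -cards_eq0 -leqn0 leqNgt; apply/negP => h.
    by have := cards0_eq lv0 => /setP /(_ v); rewrite !inE h.
  by split=> //; rewrite big_ord0.
- by move: lt; rewrite ltnS leqn0 => /eqP h; rewrite h in lv_gt0.
- exists 0, 0, U; split=> //; last first.
    move=> v; apply/eqP; rewrite -cards_eq0 -leqn0 leqNgt; apply/negP => h.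
    by have := cards0_eq lv0 => /setP /(_ v); rewrite !inE h.
  by split=> //; rewrite big_ord0.
- have [T1 leT1 [r1 cf1]] := setup_phase sg lv_gt0 cf.
  have lr := live_rest 0 sg lv_gt0.
  have lt' : live (rest U (sums U 0)) < 2 ^ j by move: lt; rewrite expnS; lia.
  have [k [T [V [lek leT r V0 cf2]]]] := IH _ _ (rest_sub_graph _ sg) lt' cf1.
  exists (k + (5 * L + 2)), (T1 + T), V; split=> //.
  + by rewrite mulSn addnC leq_add2l.
  + by rewrite mulSn leq_add.
  + exact: run_cat r1 r.
  + by rewrite iterD.
Qed.

Definition ring_deg (ph : nat) : nat := \sum_(w | delta w == ph) #|nb w|.

Lemma sums_ring U ph : (sums U ph).2 = ring_deg ph.
Proof.
rewrite /ring_deg [RHS]big_mkcond; apply: eq_bigr => w _.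
by rewrite -[active ph (dist ph w)]/(front ph (dist ph) w) bfs_front.
Qed.

(** The time is multiplied by [n] so that the degrees of all layers can be added up before
    dividing. *)
Lemma bfs_phase Y U ph : (forall v, U v = set0) -> phase_start Y U ph ->
  exists2 T, T * n <= 7 * L * n + 5 * ring_deg ph & run Y (4 * L + 3) T /\
    phase_start (iter (4 * L + 3) step Y) U ph.+1.
Proof.
move=> U0 cf; have [[cr1 ct1] r1] := reduce_phase cf.
have n_gt0 := size_gt0; have Lgt0 := logc_gt0 n.
have cE y : cntS (fun v => nb v :\: U v) y = cntS nb y.
  by apply: eq_card => u; rewrite !inE U0 inE.
have st : setup (sums U ph) = false.
  rewrite /setup sums_live /live; apply/negbTE; rewrite -eqn0Ngt; apply/eqP.
  by apply: eq_card0 => v; rewrite !inE U0 cards0.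
have R_le : rlenB n (sums U ph) <= maxlen n.
  rewrite /rlenB /maxlen; have /and3P [_ _ /= h] := sums_small U ph.
  have := leq_div (sums U ph).2 (n * L); rewrite /= in h *; nia.
have cf1' : conf nb (iter (2 * L) step Y) (fun w => #|U w|) ph (dist ph)
    (fun w => [set j : 'I_n | (j == 0 :> nat) && poor (sums U ph) #|U w|])
    (fun=> sums U ph) (2 * L) (cntS nb) (@idle n).
  by split=> // y; rewrite ct1 cE.
have [[cr2 ct2] ok2] := bfs_body n_gt0 (leqnn (4 * L)) nb_sym nb_irr st (sums_small U ph)
   (sums_dnS U ph) R_le cf1'.
have r2 := run_const ok2; have := run_cat r1 r2.
have e : 2 * L + 3 + 2 * L = 4 * L + 3 by lia.
rewrite e => r; exists (2 * L + (2 * L + 3) * rlenB n (sums U ph)).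
  have := leq_trunc_div (sums U ph).2 (n * L).
  rewrite /rlenB sums_ring; set q := _ %/ _ => h.
  have le5 : 2 * L + 3 <= 5 * L by lia.
  apply: (@leq_trans ((2 * L + 5 * L * q.+1) * n)).
    by rewrite leq_mul2r leq_add2l leq_mul2r le5 !orbT.
  have -> : (2 * L + 5 * L * q.+1) * n = 7 * L * n + 5 * (q * (n * L)) by nia.
  by rewrite leq_add2l leq_mul2l h.
split=> //; rewrite -e iterD; split=> [w|y].
  by rewrite cr2 (bfs_dist_next symG deltaP).
by rewrite ct2 cE.
Qed.

Lemma bfs_chain E Y U : (forall v, U v = set0) -> phase_start Y U 0 ->
  exists k T, [/\ k <= E * (4 * L + 3), 
     T * n <= E * (7 * L * n) + 5 * \sum_(ph < E) ring_deg ph, run Y k T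
     & phase_start (iter k step Y) U E].
Proof.
move=> U0 cf; elim: E => [|E [k [T [lek leT r cf1]]]].
  by exists 0, 0; split=> //; split=> //; rewrite big_ord0.
have [T1 leT1 [r1 cf2]] := bfs_phase U0 cf1.
exists (4 * L + 3 + k), (T + T1); split.
- by rewrite mulSn leq_add2l.
- rewrite big_ord_recr /= mulnDl mulSn mulnDr addnC [5 * \sum_(_ < _) _ + _]addnC.
  by rewrite addnACA leq_add.
- exact: run_cat r r1.
- by rewrite iterD.
Qed.

(** Layers are disjoint, so this is part of the degree sum of [G], to which [arboricity_bound]
    applies with all edges. *)
Lemma sum_ring_deg E : \sum_(ph < E) ring_deg ph <= 2 * a * n.
Proof.
apply: (@leq_trans (\sum_w #|nb w|)).
  rewrite /ring_deg (exchange_big_dep xpredT) //=; apply: leq_sum => w _.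
  rewrite sum_nat_const -[X in _ <= X]mul1n leq_mul2r; apply/orP; right.
  apply/card_le1_eqP => i j; rewrite !unfold_in => /eqP ei /eqP ej.
  by apply: val_inj; rewrite /= -ei -ej.
apply: leq_trans (arboricity_bound symG irrG arbG (fun v => subxx (nb v)) nb_sym) _.
by rewrite leq_mul2l -[X in _ || (_ <= X)]card_ord max_card orbT.
Qed.

Definition init_state (x : X) : vstate x :=
  match x return vstate x with
  | inl w => vinit (inl w) (w == s) (nb w)
  | inr y => vinit (inr y) false set0
  end.

Lemma init_phase : phase_start init_state (fun v => nb v) 0.
Proof.
split=> [w|y].
  by rewrite (bfs_dist0 deltaP).
rewrite /=; congr (_, _); apply/esym/eq_card0 => u; rewrite !inE.
by rewrite andNb.
Qed.

(** [E] stands for the eccentricity of [s]. The condition [E <= n] keeps the number of steps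
    polynomial in [n], as the union bound over steps requires. *)
Lemma whole_run E : (forall v, delta v <= E) -> E <= n ->
  exists k T, [/\ k <= 21 * n ^ 2, T <= 30 * (a + E + L) * L, run init_state k T
    & forall w, r_dist (iter k step init_state (inl w)) = Some (delta w, parent G s delta w)].
Proof.
move=> deltaE leEn; have n_gt0 := size_gt0; have Lgt0 := logc_gt0 n.
have leLn : L <= n.
  by rewrite /logc; have := trunc_logP (ltnSn 1) n_gt0; have := ltn_expl (trunc_log 2 n) (ltnSn 1); lia.
have sg : sub_graph (fun v => nb v) by split=> // u v; apply: nb_sym.
have lv : live (fun v => nb v) < 2 ^ L.
  apply: leq_ltn_trans (ltn_exp_logc n); by rewrite -[X in _ <= X]card_ord max_card.
have [k1 [T1 [V [lek1 leT1 r1 V0 cf1]]]] := setup_chain sg lv init_phase.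
have [k2 [T2 [lek2 leT2 r2 cf2]]] := bfs_chain E V0 cf1.
exists (k2 + k1), (T1 + T2); split.
- nia.
- have leT2' : T2 * n <= (7 * L * E + 10 * a) * n.
    apply: leq_trans leT2 _; have := sum_ring_deg E; nia.
  rewrite leq_pmul2r // in leT2'; nia.
- exact: run_cat r1 r2.
- by move=> w; case: cf2 => cr _; rewrite iterD cr /= /bfs_dist deltaE.
Qed.

End Chain.

(** * The theorem *)

Definition bfs_alg (Q : nat) : NCCAlg := {|
  St := fun n => nstate (maxlen n) msg (@vstate n);
  Rnd := fun n => seed n (maxlen n) (tnode n);
  init := fun n => ninit msg (@vinit n);
  send := fun n => nsend (@enc n) Q (@vsend n) (@vlen n);
  recv := fun n => nrecv (@dec n) Q (@vrecv n) (@vlen n);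
  output := fun n st => r_dist (nys st (inl (nid st)))
|}.

Lemma good_step_mono n N (V : finType) c1 c1' c2 R M (f : seed n N V) :
  c1 <= c1' -> good_step c1 c2 R M f -> good_step c1' c2 R M f.
Proof.
move=> le /forallP g; apply/forallP => rho; apply/forallP => w; apply/forallP => w'.
have /forallP /(_ w) /forallP /(_ w') /and3P [h1 h2 h3] := g rho.
by rewrite (leq_trans h1 le) (leq_trans h2 le) h3.
Qed.

(** Each end of a packet takes at most [4 * L] bits and the content [9 * L]; one more [L] pays for
    the option. *)
Lemma width_packet n Q :
  width (packet n (tnode n) (code n)) Q <= (18 * Q + 1) * logc n.
Proof.
set L := logc n; have Lgt0 : 0 < L by [].
have nL : n < 2 ^ L := ltn_exp_logc n.
have LL : L.+1 <= 2 ^ L by apply: ltn_expl.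
have e3 : 8 <= 2 ^ (3 * L) by rewrite -[8]/(2 ^ 3) leq_exp2l //; lia.
have cX : #|{: vnode n (tnode n)}| <= 2 ^ (4 * L).
  rewrite card_sum !card_prod !card_ord.
  have h1 : n * L.+1 * n <= 2 ^ (3 * L).
    have -> : 2 ^ (3 * L) = 2 ^ L * 2 ^ L * 2 ^ L by rewrite -!expnD; congr (2 ^ _); lia.
    by rewrite !leq_mul // ltnW.
  have h2 : n <= 2 ^ (3 * L) by apply: leq_trans (ltnW nL) _; rewrite leq_exp2l //; lia.
  apply: (@leq_trans (2 * 2 ^ (3 * L))); first by lia.
  by rewrite -expnS leq_exp2l //; lia.
have cC : #|{: code n}| <= 2 ^ (9 * L).
  rewrite !card_prod !card_ord.
  have h1 : (n * n).+1 <= 2 ^ (2 * L).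
    by rewrite mulnC expnM -mulnn; nia.
  have -> : 2 ^ (9 * L) = 2 ^ (3 * L) * (2 ^ (2 * L) * 2 ^ (2 * L) * 2 ^ (2 * L)).
    by rewrite -!expnD; congr (2 ^ _); lia.
  by rewrite !leq_mul.
have cP : #|{: option (packet n (tnode n) (code n))}| <= 2 ^ (18 * L).
  rewrite card_option !card_prod.
  apply: (@leq_trans (2 * (2 ^ (4 * L) * 2 ^ (4 * L) * 2 ^ (9 * L)))).
    have h : #|{: vnode n (tnode n)}| * #|{: vnode n (tnode n)}| * #|{: code n}|
        <= 2 ^ (4 * L) * 2 ^ (4 * L) * 2 ^ (9 * L) by rewrite !leq_mul.
    have h' : 0 < 2 ^ (4 * L) * 2 ^ (4 * L) * 2 ^ (9 * L).
      by rewrite !muln_gt0 !expn_gt0.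
    by move: h; rewrite card_sum !card_prod; lia.
  by rewrite -!expnD -expnS leq_exp2l //; lia.
rewrite /width card_tuple.
have : trunc_log 2 (#|{: option (packet n (tnode n) (code n))}| ^ Q) <= 18 * L * Q.
  rewrite -[X in _ <= X](trunc_expnK _ (ltnSn 1)); apply: leq_trunc_log.
  by rewrite expnM; case: (Q) => // q; rewrite leq_exp2r.
by move/leq_ltn_trans; apply; nia.
Qed.

Lemma logc_sq n : 0 < n -> logc n ^ 2 <= 4 * n.
Proof.
move=> n_gt0; have := trunc_logP (ltnSn 1) n_gt0; rewrite /logc.
move: (trunc_log 2 n) => t le; suff : t.+1 ^ 2 <= 4 * 2 ^ t by lia.
case: t {le} => [//|[//|t]]; elim: t => [//|t IH].
rewrite expnS mulnCA; apply: leq_trans (leq_mul (leqnn 2) IH); nia.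
Qed.

(** * Irrevocable outputs *)

Section Decision.

Variables (A : NCCAlg) (n : nat) (G : rel 'I_n) (s : 'I_n) (cap : nat).
Variables (adv : Adv A n) (r : Rnd A n).

Lemma decided_first v T0 T x : T0 <= T ->
    (forall t, t <= T0 -> output (exec G s cap adv r t v) = None \/
                          output (exec G s cap adv r t v) = Some x) ->
    output (exec G s cap adv r T0 v) = Some x ->
  decided G s cap adv r T v = Some x.
Proof.
move=> le_T safe fin.
have decS t : decided G s cap adv r t.+1 v =
    if decided G s cap adv r t v is Some y then Some y
    else output (exec G s cap adv r t.+1 v) by [].
have safe' t : t <= T0 -> decided G s cap adv r t v = None \/
                          decided G s cap adv r t v = Some x.
  elim: t => [|t IH] le_t; first exact: safe.
  by rewrite decS; case: (IH (ltnW le_t)) => ->; [apply: safe|right].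
have fin' : decided G s cap adv r T0 v = Some x.
  case: (T0) fin safe' => [//|t] fin safe'; rewrite decS.
  by case: (safe' t (leqnSn t)) => ->.
rewrite -(subnK le_T); elim: (T - T0) => [//|j IH].
by rewrite addSn decS IH.
Qed.

End Decision.

(** * Good seeds lead to correct outputs *)

Section Success.

Variables (Q cap n : nat) (G : rel 'I_n) (s : 'I_n) (a : nat).
Variable delta : 'I_n -> nat.
Hypotheses (symG : symmetric G).
Hypothesis deltaP : forall v, is_distb G s v (delta v).
Notation step := (@vstep n (tnode n) msg (@vstate n) (@vsend n) (@vrecv n)).
Notation Y0 := (init_state G s).
Notation Y := (fun tau => iter tau step Y0).

Lemma vexec_iter tau : vexec (@vsend n) (@vrecv n) Y0 tau = iter tau step Y0.
Proof. by elim: tau => //= tau ->. Qed.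

Lemma run_success (adv : Adv (bfs_alg Q) n) (f : Rnd (bfs_alg Q) n) k T0 T :
    valid_adv cap adv ->
    width (packet n (tnode n) (code n)) Q <= cap ->
    run G s delta Y0 k T0 -> T0 <= T ->
    (forall w, r_dist (Y k (inl w)) = Some (delta w, parent G s delta w)) ->
    (forall tau, tau < k -> good_step cap Q (step_len s (Y tau)) (vmsgs (@vsend n) (Y tau)) f) ->
  bfs_success G s cap adv f T.
Proof.
move=> vadv wcap [fine lenT] leT fin good; have n_gt0 := size_gt0 s.
pose len tau := step_len s (Y tau).
pose ex t : 'I_n -> nstate (maxlen n) msg (@vstate n) := exec G s cap adv f t.
have sync tau : tau < k -> forall w : 'I_n,
    (vlen (vexec (@vsend n) (@vrecv n) Y0 tau (inl w))).+1 = len tau.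
  by move=> lt w; have [ph ok] := fine _ lt; rewrite vexec_iter; apply: (ok_sync ok).
have good' tau : tau < k ->
    good_step cap Q (len tau) (vmsgs (@vsend n) (vexec (@vsend n) (@vrecv n) Y0 tau)) f.
  by move=> lt; rewrite vexec_iter; apply: good.
have decK tau p m : tau < k ->
    vmsg (@vsend n) (vexec (@vsend n) (@vrecv n) Y0 tau) p = Some m -> dec (enc n m) = m.
  by move=> lt; rewrite vexec_iter; have [ph ok] := fine _ lt; apply: (ok_dec ok).
have ex0 : at_round (@vsend n) f Y0 1 0 (ex 0).
  move=> w; split=> //; last by move=> x' x _; rewrite ffunE.
  by case=> [u|y] //= /eqP ->.
have exS t w : exists l,
  [/\ subseq l (nincoming (@enc n) Q (@vsend n) (@vlen n) cap (ex t) w),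
      size l = minn (size (nincoming (@enc n) Q (@vsend n) (@vlen n) cap (ex t) w)) cap
    & ex t.+1 w = nrecv (@dec n) Q (@vrecv n) (@vlen n) (ex t w) l].
  exists (adv f t w (nincoming (@enc n) Q (@vsend n) (@vlen n) cap (ex t) w)).
  have [h1 h2] := vadv f t w (nincoming (@enc n) Q (@vsend n) (@vlen n) cap (ex t) w).
  by split.
have nidE t w : nid (ex t w) = w.
  elim: t => // t IH; have [l [_ _ ->]] := exS t w.
  by rewrite /nrecv; case: (_ == nlen _ _).
have T0E : start_time len k = T0 by rewrite -lenT.
apply/forallP => v; rewrite (@decided_first _ _ _ _ _ _ _ v T0 T (delta v, parent G s delta v)) //.
- exact: (bfs_dist_correct symG deltaP).
- move=> t; rewrite -T0E => le_t.
  have [tau le_tau obs] := observe_run n_gt0 sync good' wcap decK ex0 exS le_t.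
  have -> : output (exec G s cap adv f t v) = r_dist (Y tau (inl v)).
    by rewrite /= -[exec _ _ _ _ _ _ _]/(ex t v) nidE obs vexec_iter.
  move: le_tau; rewrite leq_eqVlt => /orP [/eqP ->|lt]; first by right; apply: fin.
  (* An early output cannot be wrong: every intermediate state shows [bfs_dist ph], which is either
     undecided or final. *)
  have [ph ok] := fine _ lt; rewrite (ok_dist ok) /bfs_dist; case: ifP; by [right|left].
- have := at_round_start n_gt0 sync good' wcap decK ex0 exS (leqnn k) v.
  rewrite T0E => -[e1 _ _ e4 _].
  rewrite /= -[exec _ _ _ _ _ _ _]/(ex T0 v) e1 e4 ?vexec_iter //=.
Qed.

End Success.

Theorem theorem5p3 :
  forall c : nat, 0 < c ->
  exists (A : NCCAlg) (K C : nat),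
    (forall n, 0 < #|Rnd A n|) /\
    forall (n : nat) (G : rel 'I_n) (s : 'I_n) (a D : nat),
      symmetric G -> irreflexive G ->
      is_arboricity G a -> is_diameter G D ->
      forall adv : Adv A n, valid_adv (K * logc n) adv ->
        #|[set r : Rnd A n |
            ~~ bfs_success G s (K * logc n) adv r (C * (a + D + logc n) * logc n)]|
          * n ^ c <= #|Rnd A n|.
Proof.
(* The extra 22 pays for the union bound. [Q] is 4 combinations of endpoint kinds, times 32 colours,
   times the threshold [2 * e] of a class. *)
move=> c c_gt0; pose e := c + 22; pose Q := 4 * 32 * (2 * e).
have e_gt0 : 0 < e by rewrite /e addnS.
(* The first summand covers send and receive loads, the second the width of a message with [Q]
   packets. *)
pose K := 4 * 32 * (e + 32) + (18 * Q + 1).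
exists (bfs_alg Q), K, 30; split.
  by move=> n; rewrite card_ffun card_ord expn_gt0 fact_gt0.
move=> n G s a D symG irrG [arbG _] [diamG _] adv vadv.
have n_gt0 := size_gt0 s.
have [delta deltaD deltaP] : exists2 delta : 'I_n -> nat,
    forall v, delta v <= D & forall v, is_distb G s v (delta v).
  by have [d h] := fin_all_exists2 (diamG s); exists d => v; case: (h v).
pose E := \max_v delta v.
have deltaE v : delta v <= E by apply: leq_bigmax.
have leEn : E <= n by apply/bigmax_leqP => v _; apply: ltnW; apply: (delta_lt deltaP).
have leED : E <= D by apply/bigmax_leqP.
have [k [T [lek leT rn fin]]] := whole_run symG irrG arbG deltaP deltaE leEn.
set cap := K * logc n; set Tmax := 30 * (a + D + logc n) * logc n.
have leTmax : T <= Tmax.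
  by apply: leq_trans leT _; rewrite leq_mul2r leq_mul2l leq_add2r leq_add2l leED !orbT.
have wcap : width (packet n (tnode n) (code n)) Q <= cap.
  by apply: leq_trans (width_packet n Q) _; rewrite leq_mul2r leq_addl orbT.
pose Y tau := iter tau (@vstep n (tnode n) msg (@vstate n) (@vsend n) (@vrecv n)) (init_state G s).
pose q1 := (e + 32) * logc n.
pose bad tau := [set f : seed n (maxlen n) (tnode n) |
  ~~ good_step (4 * 32 * q1) Q (step_len s (Y tau)) (vmsgs (@vsend n) (Y tau)) f].
have badE tau : tau < k -> #|bad tau| * n ^ e <= 512 * n ^ 2 * maxlen n * #|seed n (maxlen n) (tnode n)|.
  move=> lt; have [ph ok] := (proj1 rn) _ lt.
  have nN : n <= maxlen n by rewrite /maxlen; nia.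
  have h1 : 8 * (4 * logc n) <= q1 by rewrite /q1; nia.
  have h2 : n ^ e <= 2 ^ q1.
    apply: (@leq_trans ((2 ^ logc n) ^ e)); first by rewrite leq_exp2r // ltnW // ltn_exp_logc.
    by rewrite -expnM leq_exp2l // /q1; nia.
  (* By [logc_sq] the left side is at most [256 * n], and [e] is at least 16. *)
  have h3 : 4 * (4 * logc n) ^ 2 <= e ^ 2 * n.
    have := logc_sq n_gt0; have : 16 ^ 2 <= e ^ 2 by rewrite leq_exp2r // /e; lia.
    by rewrite expnMn; nia.
  have := card_bad_step n_gt0 nN (@vcol_sep n) (@vallowed_neq n) (ok_len ok) (ok_load ok) isT h1 h2 e_gt0 h3.
  rewrite !card_prod !card_bool => h; apply: leq_trans h _.
  rewrite leq_mul2r; apply/orP; right; apply: leq_mul => //.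
  by case/andP: (ok_len ok).
have sub : [set r : Rnd (bfs_alg Q) n | ~~ bfs_success G s cap adv r Tmax]
    \subset \bigcup_(tau < k) bad tau.
  apply/subsetP => f; rewrite inE; apply: contraR => nbad.
  apply: (run_success symG deltaP vadv wcap rn leTmax fin) => tau lt.
  apply: (@good_step_mono _ _ _ (4 * 32 * q1)).
    by rewrite /q1 mulnA leq_mul2r leq_addr orbT.
  apply: contraR nbad => h; apply/bigcupP; exists (Ordinal lt) => //.
  by rewrite inE.
(* For one node the claim is trivial. Otherwise [2 <= n], and constants can be absorbed into powers
   of [n]. *)
case: (ltnP 1 n) => [n_gt1|n_le1]; last first.
  have n1 : n = 1 by lia.
  have -> : n ^ c = 1 by rewrite [X in X ^ _]n1 exp1n.
  by rewrite muln1 max_card.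
have total_bad : #|\bigcup_(tau < k) bad tau| * n ^ e <=
    21 * n ^ 2 * (512 * n ^ 2 * maxlen n * #|seed n (maxlen n) (tnode n)|).
  apply: (@leq_trans (\sum_(tau < k) #|bad tau| * n ^ e)).
    by rewrite -big_distrl leq_mul2r card_bigcup_leq orbT.
  set B := (X in _ <= _ * X); apply: (@leq_trans (\sum_(tau < k) B)).
    by apply: leq_sum => tau _; apply: badE.
  by rewrite sum_nat_const card_ord leq_mul2r lek orbT.
(* Of the spare [n ^ 22], the part [n ^ 6] pays for the steps, the pairs of nodes and the rounds of
   a step, and [n ^ 16] for the constant [21 * 512 * 6], which is below [2 ^ 16]. *)
rewrite -(@leq_pmul2r (n ^ 22)) ?expn_gt0 ?n_gt0 // -mulnA -expnD -/e.
apply: leq_trans (leq_mul (subset_leq_card sub) (leqnn _)) _.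
apply: leq_trans total_bad _.
rewrite -[Rnd _ _]/(seed n (maxlen n) (tnode n)) [X in _ <= X]mulnC !mulnA leq_mul2r; apply/orP; right.
have le6 : maxlen n <= 6 * n ^ 2 by rewrite /maxlen; nia.
apply: (@leq_trans (2 ^ 16 * n ^ 6)).
  apply: (@leq_trans (21 * n * n * 512 * n * n * (6 * n ^ 2))).
    by rewrite leq_mul2l le6 orbT.
  have -> : 21 * n * n * 512 * n * n * (6 * n ^ 2) = 21 * 512 * 6 * n ^ 6.
    have -> : n ^ 6 = n * n * (n * n) * (n * n).
      by rewrite -[6]/(2 + 2 + 2) !expnD -!mulnn.
    by rewrite -mulnn; lia.
  rewrite leq_mul2r mulnAC; apply/orP; right.
  by rewrite -[16]/(7 + 9) expnD leq_mul.
rewrite -[22]/(16 + 6) expnD leq_mul2r leq_exp2r // n_gt1 orbT //.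
Qed.
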